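(* Assume $d\ge 4$ and let $q>1$ be real. If $Z$ is a standard normal variable, then, as $n\to\infty$, $$\frac{\|l_n\|_q^q-n\,\kappa(q,d)}{\sqrt{n\, v(q,d)}}\ \stackrel{\text{law}}{\longrightarrow}\ Z .$$
   Context: $\{S(n),\ n\in\mathbb{N}\}$ is the simple (nearest-neighbour, symmetric) random walk on $\mathbb{Z}^d$ started at the origin, with law $P$, expectation $E$ and variance $\operatorname{var}$. Its local times are $l_n(z)=\sum_{k=0}^{n-1}\mathbf{1}_{\{S(k)=z\}}$ for $z\in\mathbb{Z}^d$, and $\|l_n\|_q^q=\sum_{z\in\mathbb{Z}^d} l_n(z)^q$. The constants are $\kappa(q,d)=\gamma_d\,E[l_\infty(0)^q]$, where $\gamma_d=P(S(k)\ne 0\ \text{for all } k\ge 1)$ and $l_\infty(0)=\sum_{k\ge 0}\mathbf{1}_{\{S(k)=0\}}$, and $v(q,d)=\lim_{n\to\infty}\operatorname{var}(\|l_n\|_q^q)/n$, which for $d\ge 4$ exists and is a positive finite number. *)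

(* Defs.v *)
From HB Require Import structures.
From mathcomp Require Import all_boot all_order all_algebra.
From mathcomp Require Import all_classical all_reals all_analysis.

Set Implicit Arguments.
Unset Strict Implicit.
Unset Printing Implicit Defensive.
Import Order.TTheory GRing.Theory Num.Theory.
Import numFieldNormedType.Exports.
Local Open Scope classical_set_scope.
Local Open Scope ring_scope.

(* Random elements of a countable set [E] carry the discrete sigma-algebra:
   every subset of [E] is measurable. *)
Definition discrete_measurable (disp : measure_display)
    (T : measurableType disp) (E : Type) (X : T -> E) : Prop :=
  forall A : set E, measurable (X @^-1` A).

Definition mutually_independent (R : realType) (disp : measure_display)
    (T : measurableType disp) (P : probability T R) (E : Type)
    (X : nat -> T -> E) : Prop :=
  forall (J : seq nat) (A : nat -> set E), uniq J ->
    P (\big[setI/setT]_(k <- J) (X k @^-1` A k)) =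
    (\prod_(k <- J) P (X k @^-1` A k))%E.

Definition unit_vector (d : nat) (i : 'I_d) : 'rV[int]_d := delta_mx ord0 i.

Definition walk_step (disp : measure_display) (T : measurableType disp)
    (d : nat) (S : nat -> T -> 'rV[int]_d) (k : nat) (w : T) : 'rV[int]_d :=
  S k.+1 w - S k w.

(* The 2d unit vectors carry total mass 1, so [srw_unif_pos] and
   [srw_unif_neg] determine the law of a step. *)
Record simple_random_walk (R : realType) (disp : measure_display)
    (T : measurableType disp) (P : probability T R) (d : nat)
    (S : nat -> T -> 'rV[int]_d) : Prop := SimpleRandomWalk {
  srw_measurable : forall n, discrete_measurable (S n);
  srw_start : forall w, S 0%N w = 0;
  srw_unif_pos : forall k (i : 'I_d),
    P (walk_step S k @^-1` [set unit_vector i]) = ((d.*2%:R)^-1)%:E;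
  srw_unif_neg : forall k (i : 'I_d),
    P (walk_step S k @^-1` [set - unit_vector i]) = ((d.*2%:R)^-1)%:E;
  srw_indep : mutually_independent P (walk_step S)
}.

Definition local_time (T : Type) (d : nat) (S : nat -> T -> 'rV[int]_d)
    (n : nat) (z : 'rV[int]_d) (w : T) : nat :=
  (\sum_(0 <= k < n) (S k w == z))%N.

(* ||l_n||_q^q.  For q <> 0 the summand vanishes off the finite range
   {S 0, ..., S n.-1}, so this sum over the finite support is the sum over
   the whole lattice. *)
Definition local_time_norm (R : realType) (T : Type) (d : nat)
    (S : nat -> T -> 'rV[int]_d) (q : R) (n : nat) (w : T) : R :=
  \sum_(z \in [set: 'rV[int]_d]) (local_time S n z w)%:R `^ q.

Definition local_time_oo (R : realType) (T : Type) (d : nat)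
    (S : nat -> T -> 'rV[int]_d) (w : T) : \bar R :=
  (\sum_(0 <= k <oo) ((S k w == 0)%:R : R)%:E)%E.

Definition escape_probability (R : realType) (disp : measure_display)
    (T : measurableType disp) (P : probability T R) (d : nat)
    (S : nat -> T -> 'rV[int]_d) : R :=
  fine (P [set w | forall k : nat, (1 <= k)%N -> S k w <> 0]).

Definition kappa (R : realType) (disp : measure_display)
    (T : measurableType disp) (P : probability T R) (d : nat)
    (S : nat -> T -> 'rV[int]_d) (q : R) : R :=
  escape_probability P S * fine (\int[P]_w (local_time_oo R S w `^ q))%E.

Definition limit_variance (R : realType) (disp : measure_display)
    (T : measurableType disp) (P : probability T R) (d : nat)
    (S : nat -> T -> 'rV[int]_d) (q : R) : R :=
  lim (fine ('V_P[local_time_norm S q n])%E / n%:R @[n --> \oo]).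

(* The variables X n and Z may live on different probability spaces. *)
Definition cvg_in_law (R : realType)
    (disp : measure_display) (T : measurableType disp) (P : probability T R)
    (disp' : measure_display) (T' : measurableType disp')
    (P' : probability T' R) (X : nat -> T -> R) (Z : T' -> R) : Prop :=
  forall f : R -> R, continuous f -> (exists M : R, forall x, `|f x| <= M) ->
    ('E_P[f \o X n] @[n --> \oo] --> 'E_P'[f \o Z])%E.

Definition standard_normal (R : realType)
    (disp : measure_display) (T : measurableType disp) (P : probability T R)
    (Z : {RV P >-> R}) : Prop :=
  forall A : set R, measurable A -> distribution P Z A = normal_prob 0 1 A.

(* Main.v *)
(** The walk is coded by its word of steps, and expectations become uniform
averages over words, so that disjoint blocks of letters are independent.
Write [X w] for the sum of the [q]-th powers of the local times of [w].

Since [d >= 4], the heat kernel decays like [n^-2] and the truncated Green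
function [G_n] satisfies [sum_z G_n(z)^2 = O(log n)]. A Khas'minskii-type
induction bounds the exponential moments of local times at one and at two
points, hence the second moment of the cross term [X (u ++ v) - X u - X v]; we
only keep the crude rate [n^(1/4)] for its L2 norm. So [X] is almost additive.
Cutting [n] dyadically into blocks of length [m] shows that, in L2, the centered
[X] is the sum of the [n / m] independent centered block contributions up to
[(C m^(-1/4) + o(1)) sqrt n]. This gives the convergence of the variance divided
by [n], the bound [E X - n kappa = O(n^(1/4))] (the constant being identified by
decomposing at the last visit to each site), and reduces the theorem to the
central limit theorem for sums of bounded independent blocks, proved by Stein's
method. The limit variance is positive because replacing an excursion that
shuttles across one edge by one that walks away and back changes [X] by a
definite amount in mean, whatever the rest of the path: correlate [X] with the
number of blocks of the first kind minus that of the second kind. *)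

Require Import Defs.
From HB Require Import structures.
From mathcomp Require Import all_boot all_order all_algebra.
From mathcomp Require Import all_classical all_reals all_analysis.
From mathcomp Require Import measurable_realfun.
From mathcomp Require Import ring lra zify.

Set Implicit Arguments.
Unset Strict Implicit.
Unset Printing Implicit Defensive.
Import Order.TTheory GRing.Theory Num.Theory.
Import numFieldNormedType.Exports.
Local Open Scope classical_set_scope.
Local Open Scope ring_scope.

(** For real [q] the powers have no multinomial expansion. What the cross term uses of [phi k = k^q]
    is superadditivity, and the domination of [phi (a + b) - phi a - phi b] by a product of two
    factors [(1 + l)^k - 1], each vanishing at 0. Past and future of a cut are independent, so
    moments of such products factor, and only sites visited by both sides contribute. Squaring the
    cross term calls for joint moments at two sites [z], [y]; their decay [G (z - y)] keeps the
    double sum over sites below a multiple of [(sum G^2)^2]. Any rate [n^a] with [a < 1/2] would do: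
    halving multiplies independent errors by [sqrt 2], so the errors of the successive levels form a
    geometric series dominated by the smallest blocks. Limits are taken in [n] first, with the block
    length [m] fixed: blocks are then bounded, as Stein's method requires. Its test functions are
    made uniformly continuous so that closeness in L2 is enough to pass from the block sum to
    [X]. *)

Lemma eq_ler disp (T : porderType disp) (x y : T) : x = y -> (x <= y)%O.
Proof. by move=> ->. Qed.

(** * Averages over words *)

Section UniformExpectation.
Variables (R : rcfType) (V : finType).
Implicit Types (F G : seq V -> R) (n : nat).

(** Recursion on the length rather than a sum over tuples: conditioning on the first letter is
    definitional, functionals live on words of every length, and splitting a word needs no cast. *)
Fixpoint Ex n F : R :=
  if n is n'.+1 then #|V|%:R^-1 * \sum_(s : V) Ex n' (fun w => F (s :: w))
  else F [::].

Lemma ExO F : Ex 0 F = F [::].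
Proof. by []. Qed.

Lemma ExS n F :
  Ex n.+1 F = #|V|%:R^-1 * \sum_(s : V) Ex n (fun w => F (s :: w)).
Proof. by []. Qed.

Lemma eq_Ex n F G :
  (forall w, size w = n -> F w = G w) -> Ex n F = Ex n G.
Proof.
elim: n F G => [|n IH] F G FG /=; first exact: FG.
by congr (_ * _); apply: eq_bigr => s _; apply: IH => w sw; apply: FG; rewrite /= sw.
Qed.

Lemma ExD n F G : Ex n (fun w => F w + G w) = Ex n F + Ex n G.
Proof.
elim: n F G => [//|n IH] F G /=; rewrite -mulrDr -big_split /=.
by congr (_ * _); apply: eq_bigr => s _; rewrite IH.
Qed.

Lemma ExZ n c F : Ex n (fun w => c * F w) = c * Ex n F.
Proof.
elim: n F => [//|n IH] F /=; rewrite [RHS]mulrCA [in RHS]mulr_sumr.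
by congr (_ * _); apply: eq_bigr => s _; rewrite IH.
Qed.

Lemma ExZr n c F : Ex n (fun w => F w * c) = Ex n F * c.
Proof. by rewrite mulrC -ExZ; apply: eq_Ex => w _; rewrite mulrC. Qed.

Lemma ExN n F : Ex n (fun w => - F w) = - Ex n F.
Proof. by rewrite -mulN1r -ExZ; apply: eq_Ex => w _; rewrite mulN1r. Qed.

Lemma ExB n F G : Ex n (fun w => F w - G w) = Ex n F - Ex n G.
Proof. by rewrite ExD ExN. Qed.

Lemma le_Ex n F G :
  (forall w, size w = n -> F w <= G w) -> Ex n F <= Ex n G.
Proof.
elim: n F G => [|n IH] F G FG /=; first exact: FG.
rewrite ler_wpM2l ?invr_ge0 ?ler0n//; apply: ler_sum => s _.
by apply: IH => w sw; apply: FG; rewrite /= sw.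
Qed.

Lemma Ex0 n : Ex n (fun=> 0) = 0.
Proof. by rewrite -[RHS](mul0r (Ex n (fun=> 1))) -ExZ; apply: eq_Ex => w _; rewrite mul0r. Qed.

Lemma Ex_ge0 n F : (forall w, size w = n -> 0 <= F w) -> 0 <= Ex n F.
Proof. by move=> F0; rewrite -[X in X <= _](Ex0 n); exact: le_Ex. Qed.

Lemma Ex_sum n (I : Type) (r : seq I) (Q : pred I) (F : I -> seq V -> R) :
  Ex n (fun w => \sum_(i <- r | Q i) F i w) = \sum_(i <- r | Q i) Ex n (F i).
Proof.
elim: r => [|i r IH].
  by rewrite [RHS]big_nil -[RHS](Ex0 n); apply: eq_Ex => w _; rewrite big_nil.
rewrite big_cons -IH; case: ifP => Qi.
  by rewrite -ExD; apply: eq_Ex => w _; rewrite big_cons Qi.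
by apply: eq_Ex => w _; rewrite big_cons Qi.
Qed.

Lemma Ex_cat a b F : Ex (a + b) F = Ex a (fun u => Ex b (fun v => F (u ++ v))).
Proof.
elim: a F => [//|a IH] F; rewrite addSn !ExS; congr (_ * _).
by apply: eq_bigr => s _; rewrite IH.
Qed.

Lemma Ex_exchange a b (F : seq V -> seq V -> R) :
  Ex a (fun u => Ex b (F u)) = Ex b (fun v => Ex a (F^~ v)).
Proof.
elim: a F => [//|a IH] F; rewrite ExS.
under eq_bigr => s _ do rewrite IH.
by rewrite -Ex_sum -ExZ; apply: eq_Ex => v _.
Qed.

Lemma Ex_rcons n F :
  Ex n.+1 F = Ex n (fun w => #|V|%:R^-1 * \sum_(s : V) F (rcons w s)).
Proof.
rewrite -addn1 Ex_cat; apply: eq_Ex => w _ /=.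
by congr (_ * _); apply: eq_bigr => s _; rewrite cats1.
Qed.

Lemma Ex_rev n F : Ex n (fun w => F (rev w)) = Ex n F.
Proof.
elim: n F => [//|n IH] F; rewrite ExS Ex_rcons ExZ Ex_sum; congr (_ * _).
apply: eq_bigr => s _; rewrite -(IH (fun w => F (rcons w s))).
by apply: eq_Ex => w _; rewrite rev_cons.
Qed.

Hypothesis V0 : (0 < #|V|)%N.

Let cV0 : #|V|%:R != 0 :> R.
Proof. by rewrite pnatr_eq0 -lt0n. Qed.

Lemma avg_cst (c : R) : #|V|%:R^-1 * \sum_(s : V) c = c.
Proof. by rewrite sumr_const -[c *+ _]mulr_natl mulKf. Qed.

Lemma Ex_cst n c : Ex n (fun=> c) = c.
Proof. by elim: n => [//|n IH]; rewrite ExS IH avg_cst. Qed.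

Lemma Ex_take a b F : Ex (a + b) (fun w => F (take a w)) = Ex a F.
Proof.
rewrite Ex_cat; apply: eq_Ex => u su.
rewrite -[RHS](Ex_cst b); apply: eq_Ex => v _; by rewrite take_size_cat.
Qed.

Lemma Ex_prod a b F G :
  Ex a (fun u => Ex b (fun v => F u * G v)) = Ex a F * Ex b G.
Proof. by rewrite -ExZr; apply: eq_Ex => u _; rewrite ExZ. Qed.

Lemma Ex_norm n F : `|Ex n F| <= Ex n (fun w => `|F w|).
Proof.
rewrite ler_norml -ExN; apply/andP; split; apply: le_Ex => w _.
  by rewrite lerNl -normrN ler_norm.
exact: ler_norm.
Qed.

Lemma Ex_cauchy_schwarz n F G :
  Ex n (fun w => F w * G w) ^+ 2 <=
  Ex n (fun w => F w ^+ 2) * Ex n (fun w => G w ^+ 2).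
Proof.
set A := Ex n (fun w => F w ^+ 2); set B := Ex n (fun w => G w ^+ 2).
set C := Ex n _.
have A0 : 0 <= A by apply: Ex_ge0 => w _; exact: sqr_ge0.
have B0 : 0 <= B by apply: Ex_ge0 => w _; exact: sqr_ge0.
have quad x y : 0 <= x ^+ 2 * A - 2 * x * y * C + y ^+ 2 * B.
  rewrite -!ExZ -ExB -ExD; apply: Ex_ge0 => w _.
  rewrite (_ : _ + _ = (x * F w - y * G w) ^+ 2) ?sqr_ge0//; ring.
have [B00|Bn0] := eqVneq B 0.
  have [->|Cn0] := eqVneq C 0; first by rewrite expr0n/= mulr_ge0.
  (* When [B = 0] the form is affine in [y], and this value of [y] makes it equal to [-1]. *)
  have := quad 1 ((A + 1) / (2 * C)); rewrite B00.
  have -> : 1 ^+ 2 * A - 2 * 1 * ((A + 1) / (2 * C)) * C + ((A + 1) / (2 * C)) ^+ 2 * 0 = -1.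
    by field; rewrite Cn0.
  by rewrite lerNr oppr0 ler10.
have Bp : 0 < B by rewrite lt0r Bn0.
have := quad B C.
have -> : B ^+ 2 * A - 2 * B * C * C + C ^+ 2 * B = B * (A * B - C ^+ 2) by ring.
by rewrite pmulr_rge0// subr_ge0.
Qed.

Definition norm2 n F : R := Num.sqrt (Ex n (fun w => F w ^+ 2)).

Lemma norm2_ge0 n F : 0 <= norm2 n F. Proof. exact: sqrtr_ge0. Qed.

Lemma norm2_sq n F : norm2 n F ^+ 2 = Ex n (fun w => F w ^+ 2).
Proof. by rewrite sqr_sqrtr//; apply: Ex_ge0 => w _; exact: sqr_ge0. Qed.

Lemma eq_norm2 n F G :
  (forall w, size w = n -> F w = G w) -> norm2 n F = norm2 n G.
Proof. by move=> FG; congr (Num.sqrt _); apply: eq_Ex => w sw; rewrite FG. Qed.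

Lemma norm2_le n F (c : R) : 0 <= c ->
  (norm2 n F <= c) = (Ex n (fun w => F w ^+ 2) <= c ^+ 2).
Proof. by move=> c0; rewrite -norm2_sq ler_pXn2r// nnegrE norm2_ge0. Qed.

Lemma Ex_le_norm2 n F G : Ex n (fun w => F w * G w) <= norm2 n F * norm2 n G.
Proof.
apply: le_trans (ler_norm _) _.
rewrite -(@ler_pXn2r _ 2)// ?nnegrE ?mulr_ge0 ?norm2_ge0//.
by rewrite real_normK ?num_real// exprMn !norm2_sq Ex_cauchy_schwarz.
Qed.

Lemma ler_norm2D n F G : norm2 n (fun w => F w + G w) <= norm2 n F + norm2 n G.
Proof.
rewrite norm2_le ?addr_ge0 ?norm2_ge0// sqrrD !norm2_sq.
have -> : Ex n (fun w => (F w + G w) ^+ 2) = Ex n (fun w => F w ^+ 2)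
    + Ex n (fun w => F w * G w) *+ 2 + Ex n (fun w => G w ^+ 2).
  by rewrite mulr2n -!ExD; apply: eq_Ex => w _; ring.
by rewrite lerD2r lerD2l lerMn2r/= Ex_le_norm2.
Qed.

Lemma norm2Z n c F : norm2 n (fun w => c * F w) = `|c| * norm2 n F.
Proof.
rewrite /norm2 -sqrtr_sqr -sqrtrM ?sqr_ge0// -ExZ.
by congr Num.sqrt; apply: eq_Ex => w _; rewrite exprMn.
Qed.

Lemma norm2N n F : norm2 n (fun w => - F w) = norm2 n F.
Proof. by congr Num.sqrt; apply: eq_Ex => w _; rewrite sqrrN. Qed.

Lemma ler_norm2B n F G : `|norm2 n F - norm2 n G| <= norm2 n (fun w => F w - G w).
Proof.
have H F' G' : norm2 n F' - norm2 n G' <= norm2 n (fun w => F' w - G' w).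
  rewrite lerBlDr; apply: le_trans (ler_norm2D _ _ _).
  by apply/eq_ler/eq_norm2 => w _; rewrite subrK.
rewrite ler_norml H andbT lerNl opprB; apply: le_trans (H _ _) _.
by rewrite -norm2N; apply/eq_ler/eq_norm2 => w _; rewrite opprB.
Qed.

Lemma Ex_abs_le_norm2 n F : `|Ex n F| <= norm2 n F.
Proof.
rewrite -(@ler_pXn2r _ 2)// ?nnegrE ?norm2_ge0// real_normK ?num_real// norm2_sq.
have := Ex_cauchy_schwarz n F (fun=> 1); rewrite Ex_cst expr1n mulr1.
apply: le_trans; apply: eq_ler.
by congr (_ ^+ 2); apply: eq_Ex => w _; rewrite mulr1.
Qed.

Lemma Ex_sq_center n F (c := Ex n F) :
  Ex n (fun w => (F w - c) ^+ 2) = Ex n (fun w => F w ^+ 2) - c ^+ 2.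
Proof.
have -> : Ex n (fun w => (F w - c) ^+ 2) =
    Ex n (fun w => F w ^+ 2) - (2 * c) * Ex n F + Ex n (fun=> c ^+ 2).
  by rewrite -ExZ -ExB -ExD; apply: eq_Ex => w _; ring.
rewrite Ex_cst -/c; ring.
Qed.

Lemma norm2_center n F : norm2 n (fun w => F w - Ex n F) <= norm2 n F.
Proof. by rewrite norm2_le ?norm2_ge0// norm2_sq Ex_sq_center gerBl sqr_ge0. Qed.

Lemma Ex_sq_indep a b F G : Ex a F = 0 ->
  Ex a (fun u => Ex b (fun v => (F u + G v) ^+ 2)) =
  Ex a (fun u => F u ^+ 2) + Ex b (fun v => G v ^+ 2).
Proof.
move=> F0.
transitivity (Ex a (fun u => F u ^+ 2 + 2 * (F u * Ex b G) + Ex b (fun v => G v ^+ 2))).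
  apply: eq_Ex => u _.
  rewrite -[F u ^+ 2](Ex_cst b) -!ExZ -!ExD; apply: eq_Ex => v _; ring.
by rewrite !ExD ExZ ExZr F0 mul0r mulr0 addr0 Ex_cst.
Qed.

End UniformExpectation.

Arguments Ex {R V} n F : simpl never.

(** * Heat kernel of the simple walk *)

Section Walk.
Variables (R : rcfType) (V : finType) (L : zmodType) (st : V -> L).

Definition pos (w : seq V) : L := \sum_(s <- w) st s.

Lemma pos_nil : pos [::] = 0. Proof. exact: big_nil. Qed.

Lemma pos_cons s w : pos (s :: w) = st s + pos w.
Proof. by rewrite /pos big_cons. Qed.

Lemma pos_cat u v : pos (u ++ v) = pos u + pos v.
Proof. by rewrite /pos big_cat. Qed.

Lemma pos_rev w : pos (rev w) = pos w.
Proof. by apply: perm_big; rewrite perm_rev. Qed.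

Definition hk n z : R := Ex n (fun w => (pos w == z)%:R).

Lemma hk0 z : hk 0 z = (z == 0)%:R.
Proof. by rewrite /hk ExO pos_nil eq_sym. Qed.

Lemma hkS n z : hk n.+1 z = #|V|%:R^-1 * \sum_(s : V) hk n (z - st s).
Proof.
rewrite /hk ExS; congr (_ * _); apply: eq_bigr => s _; apply: eq_Ex => w _.
rewrite pos_cons; congr (_%:R); congr nat_of_bool; apply/eqP/eqP => [<-|->].
  by rewrite addrC addKr.
by rewrite addrC subrK.
Qed.

Lemma hk_ge0 n z : 0 <= hk n z.
Proof. by apply: Ex_ge0 => w _; rewrite ler0n. Qed.

End Walk.

(** * Central binomial coefficients *)

Lemma bin_le_half N k : ('C(N, k) <= 'C(N, N./2))%N.
Proof.
have up m : (m <= N./2)%N -> ('C(N, m) <= 'C(N, N./2))%N.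
  move=> mh; rewrite -(subKn mh); elim: (N./2 - m)%N => [|i IH]; first by rewrite subn0.
  have [hi|hi] := leqP (N./2) i.
    by apply: leq_trans IH; rewrite (eqP (hi : _ - _ == 0)%N) (_ : _ - _ = 0)%N//; lia.
  apply: leq_trans IH; set j := (N./2 - i.+1)%N.
  have -> : (N./2 - i = j.+1)%N by rewrite /j; lia.
  have := mul_bin_left N j => E.
  rewrite -(@leq_pmul2l j.+1)// E leq_mul2r; apply/orP; right.
  by rewrite /j; lia.
have [kh|kh] := leqP k (N./2); first exact: up.
have [kN|kN] := leqP k N; last by rewrite bin_small.
by rewrite -(bin_sub kN); apply: up; lia.
Qed.

(** The step multiplies the left side by [4 (2k+1)(2k+3) / (k+1)^2] and the right side by 16, and
    [(2k+1)(2k+3) = (2k+2)^2 - 1]. *)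
Lemma central_bin k : ('C(k.*2, k) ^ 2 * k.*2.+1 <= 4 ^ k.*2)%N.
Proof.
elim: k => [//|k IH].
have E : (k.+1 * 'C(k.*2.+2, k.+1) = 2 * k.*2.+1 * 'C(k.*2, k))%N.
  have e1 := mul_bin_diag k.*2.+2 k.
  have e2 := mul_bin_down k.*2.+1 k.
  have {}e2 : (k.*2.+1 * 'C(k.*2, k) = k.+1 * 'C(k.*2.+1, k))%N.
    by rewrite e2; congr (_ * _)%N; lia.
  by rewrite -e1 /= -mulnA e2 mulnA; congr (_ * _)%N; lia.
rewrite doubleS -(@leq_pmul2l (k.+1 ^ 2)) ?expn_gt0//.
rewrite mulnA -expnMn E (expnS 4) (expnS 4).
move: IH; set c := 'C(_, _); set p := (4 ^ _)%N => IH.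
have : (k.*2.+1 * k.*2.+3 * (4 * (c ^ 2 * k.*2.+1)) <= k.*2.+1 * k.*2.+3 * (4 * p))%N.
  by rewrite !leq_mul2l IH !orbT.
have : (k.*2.+1 * k.*2.+3 * (4 * p) <= k.+1 ^ 2 * (4 * (4 * p)))%N.
  rewrite -!muln2; nia.
nia.
Qed.

(** The bound [C(N,k) / 2^N <= (N+1)^(-1/2)], squared to stay in the natural numbers. Odd [N]
    reduces to even [N] because [C(2h+1,h)] is half of [C(2h+2,h+1)]. *)
Lemma bin_sq_le N k : ('C(N, k) ^ 2 * N.+1 <= 4 ^ N)%N.
Proof.
apply: (@leq_trans ('C(N, N./2) ^ 2 * N.+1)).
  by rewrite leq_mul2r leq_exp2r ?bin_le_half ?orbT.
rewrite -(odd_double_half N); case: (odd N) => /=; rewrite ?add0n ?half_double ?add1n; last first.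
  exact: central_bin.
rewrite uphalf_double; set h := N./2.
have := central_bin h.+1; rewrite doubleS => H.
have E : ('C(h.*2.+2, h.+1) = 2 * 'C(h.*2.+1, h))%N.
  rewrite binS -[X in (X + _)%N](bin_sub (n := h.*2.+1)); last by lia.
  by rewrite (_ : h.*2.+1 - h.+1 = h)%N ?mul2n ?addnn//; lia.
move: H; rewrite E expnMn (expnS 4) -mulnA leq_mul2l /=; set p := (4 ^ _)%N.
set c := ('C(_, _) ^ 2)%N; nia.
Qed.

Section HeatKernel.
Variable R : rcfType.

Fixpoint hk1 (N : nat) (x : int) : R :=
  if N is N'.+1 then (hk1 N' (x - 1) + hk1 N' (x + 1)) / 2 else (0 == x)%:R.

Lemma hk1_neq0 N x : hk1 N x != 0 -> exists k : nat, x = N%:Z - k%:Z *+ 2.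
Proof.
elim: N x => [|N IH] x /=.
  by have [<-|_] := eqVneq 0 x; [exists 0%N|rewrite eqxx].
have [E1|/IH[k Hk] _] := eqVneq (hk1 N (x - 1)) 0; last by exists k; lia.
have [E2|/IH[k Hk] _] := eqVneq (hk1 N (x + 1)) 0; last by exists k.+1; lia.
by rewrite E1 E2 addr0 mul0r eqxx.
Qed.

Lemma hk1_bin N k : hk1 N (N%:Z - k%:Z *+ 2) = 'C(N, k)%:R / 2 ^+ N.
Proof.
elim: N k => [|N IH] k.
  rewrite /= expr0 divr1; case: k => [//|k]; rewrite bin0n.
  by case: eqP => //; lia.
case: k => [|k] /=.
  have -> : N.+1%:Z - 0%:Z *+ 2 - 1 = N%:Z - 0%:Z *+ 2 by lia.
  rewrite IH !bin0 exprS; have -> : hk1 N (N.+1%:Z - 0%:Z *+ 2 + 1) = 0.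
    by apply/eqP/negPn/negP => /hk1_neq0[k]; lia.
  by field; rewrite expf_neq0//= pnatr_eq0.
have -> : N.+1%:Z - k.+1%:Z *+ 2 - 1 = N%:Z - k.+1%:Z *+ 2 by lia.
have -> : N.+1%:Z - k.+1%:Z *+ 2 + 1 = N%:Z - k%:Z *+ 2 by lia.
rewrite !IH binS natrD exprS; field; by rewrite expf_neq0//= pnatr_eq0.
Qed.

Lemma hk1_ge0 N x : 0 <= hk1 N x.
Proof. by elim: N x => [|N IH] x /=; rewrite ?ler0n// divr_ge0 ?addr_ge0. Qed.

Lemma hk1_le N x : hk1 N x <= Num.sqrt N.+1%:R^-1.
Proof.
have [->|/hk1_neq0[k ->]] := eqVneq (hk1 N x) 0; first exact: sqrtr_ge0.
rewrite hk1_bin -(@ler_pXn2r _ 2)// ?nnegrE ?sqrtr_ge0 ?divr_ge0 ?ler0n ?exprn_ge0//.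
rewrite sqr_sqrtr ?invr_ge0 ?ler0n// -(@ler_pM2r _ N.+1%:R) ?ltr0n// mulVf ?pnatr_eq0//.
rewrite exprMn exprVn -exprM mulnC exprM mulrAC ler_pdivrMr ?exprn_gt0 ?exprn_gt0//.
rewrite mul1r -!natrX -natrM ler_nat; exact: bin_sq_le.
Qed.

Section Multinomial.
Variable d : nat.
Hypothesis d0 : (0 < d)%N.
Let V := 'I_d.
Let V0 : (0 < #|V|)%N. Proof. by rewrite card_ord. Qed.

(* Size biasing of the multinomial counts: the letter [j] that the factor
   [count_mem j w] selects may be moved to the front. *)
Lemma size_bias n j (psi : seq V -> R) :
  (forall w w', perm_eq w w' -> psi w = psi w') ->
  Ex n.+1 (fun w => (count_mem j w)%:R * psi w) =
  n.+1%:R / d%:R * Ex n (fun w => psi (j :: w)).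
Proof.
elim: n psi => [|n IH] psi inv.
  rewrite ExS card_ord (bigD1 j)//= ExO /= eqxx mul1r big1 ?addr0 ?div1r ?ExO//.
  by move=> i ij; rewrite ExO /= (negbTE ij) mul0r.
rewrite ExS card_ord.
have -> : \sum_s Ex n.+1 (fun w => (count_mem j (s :: w))%:R * psi (s :: w)) =
   Ex n.+1 (fun w => psi (j :: w)) +
   \sum_s Ex n.+1 (fun w => (count_mem j w)%:R * psi (s :: w)).
  transitivity (\sum_s ((s == j)%:R * Ex n.+1 (fun w => psi (s :: w)) +
      Ex n.+1 (fun w => (count_mem j w)%:R * psi (s :: w)))).
    apply: eq_bigr => s _; rewrite -ExZ -ExD; apply: eq_Ex => w _ /=.
    by rewrite natrD mulrDl.
  rewrite big_split/=; congr (_ + _); rewrite (bigD1 j)//= eqxx mul1r big1 ?addr0//.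
  by move=> i ij; rewrite (negbTE ij) mul0r.
under eq_bigr => s _.
  rewrite (IH (fun w => psi (s :: w))); last by move=> w w' ww; apply: inv; rewrite perm_cons.
  over.
rewrite -mulr_sumr.
have -> : \sum_s Ex n (fun w => psi [:: s, j & w]) =
          d%:R * Ex n.+1 (fun w => psi (j :: w)).
  rewrite ExS card_ord mulrA divff ?mul1r ?pnatr_eq0 -?lt0n//.
  apply: eq_bigr => s _; apply: eq_Ex => w _; apply: inv.
  by rewrite -[_ :: _]/([:: s] ++ [:: j] ++ w) perm_catCA.
rewrite [n.+2%:R]mulrS; field; by rewrite pnatr_eq0 -lt0n.
Qed.

(** Size biasing read backwards: a factor [1/(count + 1)] is [1/count] after a letter [j] is added
    in front, so it can be traded for [d/(n+1)] and a word one letter longer, where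
    [count * count^-1 <= 1] (with [0^-1 = 0]). Each axis thus behaves as if it received [n/d]
    steps. *)
Lemma Ex_prod_inv n (J : seq V) : uniq J ->
  Ex n (fun w => \prod_(i <- J) (count_mem i w).+1%:R^-1) <=
  (d%:R / n.+1%:R) ^+ size J :> R.
Proof.
elim: J n => [|j J IH] n.
  by rewrite -[_ ^+ _](Ex_cst V0 n) => _; apply: le_Ex => w _; rewrite big_nil.
move=> /andP[jJ uJ].
pose psi (w : seq V) : R := (count_mem j w)%:R^-1 * \prod_(i <- J) (count_mem i w).+1%:R^-1.
have inv w w' : perm_eq w w' -> psi w = psi w'.
  move=> /permP ww; rewrite /psi ww; congr (_ * _); apply: eq_bigr => i _.
  by rewrite ww.
have := size_bias n j inv => SB.
have -> : Ex n (fun w => \prod_(i <- j :: J) (count_mem i w).+1%:R^-1) =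
          Ex n (fun w => psi (j :: w)).
  apply: eq_Ex => w _; rewrite big_cons /psi /= eqxx add1n; congr (_ * _).
  rewrite big_seq_cond [RHS]big_seq_cond; apply: eq_bigr => i; rewrite andbT => iJ.
  by case: eqP => // ji; rewrite ji iJ in jJ.
have -> : Ex n (fun w => psi (j :: w)) =
    d%:R / n.+1%:R * Ex n.+1 (fun w => (count_mem j w)%:R * psi w).
  rewrite SB mulrA -[LHS]mul1r; congr (_ * _); rewrite mulrA divfK ?divff// pnatr_eq0//.
  by rewrite -lt0n.
rewrite /= exprS ler_wpM2l ?divr_ge0 ?ler0n//.
apply: le_trans (_ : (d%:R / n.+2%:R) ^+ size J <= _); last first.
  rewrite lerXn2r ?nnegrE ?divr_ge0 ?ler0n// ler_wpM2l ?ler0n// lef_pV2 ?posrE ?ltr0n//.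
  by rewrite ler_nat.
apply: le_trans (IH n.+1 uJ); apply: le_Ex => w _; rewrite /psi mulrA.
have p0 : 0 <= \prod_(i <- J) (count_mem i w).+1%:R^-1 :> R.
  by apply: prodr_ge0 => i _; rewrite invr_ge0 ler0n.
have [->|c0] := eqVneq (count_mem j w) 0%N; first by rewrite mul0r mul0r.
by rewrite divff ?mul1r// pnatr_eq0.
Qed.

End Multinomial.

Section SimpleWalk.
Variable d : nat.
Hypothesis d4 : (4 <= d)%N.
Let d0 : (0 < d)%N. Proof. exact: leq_trans d4. Qed.

Definition srw_step (s : 'I_d * bool) : 'rV[int]_d :=
  if s.2 then delta_mx ord0 s.1 else - delta_mx ord0 s.1.

(* Given the number of steps along each axis, the coordinates are independent
   one-dimensional walks. *)
Lemma hk_srw_prod n z : hk R srw_step n z =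
  Ex n (fun w => \prod_(j < d) hk1 (count_mem j w) (z ord0 j)).
Proof.
elim: n z => [|n IH] z.
  rewrite hk0 ExO; have [->|zn0] := eqVneq z 0.
    by rewrite big1// => j _; rewrite /= mxE.
  suff /existsP[j zj] : [exists j, z ord0 j != 0].
    by rewrite (bigD1 j)//= eq_sym (negbTE zj) mul0r.
  apply: contraNT zn0 => /existsPn H; apply/eqP/matrixP => i j.
  by rewrite ord1 mxE; apply/eqP/negPn/H.
rewrite hkS ExS card_prod card_ord card_bool natrM invfM -mulrA; congr (_ * _).
rewrite -(pair_bigA _ (fun j b => hk R srw_step n (z - srw_step (j, b))))/=.
rewrite mulr_sumr; apply: eq_bigr => j _; rewrite big_bool /= !IH -ExD -ExZ.
apply: eq_Ex => w _; rewrite (bigD1 j)//= [X in _ * (_ + X)](bigD1 j)//= [RHS](bigD1 j)//=.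
rewrite eqxx /=.
have E b : \prod_(i < d | i != j) hk1 (count_mem i w) ((z - srw_step (j, b)) ord0 i) =
    \prod_(i < d | i != j) hk1 ((j == i) + count_mem i w) (z ord0 i).
  apply: eq_bigr => i ij; rewrite [j == i]eq_sym (negbTE ij) add0n; congr hk1.
  by case: b; rewrite !mxE eqxx (negbTE ij) /= ?oppr0 ?addr0 ?opprK.
rewrite !E -mulrDl mulrA; congr (_ * _).
rewrite /srw_step /= !mxE !eqxx /= opprK mulrC; congr (_ / _).
Qed.

(** Here [d >= 4] enters: four axes each contribute the inverse square root of their number of
    steps, the other axes at most 1. Cauchy-Schwarz against the constant 1 removes the roots, and
    the inverse moments over four axes give [(d/(n+1))^4] for the square. *)
Lemma hk_srw_le n z : hk R srw_step n z <= d%:R ^+ 2 / n.+1%:R ^+ 2.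
Proof.
have V0 : (0 < #|'I_d|)%N by rewrite card_ord.
rewrite hk_srw_prod; pose J := take 4 (enum 'I_d).
have uJ : uniq J by rewrite take_uniq// enum_uniq.
have sJ : size J = 4 by rewrite size_takel// size_enum_ord.
pose f j (w : seq 'I_d) : R := Num.sqrt (count_mem j w).+1%:R^-1.
have f0 j w : 0 <= f j w by exact: sqrtr_ge0.
have f1 j w : f j w <= 1.
  by rewrite -sqrtr1 ler_wsqrtr// invf_le1 ?ltr0n// ler1n.
apply: (@le_trans _ _ (Ex n (fun w => 1 * \prod_(j <- J) f j w))).
  apply: le_Ex => w _; rewrite mul1r.
  apply: (@le_trans _ _ (\prod_(j < d) f j w)).
    by apply: ler_prod => j _; rewrite hk1_ge0 hk1_le.
  rewrite -big_enum -(cat_take_drop 4 (enum 'I_d)) big_cat /= -/J -[leRHS]mulr1.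
  rewrite ler_wpM2l ?prodr_ge0//.
  rewrite -[leRHS](@big1_idem _ _ _ (mulr1 1) _ (drop 4 (enum 'I_d)) xpredT (fun=> 1))//.
  by apply: ler_prod => j _; rewrite f0 f1.
rewrite -(@ler_pXn2r _ 2)// ?nnegrE ?divr_ge0 ?exprn_ge0 ?ler0n//; last first.
  by apply: Ex_ge0 => w _; rewrite mul1r prodr_ge0.
apply: le_trans (Ex_cauchy_schwarz _ _ _) _.
rewrite expr1n (Ex_cst V0) mul1r.
have := Ex_prod_inv d0 n uJ; rewrite sJ.
have -> : (d%:R ^+ 2 / n.+1%:R ^+ 2) ^+ 2 = (d%:R / n.+1%:R) ^+ 4 :> R.
  by rewrite -exprVn -exprMn -exprM.
apply: le_trans; apply: le_Ex => w _; rewrite -prodrXl.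
apply: ler_prod => j _; rewrite exprn_ge0//= sqr_sqrtr ?invr_ge0 ?ler0n//.
Qed.

End SimpleWalk.
End HeatKernel.

(** * Local times *)

Lemma eq_big_support (R : nmodType) (T : eqType) (h : T -> R) (Z Z' : seq T) :
  uniq Z -> uniq Z' -> (forall z, h z != 0 -> (z \in Z) = (z \in Z')) ->
  \sum_(z <- Z) h z = \sum_(z <- Z') h z.
Proof.
have H s : \sum_(z <- s) h z = \sum_(z <- [seq z <- s | h z != 0]) h z.
  rewrite big_filter [LHS](bigID (fun z => h z != 0))/= [X in _ + X]big1 ?addr0//.
  by move=> z /negPn/eqP.
move=> uZ uZ' ZZ'; rewrite H [RHS]H; apply: perm_big.
apply: uniq_perm; rewrite ?filter_uniq// => z; rewrite !mem_filter.
by case: eqP => //= /eqP /ZZ'.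
Qed.

(** * The rate [n^(1/4)] and elementary series *)

Section Rates.
Variable R : rcfType.

(** Stands in for the logarithm: it makes sense in any real closed field, is multiplicative, and
    inequalities about it reduce to polynomial ones through [root4 n ^+ 4 = n]. *)
Definition root4 (n : nat) : R := Num.sqrt (Num.sqrt n%:R).

Lemma root4_ge0 n : 0 <= root4 n. Proof. exact: sqrtr_ge0. Qed.

Lemma root4_4 n : root4 n ^+ 4 = n%:R.
Proof. by rewrite (exprM _ 2 2) !sqr_sqrtr ?sqrtr_ge0 ?ler0n. Qed.

Lemma root4_2 n : root4 n ^+ 2 = Num.sqrt n%:R.
Proof. by rewrite sqr_sqrtr ?sqrtr_ge0. Qed.

Lemma ler_root4 m n : (m <= n)%N -> root4 m <= root4 n.
Proof. by move=> mn; rewrite !ler_wsqrtr// ler_nat. Qed.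

Lemma root4_ge1 n : (0 < n)%N -> 1 <= root4 n.
Proof.
move=> n0; rewrite /root4 -[leLHS]sqrtr1 ler_wsqrtr// -[leLHS]sqrtr1 ler_wsqrtr//.
by rewrite ler1n.
Qed.

(** Telescoping: [x^-2 <= 2/x - 2/(x+1)] for [x >= 1], the factor 2 making up for [x+1 <= 2x]. *)
Lemma sum_inv_sq j n :
  \sum_(k < n) (j + k).+1%:R ^- 2 <= 2 / j.+1%:R :> R.
Proof.
suff: \sum_(k < n) (j + k).+1%:R ^- 2 <= 2 / j.+1%:R - 2 / (j + n).+1%:R :> R.
  by move/le_trans; apply; rewrite gerBl divr_ge0// ler0n.
elim: n => [|n IH]; first by rewrite big_ord0 addn0 subrr.
rewrite big_ord_recr /= addnS; set a := (j + n)%N.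
have a0 : 0 < a.+1%:R :> R by rewrite ltr0n.
have E : a.+2%:R = a.+1%:R + 1 :> R by rewrite -natr1.
have a1 : 1 <= a.+1%:R :> R by rewrite ler1n.
rewrite E; move: IH; rewrite -/a; set x := a.+1%:R in a0 a1 * => IH.
suff HH : x ^- 2 <= 2 / x - 2 / (x + 1).
  by apply: le_trans (lerD IH HH) _; rewrite addrA subrK.
rewrite -subr_ge0 (_ : _ - _ = (x - 1) / (x ^+ 2 * (x + 1))).
  by rewrite divr_ge0 ?subr_ge0// mulr_ge0 ?exprn_ge0 ?addr_ge0 ?ltW.
field; apply/andP; split; lra.
Qed.

(** Telescoping again: for [b^4 = n+1] and [a^4 = n], the product of [b - a] and
    [b^3 + b^2 a + b a^2 + a^3] is 1, and the second factor is at most [4 b^3 <= 4 b^4]. *)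
Lemma sum_inv_le n : \sum_(j < n) j.+1%:R^-1 <= 4 * root4 n.
Proof.
elim: n => [|n IH]; first by rewrite big_ord0 mulr_ge0 ?root4_ge0.
rewrite big_ord_recr /=.
suff H : n.+1%:R^-1 <= 4 * (root4 n.+1 - root4 n).
  by apply: le_trans (lerD IH H) _; rewrite -mulrDr addrC subrK.
have := root4_4 n; have := root4_4 n.+1; have := root4_ge0 n; have := root4_ge1 (ltn0Sn n).
have := ler_root4 (leqnSn n).
rewrite -natr1; set a := root4 n; set b := root4 n.+1 => ab b1 a0 b4 a4.
rewrite -b4 -[leLHS]mul1r ler_pdivrMr ?exprn_gt0; [|lra..].
have E1 : (b - a) * (b ^+ 3 + b ^+ 2 * a + b * a ^+ 2 + a ^+ 3) = 1.
  by rewrite (_ : _ * _ = b ^+ 4 - a ^+ 4); [lra|ring].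
suff S4 : b ^+ 3 + b ^+ 2 * a + b * a ^+ 2 + a ^+ 3 <= 4 * b ^+ 4.
  have : (b - a) * (b ^+ 3 + b ^+ 2 * a + b * a ^+ 2 + a ^+ 3) <= (b - a) * (4 * b ^+ 4).
    by rewrite ler_wpM2l ?subr_ge0.
  by rewrite E1 mulrA [_ * 4]mulrC.
have b0 : 0 <= b by lra.
have h1 : b ^+ 2 * a <= b ^+ 2 * b by rewrite ler_wpM2l// exprn_ge0.
have h2 : b * a ^+ 2 <= b * b ^+ 2 by rewrite ler_wpM2l// lerXn2r.
have h3 : a ^+ 3 <= b ^+ 3 by rewrite lerXn2r.
have h4 : b ^+ 3 <= b ^+ 4 by rewrite (exprS _ 3) ler_peMl// exprn_ge0.
have e1 : b ^+ 2 * b = b ^+ 3 by ring.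
have e2 : b * b ^+ 2 = b ^+ 3 by ring.
lra.
Qed.

End Rates.

Section LocalTimes.
Variables (R : rcfType) (V : finType) (L : zmodType) (st : V -> L).
Hypothesis V0 : (0 < #|V|)%N.
Local Notation pos := (pos st).
Local Notation hk := (hk R st).

(* [trail] and [occ] leave out the endpoint of the path, as the local times
   [l_n] do; [occS] counts it. *)
Fixpoint trail x w : seq L :=
  if w is s :: w' then x :: trail (x + st s) w' else [::].

Definition occ x w z := count_mem z (trail x w).

Fixpoint occS (x : L) w (z : L) : nat :=
  ((x == z) + (if w is s :: w' then occS (x + st s)%R w' z else 0))%N.

Lemma occ_cons x s w z : occ x (s :: w) z = ((x == z) + occ (x + st s)%R w z)%N.
Proof. by []. Qed.

Lemma trail_cat x u v : trail x (u ++ v) = trail x u ++ trail (x + pos u) v.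
Proof.
elim: u x => [|s u IH] x /=; first by rewrite pos_nil addr0.
by rewrite IH pos_cons addrA.
Qed.

Lemma occ_cat x u v z : occ x (u ++ v) z = (occ x u z + occ (x + pos u)%R v z)%N.
Proof. by rewrite /occ trail_cat count_cat. Qed.

Lemma size_trail x w : size (trail x w) = size w.
Proof. by elim: w x => //= s w IH x; rewrite IH. Qed.

Lemma trail_shift x a w : trail (x + a) w = [seq y + a | y <- trail x w].
Proof. by elim: w x => //= s w IH x; rewrite -IH addrAC. Qed.

Lemma occ_shift x a w z : occ (x + a) w z = occ x w (z - a).
Proof.
rewrite /occ trail_shift count_map; apply: eq_count => y /=.
by rewrite eq_sym -subr_eq eq_sym.
Qed.

Lemma occ_le_occS x w z : (occ x w z <= occS x w z)%N.
Proof. by elim: w x => [//|s w IH] x; rewrite occ_cons /= leq_add2l. Qed.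

Lemma occS_rcons x w s z :
  occS x (rcons w s) z = (occS x w z + ((x + pos (rcons w s))%R == z))%N.
Proof.
elim: w x => [|t w IH] x /=; first by rewrite pos_cons pos_nil !addr0 !addn0.
by rewrite IH pos_cons addrA addnA.
Qed.

(* Seen from its endpoint, a path is a time-reversed one. *)
Lemma occ_end_le_occS u z : (occ 0 u (pos u + z)%R <= occS 0 (rev u) (- z)%R)%N.
Proof.
elim: u => [//|s u IH]; rewrite occ_cons occ_shift rev_cons occS_rcons addnC leq_add//.
  rewrite (_ : pos (s :: u) + z - st s = pos u + z)//.
  by rewrite pos_cons -[st s + _ + z]addrA [st s + _]addrC addrK.
rewrite add0r -rev_cons pos_rev eq_sym.
by rewrite addr_eq0.
Qed.

Hypothesis inv : V -> V.
Hypothesis invK : involutive inv.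
Hypothesis st_inv : forall s, st (inv s) = - st s.

Lemma hk_opp n z : hk n (- z) = hk n z.
Proof.
elim: n z => [|n IH] z; first by rewrite !hk0 oppr_eq0.
rewrite !hkS; congr (_ * _); rewrite (reindex_inj (inv_inj invK)).
by apply: eq_bigr => s _; rewrite st_inv opprK -IH opprD opprK.
Qed.

(** Chapman-Kolmogorov on part of the lattice. By symmetry, two independent walks meet with the
    probability that their concatenation returns to 0; the finite [Z] may miss some meeting points,
    hence an inequality. *)
Lemma hk_conv j k (Z : seq L) : uniq Z ->
  \sum_(z <- Z) hk j z * hk k z <= hk (j + k) 0.
Proof.
move=> uZ; have -> : hk (j + k) 0 =
    Ex j (fun u => Ex k (fun v => (pos v == pos u)%:R)).
  rewrite /hk Ex_cat; apply: eq_Ex => u _.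
  rewrite -/(hk k (pos u)) -hk_opp; apply: eq_Ex => v _.
  by rewrite pos_cat [pos u + _]addrC addr_eq0.
have -> : \sum_(z <- Z) hk j z * hk k z =
    Ex j (fun u => Ex k (fun v => \sum_(z <- Z) (pos u == z)%:R * (pos v == z)%:R)).
  transitivity (\sum_(z <- Z)
    Ex j (fun u => Ex k (fun v => (pos u == z)%:R * (pos v == z)%:R)) : R).
    by apply: eq_bigr => z _; rewrite Ex_prod.
  rewrite -Ex_sum; apply: eq_Ex => u _; by rewrite Ex_sum.
apply: le_Ex => u _; apply: le_Ex => v _.
have [uvZ|uZn] := boolP (pos u \in Z).
  rewrite (bigD1_seq (pos u))//= eqxx mul1r big1 ?addr0//.
  by move=> z; rewrite eq_sym => /negbTE ->; rewrite mul0r.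
rewrite big_seq big1 ?ler0n// => z zZ.
by case: eqP => [E|]; rewrite ?mul0r//; rewrite E zZ in uZn.
Qed.

Definition green n z : R := \sum_(k < n) hk k z.

Lemma green_ge0 n z : 0 <= green n z.
Proof. by apply: sumr_ge0 => k _; exact: hk_ge0. Qed.

Lemma green_opp n z : green n (- z) = green n z.
Proof. by apply: eq_bigr => k _; rewrite hk_opp. Qed.

Lemma greenS n z :
  green n.+1 z = (z == 0)%:R + #|V|%:R^-1 * \sum_(s : V) green n (z - st s).
Proof.
rewrite /green big_ord_recl hk0; congr (_ + _).
rewrite exchange_big mulr_sumr; apply: eq_bigr => k _; exact: hkS.
Qed.

Lemma ler_green m n z : (m <= n)%N -> green m z <= green n z.
Proof.
move=> mn; rewrite -(subnK mn); elim: (n - m)%N => [//|i IH].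
by rewrite addSn /green big_ord_recr; apply: le_trans IH _; rewrite lerDl hk_ge0.
Qed.

Lemma green_gt0 n : 1 <= green n.+1 0.
Proof.
by rewrite /green big_ord_recl hk0 eqxx lerDl; apply: sumr_ge0 => k _; exact: hk_ge0.
Qed.

Variable C : R.
Hypothesis hkC : forall n z, hk n z <= C / n.+1%:R ^+ 2.

Lemma C_ge1 : 1 <= C.
Proof. by have := hkC 0 0; rewrite hk0 eqxx expr1n divr1. Qed.
Let C0 : 0 <= C. Proof. exact: le_trans ler01 C_ge1. Qed.

Lemma green_le n z : green n z <= 2 * C.
Proof.
apply: (@le_trans _ _ (C * \sum_(k < n) (0 + k).+1%:R ^- 2)).
  by rewrite mulr_sumr; apply: ler_sum => k _; exact: hkC.
by rewrite [leRHS]mulrC ler_wpM2l//; apply: le_trans (sum_inv_sq R 0 n) _; rewrite divr1.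
Qed.

(** Expanding the square gives return probabilities at times [j + k]. Summing [C (j+k+1)^-2] over
    [k] leaves [2C/(j+1)], so only a harmonic sum remains. The bound is uniform in the finite set
    [Z]. *)
Lemma sum_green_sq n (Z : seq L) : uniq Z ->
  \sum_(z <- Z) green n z ^+ 2 <= 8 * C * root4 R n.
Proof.
move=> uZ; have -> : \sum_(z <- Z) green n z ^+ 2 =
    \sum_(j < n) \sum_(k < n) \sum_(z <- Z) hk j z * hk k z.
  under eq_bigr do rewrite expr2 /green mulr_suml.
  rewrite exchange_big; apply: eq_bigr => j _.
  rewrite exchange_big; apply: eq_bigr => z _; by rewrite mulr_sumr.
apply: (@le_trans _ _ (\sum_(j < n) (2 * C) * j.+1%:R^-1)); last first.
  rewrite -mulr_sumr.
  apply: (@le_trans _ _ (2 * C * (4 * root4 R n))); last by apply: eq_ler; ring.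
  by rewrite ler_wpM2l ?mulr_ge0// sum_inv_le.
apply: ler_sum => j _; apply: (@le_trans _ _ (C * \sum_(k < n) (j + k).+1%:R ^- 2)).
  rewrite mulr_sumr; apply: ler_sum => k _.
  by apply: le_trans (hk_conv _ _ uZ) _; exact: hkC.
by rewrite -mulrA mulrCA ler_wpM2l// sum_inv_sq.
Qed.

Section Khasminskii.

(* Unlike in Khas'minskii's lemma proper, no Markov property is invoked: the
   induction on [n] peels the first letter, and [l * C] small absorbs the factor
   created when the path starts at [z]. *)
Lemma exp_moment_occ l n x z : 0 < l -> l * (2 * C) <= 1 / 2 ->
  Ex n (fun w => (1 + l) ^+ occS x w z - 1) <= 2 * l * green n.+1 (z - x).
Proof.
move=> l0 lC; elim: n x => [|n IH] x.
  rewrite ExO /= greenS big1 ?mulr0 ?addr0 => [|s _]; last by rewrite /green big_ord0.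
  rewrite addn0 subr_eq0 eq_sym; case: eqP => _ /=; rewrite ?expr0 ?expr1; lra.
rewrite ExS /=.
set A := #|V|%:R^-1 * \sum_s green n.+1 (z - x - st s).
have GA : green n.+2 (z - x) = (x == z)%:R + A by rewrite greenS subr_eq0 eq_sym.
have G1 := green_le n.+2 (z - x).
have A0 : 0 <= A.
  by rewrite mulr_ge0 ?invr_ge0 ?ler0n// sumr_ge0// => s _; exact: green_ge0.
have IHA : #|V|%:R^-1 * \sum_s Ex n (fun w => (1 + l) ^+ occS (x + st s) w z - 1)
     <= 2 * l * A.
  rewrite /A [leRHS]mulrCA ler_wpM2l ?invr_ge0 ?ler0n// mulr_sumr.
  by apply: ler_sum => s _; rewrite -addrA -opprD.
rewrite GA in G1 *.
case: eqP G1 => /= _ G1; last by rewrite add0r.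
have -> : #|V|%:R^-1 * \sum_s Ex n (fun w => (1 + l) ^+ (occS (x + st s) w z).+1 - 1) =
  l + (1 + l) * (#|V|%:R^-1 * \sum_s Ex n (fun w => (1 + l) ^+ occS (x + st s) w z - 1)).
  transitivity (#|V|%:R^-1 * \sum_s (l + (1 + l) *
      Ex n (fun w => (1 + l) ^+ occS (x + st s) w z - 1))).
    congr (_ * _); apply: eq_bigr => s _.
    rewrite -[X in _ = X + _](Ex_cst V0 n) -ExZ -ExD.
    by apply: eq_Ex => w _; rewrite exprS; ring.
  by rewrite big_split /= mulrDr (avg_cst V0) -mulr_sumr mulrCA.
move: IHA; set B := _ * \sum_s _ => IHA; nra.
Qed.

(** To visit both sites the walk must reach one of them and then travel to the other, which costs
    the extra factor [g]. Taking [g] at a fixed horizon [N > n] keeps it constant along the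
    induction on [n]. The induction treats distinct sites, with [4 l^2] in place of 6. *)
Lemma exp_moment_occ2 l n x z y N :
  0 < l -> l <= 1 -> l * (2 * C) <= 1 / 6 -> (n < N)%N ->
  Ex n (fun w => ((1 + l) ^+ occS x w z - 1) * ((1 + l) ^+ occS x w y - 1)) <=
  6 * green N (z - y) * (green n.+1 (z - x) + green n.+1 (y - x)).
Proof.
move=> l0 l1 lC.
set g := green N (z - y); move=> nN.
have g0 : 0 <= g by exact: green_ge0.
have [zy|zy] := eqVneq z y.
  (* For equal sites [(t - 1)^2 <= t^2 - 1] reduces to one site with parameter [2l + l^2 <= 3l]; the
     threshold 1/6 on [l * (2 * C)] is what brings this below 1/2. *)
  rewrite -zy; apply: (@le_trans _ _
    (Ex n (fun w => (1 + (2 * l + l ^+ 2)) ^+ occS x w z - 1))).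
    apply: le_Ex => w _; have -> : 1 + (2 * l + l ^+ 2) = (1 + l) ^+ 2 by ring.
    rewrite -exprM mulnC exprM; set t := _ ^+ occS _ _ _.
    have : 1 <= t by rewrite exprn_ege1// lerDl ltW.
    nra.
  apply: le_trans (exp_moment_occ _ _ _ _ _) _; [nra|nra|].
  have : 1 <= g by rewrite /g -zy subrr; apply: le_trans (green_gt0 n) (ler_green _ nN).
  have := green_ge0 n.+1 (z - x); set G := green _ _ => G0 g1.
  have h1 : G <= g * G by rewrite ler_peMl.
  have h2 : l * G <= G by rewrite ler_piMl.
  have h3 : l ^+ 2 * G <= G by rewrite ler_piMl// exprn_ile1// ltW.
  lra.
suff H : Ex n (fun w => ((1 + l) ^+ occS x w z - 1) * ((1 + l) ^+ occS x w y - 1)) <=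
  4 * l ^+ 2 * g * (green n.+1 (z - x) + green n.+1 (y - x)).
  apply: le_trans H _; rewrite ler_wpM2r ?addr_ge0 ?green_ge0// ler_wpM2r//; nra.
elim: n nN x => [|n IH] nN x.
  rewrite ExO /= !addn0; have [->|_] := eqVneq x z.
    rewrite (negbTE zy) expr0 (subrr 1) mulr0.
    by rewrite !mulr_ge0 ?addr_ge0 ?green_ge0 ?exprn_ge0// ltW.
  by rewrite expr0 (subrr 1) mul0r !mulr_ge0 ?addr_ge0 ?green_ge0 ?exprn_ge0// ltW.
have {}IH := IH (ltnW nN).
rewrite ExS /=.
set A := #|V|%:R^-1 * \sum_s (green n.+1 (z - x - st s) + green n.+1 (y - x - st s)).
have GA : green n.+2 (z - x) + green n.+2 (y - x) = (x == z)%:R + (x == y)%:R + A.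
  by rewrite !greenS !subr_eq0 ![_ == x]eq_sym /A big_split /= mulrDr; ring.
have A1 : A <= 4 * C.
  have := green_le n.+2 (z - x); have := green_le n.+2 (y - x).
  have : 0 <= (x == z)%:R :> R by rewrite ler0n.
  have : 0 <= (x == y)%:R :> R by rewrite ler0n.
  lra.
have A0 : 0 <= A.
  by rewrite mulr_ge0 ?invr_ge0 ?ler0n// sumr_ge0// => s _; rewrite addr_ge0 ?green_ge0.
set c := 4 * l ^+ 2 * g in IH *.
have c0 : 0 <= c by rewrite mulr_ge0 // mulr_ge0 // sqr_ge0.
set B := #|V|%:R^-1 * \sum_s Ex n (fun w => ((1 + l) ^+ occS (x + st s) w z - 1)
   * ((1 + l) ^+ occS (x + st s) w y - 1)).
have IHA : B <= c * A.
  rewrite /A [leRHS]mulrCA ler_wpM2l ?invr_ge0 ?ler0n// mulr_sumr.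
  by apply: ler_sum => s _; apply: le_trans (IH _) _; rewrite !opprD !addrA.
have key a b : a != b -> green N (b - a) = g ->
   #|V|%:R^-1 * \sum_s Ex n (fun w => ((1 + l) ^+ occS (a + st s) w b - 1)) <= 2 * l * g.
  move=> ab <-; apply: (@le_trans _ _ (2 * l * green n.+2 (b - a))); last first.
    by rewrite ler_wpM2l ?ler_green// mulr_ge0// ltW.
  rewrite greenS subr_eq0 eq_sym (negbTE ab) add0r [leRHS]mulrCA.
  rewrite ler_wpM2l ?invr_ge0 ?ler0n// mulr_sumr.
  apply: ler_sum => s _; rewrite -addrA -opprD; apply: exp_moment_occ => //; lra.
have expand a b : #|V|%:R^-1 * \sum_s Ex n (fun w => ((1 + l) ^+ (1 + occS (x + st s) w a) - 1)
   * ((1 + l) ^+ (0 + occS (x + st s) w b) - 1)) =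
   (1 + l) * (#|V|%:R^-1 * \sum_s Ex n (fun w => ((1 + l) ^+ occS (x + st s) w a - 1)
   * ((1 + l) ^+ occS (x + st s) w b - 1))) +
   l * (#|V|%:R^-1 * \sum_s Ex n (fun w => ((1 + l) ^+ occS (x + st s) w b - 1))).
  rewrite mulrCA [l * _]mulrCA -mulrDr; congr (_ * _); rewrite !mulr_sumr -big_split /=.
  apply: eq_bigr => s _; rewrite -!ExZ -ExD; apply: eq_Ex => w _.
  rewrite add1n add0n exprS; ring.
(* Budget for a visit: it adds [c] to the right side, of which [l B'] takes at most [c/2] and
   [l c A], since [A <= 4 C], at most [c/3]. *)
have fin B' : B' <= 2 * l * g -> (1 + l) * B + l * B' <= c * (1 + A).
  move=> B'g; have : l * c * A <= l * c * (4 * C) by rewrite ler_wpM2l// mulr_ge0// ltW.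
  have : c * (l * (2 * C)) <= c * (1 / 6) by rewrite ler_wpM2l.
  have : (1 + l) * B <= (1 + l) * (c * A) by rewrite ler_wpM2l// addr_ge0// ltW.
  have : l * B' <= l * (2 * l * g) by rewrite ler_wpM2l// ltW.
  have : l * (2 * l * g) = c / 2 by rewrite /c; field.
  have : 0 <= c * A by rewrite mulr_ge0.
  lra.
rewrite GA; have [xz|xz] := eqVneq x z.
  have xy : (x == y) = false by rewrite xz (negbTE zy).
  rewrite xy addr0 (expand z y); apply: fin; rewrite xz; apply: key => //.
  by rewrite -opprB green_opp.
have [xy|xy] := eqVneq x y; last first.
  by rewrite !add0r; apply: le_trans IHA; apply: eq_ler.
rewrite add0r.
have -> : #|V|%:R^-1 * \sum_s Ex n (fun w => ((1 + l) ^+ (false + occS (x + st s) w z) - 1)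
   * ((1 + l) ^+ (true + occS (x + st s) w y) - 1)) =
   #|V|%:R^-1 * \sum_s Ex n (fun w => ((1 + l) ^+ (1 + occS (x + st s) w y) - 1)
   * ((1 + l) ^+ (0 + occS (x + st s) w z) - 1)).
  by congr (_ * _); apply: eq_bigr => s _; apply: eq_Ex => w _; rewrite mulrC.
rewrite expand; set B1 := #|V|%:R^-1 * \sum_s Ex n _.
have -> : B1 = B.
  by congr (_ * _); apply: eq_bigr => s _; apply: eq_Ex => w _; rewrite mulrC.
by apply: fin; rewrite xy; apply: key => //; rewrite eq_sym.
Qed.

End Khasminskii.

End LocalTimes.

(** * Almost additivity *)

Section BlockSums.
Variables (R : rcfType) (V : finType).
Hypothesis V0 : (0 < #|V|)%N.
Variables (m : nat) (t : seq V -> R).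

Fixpoint bsum b w : R :=
  if b is b'.+1 then t (take m w) + bsum b' (drop m w) else 0.

Lemma bsum_cat b1 b2 u v : size u = (b1 * m)%N ->
  bsum (b1 + b2) (u ++ v) = bsum b1 u + bsum b2 v.
Proof.
elim: b1 u => [|b1 IH] u su; first by rewrite (size0nil su) add0r.
rewrite addSn /= -addrA; congr (_ + _).
  by rewrite takel_cat// su mulSn leq_addr.
have mu : (m <= size u)%N by rewrite su mulSn leq_addr.
rewrite drop_cat; case: ltnP => h; first by rewrite IH// size_drop su mulSn addKn.
have E : size u = m by apply/eqP; rewrite eqn_leq h mu.
rewrite E subnn drop0 drop_oversize ?E// -IH//=.
by apply/esym/eqP; move: su; rewrite mulSn E; lia.
Qed.

Lemma Ex_bsum b : Ex m t = 0 -> Ex (b * m) (bsum b) = 0.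
Proof.
move=> t0; elim: b => [|b IH]; first by rewrite ExO.
rewrite mulSn Ex_cat; transitivity (Ex m (fun u => t u + Ex (b * m) (bsum b))).
  apply: eq_Ex => u su; rewrite -[X in _ = X + _](Ex_cst V0 (b * m)) -ExD.
  by apply: eq_Ex => v _ /=; rewrite take_size_cat// drop_size_cat.
by rewrite ExD t0 add0r (Ex_cst V0).
Qed.

Lemma Ex_bsum_sq b : Ex m t = 0 ->
  Ex (b * m) (fun w => bsum b w ^+ 2) = b%:R * Ex m (fun w => t w ^+ 2).
Proof.
move=> t0; elim: b => [|b IH]; first by rewrite ExO expr0n mul0r.
rewrite mulSn Ex_cat -natr1 mulrDl mul1r addrC -IH -(Ex_sq_indep V0 _ _ t0).
apply: eq_Ex => u su; apply: eq_Ex => v _ /=.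
by rewrite take_size_cat// drop_size_cat.
Qed.

End BlockSums.

Section RateAlgebra.
Variable R : rcfType.
Local Notation r4 := (root4 R).

Lemma root4M m n : r4 (m * n) = r4 m * r4 n.
Proof. by rewrite /root4 natrM sqrtrM ?ler0n// sqrtrM ?sqrtr_ge0. Qed.

Lemma root4_1 : r4 1 = 1. Proof. by rewrite /root4 !sqrtr1. Qed.

Lemma root4X m k : r4 (m ^ k) = r4 m ^+ k.
Proof. by elim: k => [|k IH]; rewrite ?expn0 ?root4_1// expnS root4M IH exprS. Qed.

Lemma root4_2_gt1 : 1 < r4 2.
Proof.
rewrite lt_neqAle root4_ge1// andbT eq_sym; apply/eqP => E.
by have := root4_4 R 2; rewrite E expr1n => e; lra.
Qed.

Lemma root4_2_lt2 : r4 2 < 2.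
Proof.
have := root4_4 R 2; have := root4_2_gt1; set h := r4 2 => h1 h4.
rewrite ltNge; apply/negP => h2.
have : 2 ^+ 4 <= h ^+ 4 by rewrite lerXn2r// nnegrE; lra.
by rewrite h4; lra.
Qed.

End RateAlgebra.

(** * The cross term between two pieces of a path *)

Section CrossTerm.
Variables (R : rcfType) (V : finType) (L : zmodType) (st : V -> L).
Hypothesis V0 : (0 < #|V|)%N.
Variable inv : V -> V.
Hypothesis invK : involutive inv.
Hypothesis st_inv : forall s, st (inv s) = - st s.
Variable C : R.
Hypothesis hkC : forall n z, hk R st n z <= C / n.+1%:R ^+ 2.
Variables (phi : nat -> R) (l K : R).
Hypothesis l0 : 0 < l.
Hypothesis l1 : l <= 1.
Hypothesis lC : l * (2 * C) <= 1 / 6.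
Hypothesis K0 : 0 <= K.
Hypothesis phi0 : phi 0 = 0.
Hypothesis phiD : forall a b, phi a + phi b <= phi (a + b).
(* The bound vanishes at the sites visited by only one of the two pieces. *)
Hypothesis phi_cross : forall a b,
  phi (a + b) - phi a - phi b <= K * (((1 + l) ^+ a - 1) * ((1 + l) ^+ b - 1)).
Local Notation trail := (trail st).
Local Notation occ := (occ st).
Local Notation occS := (occS st).
Local Notation pos := (pos st).
Local Notation green := (green R st).
Local Notation r4 := (root4 R).

Let C0 : 0 <= C. Proof. exact: le_trans ler01 (C_ge1 hkC). Qed.

(** For [phi k = k^q] this is the [q]-th power of the norm of the local times. The starting point is
    a parameter because the second piece of a path starts where the first one ends. *)
Definition occ_sum_from x w : R := \sum_(z <- undup (trail x w)) phi (occ x w z).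

Lemma occ_neq0 x w z : occ x w z != 0 -> z \in trail x w.
Proof. by rewrite -lt0n -has_count has_pred1. Qed.

Lemma occ_sum_fromE x w Z : uniq Z -> {subset trail x w <= Z} ->
  occ_sum_from x w = \sum_(z <- Z) phi (occ x w z).
Proof.
move=> uZ sZ; apply: eq_big_support; rewrite ?undup_uniq// => z zn0.
have zw : z \in trail x w.
  by apply: occ_neq0; apply: contraNN zn0 => /eqP ->; rewrite phi0.
by rewrite mem_undup zw sZ.
Qed.

Lemma occ_sum_from_shift x w : occ_sum_from x w = occ_sum_from 0 w.
Proof.
have E := trail_shift st 0 x w; rewrite add0r in E.
rewrite (@occ_sum_fromE x w [seq y + x | y <- undup (trail 0 w)]).
- rewrite big_map; apply: eq_bigr => z _; congr phi.
  by rewrite -{1}[x]add0r occ_shift addrK.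
- by rewrite map_inj_uniq ?undup_uniq//; exact: addIr.
- move=> z; rewrite E => /mapP[y yw ->]; apply: map_f; by rewrite mem_undup.
Qed.

Definition occ_sum w := occ_sum_from 0 w.
Local Notation X := occ_sum.

Definition cross u v := X (u ++ v) - X u - X v.

Lemma crossE u v Z : uniq Z -> {subset trail 0 (u ++ v) <= Z} ->
  cross u v = \sum_(z <- Z) (phi (occ 0 u z + occ (pos u) v z)
                            - phi (occ 0 u z) - phi (occ (pos u) v z)).
Proof.
move=> uZ sZ; rewrite /cross [X v]/occ_sum -(occ_sum_from_shift (pos u)) /occ_sum.
have su : {subset trail 0 u <= Z}.
  by move=> z zu; apply: sZ; rewrite trail_cat mem_cat zu.
have sv : {subset trail (pos u) v <= Z}.
  by move=> z zu; apply: sZ; rewrite trail_cat mem_cat add0r zu orbT.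
rewrite (occ_sum_fromE uZ sZ) (occ_sum_fromE uZ su) (occ_sum_fromE uZ sv) -!sumrB.
by apply: eq_bigr => z _; rewrite occ_cat add0r.
Qed.

Lemma cross_ge0 u v : 0 <= cross u v.
Proof.
rewrite (@crossE u v (undup (trail 0 (u ++ v)))) ?undup_uniq//; last first.
  by move=> z; rewrite mem_undup.
by apply: sumr_ge0 => z _; rewrite -addrA -opprD subr_ge0.
Qed.

(** A finite set of sites depending only on the length, so that sums over it can be taken out of the
    averages. *)
Definition reach b : seq L :=
  undup (flatten [seq trail 0 (tval t) | t <- enum {: b.-tuple V}]).

Lemma reach_trail v : {subset trail 0 v <= reach (size v)}.
Proof.
move=> z zv; rewrite mem_undup; apply/flattenP; exists (trail 0 v) => //.
by apply/mapP; exists (in_tuple v); rewrite ?mem_enum.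
Qed.

Let ex_ge0 (k : nat) : 0 <= (1 + l) ^+ k - 1.
Proof. by rewrite subr_ge0 exprn_ege1// lerDl ltW. Qed.

Let ex_le (j k : nat) : (j <= k)%N -> (1 + l) ^+ j - 1 <= (1 + l) ^+ k - 1.
Proof. by move=> jk; rewrite lerD2r ler_weXn2l// lerDl ltW. Qed.

(** Recentring at the cut turns the past into a reversed walk and the future into a fresh walk from
    0. The summand vanishes at sites missed by the future, so the sum can be moved to [reach], which
    does not depend on the words. *)
Lemma cross_le u v : cross u v <= K * \sum_(z <- reach (size v))
  ((1 + l) ^+ occS 0 (rev u) (- z) - 1) * ((1 + l) ^+ occS 0 v z - 1).
Proof.
set Z := undup (trail 0 (u ++ v)); have uZ : uniq Z by exact: undup_uniq.
rewrite (@crossE u v Z) //; last by move=> z; rewrite mem_undup.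
pose h z := K * (((1 + l) ^+ occ 0 u z - 1) * ((1 + l) ^+ occ (pos u) v z - 1)).
apply: (@le_trans _ _ (\sum_(z <- Z) h z)); first exact: ler_sum.
rewrite (@eq_big_support _ _ h Z [seq y + pos u | y <- reach (size v)])//.
- rewrite big_map mulr_sumr; apply: ler_sum => z _; rewrite /h ler_wpM2l//.
  rewrite ler_pM// ex_le//.
    by rewrite addrC occ_end_le_occS.
  by rewrite -[pos u]add0r occ_shift add0r addrK occ_le_occS.
- by rewrite map_inj_uniq ?undup_uniq//; exact: addIr.
- move=> z hz; have zv : z \in trail (pos u) v.
    by apply: occ_neq0; apply: contraNN hz => /eqP zv; rewrite /h zv subrr !mulr0.
  rewrite /Z mem_undup trail_cat mem_cat add0r zv orbT; apply/esym.
  move: zv; rewrite -[pos u]add0r trail_shift => /mapP[y yv ->].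
  by rewrite add0r; apply: map_f; exact: reach_trail.
Qed.

(** After expanding the square, past and future factor, and each two-site moment is at most
    [T = 6 G(z-y) (G(z) + G(y))]; positivity of [a] and [b] puts both horizons strictly below [N].
    Then [T^2 <= 72 G(z-y)^2 (G(z)^2 + G(y)^2)], whose double sum is at most [72 * 2 * S^2] with
    [S = 8 C N^(1/4)]; this gives [96^2 = 72 * 2 * 8^2]. *)
Lemma Ex_cross_sq a b : (0 < a)%N -> (0 < b)%N ->
  Ex a (fun u => Ex b (fun v => cross u v ^+ 2)) <= (96 * K * C * r4 (a + b)) ^+ 2.
Proof.
move=> a0 b0; set N := (a + b)%N; set Z := reach b.
have uZ : uniq Z by exact: undup_uniq.
pose A z u : R := (1 + l) ^+ occS 0 (rev u) (- z) - 1.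
pose B z v : R := (1 + l) ^+ occS 0 v z - 1.
have A0 z u : 0 <= A z u by exact: ex_ge0.
have B0 z u : 0 <= B z u by exact: ex_ge0.
pose S := 8 * C * r4 N.
have S0 : 0 <= S by rewrite !mulr_ge0 ?root4_ge0.
apply: (@le_trans _ _ (Ex a (fun u => Ex b (fun v =>
    \sum_(z <- Z) \sum_(y <- Z) K ^+ 2 * ((A z u * A y u) * (B z v * B y v)))))).
  apply: le_Ex => u su; apply: le_Ex => v sv.
  apply: (@le_trans _ _ ((K * \sum_(z <- Z) A z u * B z v) ^+ 2)).
    rewrite lerXn2r ?nnegrE ?cross_ge0 ?mulr_ge0 ?sumr_ge0// => [z _|].
      by rewrite mulr_ge0.
    by have := cross_le u v; rewrite sv.
  rewrite exprMn [X in _ * X]expr2 mulr_suml mulr_sumr; apply: ler_sum => z _.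
  rewrite !mulr_sumr; apply: ler_sum => y _.
  by apply: eq_ler; ring.
have -> : Ex a (fun u => Ex b (fun v =>
    \sum_(z <- Z) \sum_(y <- Z) K ^+ 2 * ((A z u * A y u) * (B z v * B y v)))) =
  \sum_(z <- Z) \sum_(y <- Z) K ^+ 2 *
     (Ex a (fun u => A z u * A y u) * Ex b (fun v => B z v * B y v)).
  transitivity (Ex a (fun u => \sum_(z <- Z) \sum_(y <- Z)
     K ^+ 2 * ((A z u * A y u) * Ex b (fun v => B z v * B y v)))).
    apply: eq_Ex => u _; rewrite Ex_sum; apply: eq_bigr => z _.
    by rewrite Ex_sum; apply: eq_bigr => y _; rewrite !ExZ.
  rewrite Ex_sum; apply: eq_bigr => z _; rewrite Ex_sum; apply: eq_bigr => y _.
  by rewrite ExZ ExZr.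
apply: (@le_trans _ _ (\sum_(z <- Z) \sum_(y <- Z) K ^+ 2 *
   (72 * (green N (z - y) ^+ 2 * green N z ^+ 2 + green N (z - y) ^+ 2 * green N y ^+ 2)))).
  apply: ler_sum => z _; apply: ler_sum => y _; rewrite ler_wpM2l ?sqr_ge0//.
  pose T := 6 * green N (z - y) * (green N z + green N y).
  have aN : (a < N)%N by rewrite /N -addn1 leq_add2l.
  have bN : (b < N)%N by rewrite /N -add1n leq_add2r.
  have GN n x : (n < N)%N -> green n.+1 x <= green N x by move=> nN; exact: ler_green.
  have TA : Ex a (fun u => A z u * A y u) <= T.
    rewrite (Ex_rev a (fun u =>
      ((1 + l) ^+ occS 0 u (- z) - 1) * ((1 + l) ^+ occS 0 u (- y) - 1))).
    apply: le_trans (exp_moment_occ2 V0 invK st_inv hkC _ _ _ l0 l1 lC aN) _.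
    rewrite !subr0 -opprD !(green_opp _ invK st_inv) /T.
    by rewrite ler_wpM2l ?mulr_ge0 ?green_ge0// lerD ?GN.
  have TB : Ex b (fun v => B z v * B y v) <= T.
    apply: le_trans (exp_moment_occ2 V0 invK st_inv hkC _ _ _ l0 l1 lC bN) _.
    rewrite !subr0 /T.
    by rewrite ler_wpM2l ?mulr_ge0 ?green_ge0// lerD ?GN.
  apply: (@le_trans _ _ (T * T)).
    by apply: ler_pM => //; apply: Ex_ge0 => w _; exact: mulr_ge0.
  rewrite /T; set g := green N (z - y); set p := green N z; set q := green N y.
  have : 0 <= g ^+ 2 * (p - q) ^+ 2 by rewrite mulr_ge0 ?sqr_ge0.
  nra.
have sumg x : \sum_(y <- Z) green N (x - y) ^+ 2 <= S.
  apply: le_trans (sum_green_sq invK st_inv hkC N (_ : uniq [seq x - y | y <- Z])).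
    by rewrite big_map.
  by rewrite map_inj_uniq// => y y' /addrI/oppr_inj.
have sumG : \sum_(y <- Z) green N y ^+ 2 <= S by exact: (sum_green_sq invK st_inv hkC).
have H1 : \sum_(z <- Z) \sum_(y <- Z) green N (z - y) ^+ 2 * green N z ^+ 2 <= S * S.
  apply: (@le_trans _ _ (\sum_(z <- Z) S * green N z ^+ 2)).
    by apply: ler_sum => z _; rewrite -mulr_suml ler_wpM2r ?sqr_ge0.
  by rewrite -mulr_sumr ler_wpM2l.
have H2 : \sum_(z <- Z) \sum_(y <- Z) green N (z - y) ^+ 2 * green N y ^+ 2 <= S * S.
  rewrite exchange_big; apply: le_trans H1; apply: ler_sum => z _; apply: ler_sum => y _.
  by rewrite -opprB (green_opp _ invK st_inv).
under eq_bigr do rewrite -mulr_sumr.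
rewrite -mulr_sumr.
under eq_bigr do rewrite -mulr_sumr big_split /=.
rewrite -mulr_sumr big_split /=.
apply: (@le_trans _ _ (K ^+ 2 * (72 * (S * S + S * S)))).
  by rewrite ler_wpM2l ?sqr_ge0// ler_wpM2l// lerD.
by rewrite /S; apply: eq_ler; ring.
Qed.

Definition cross_at a w := cross (take a w) (drop a w).

Lemma norm2_cross a b : norm2 (a + b) (cross_at a) <= 96 * K * C * r4 (a + b).
Proof.
have E : Ex (a + b) (fun w => cross_at a w ^+ 2) =
         Ex a (fun u => Ex b (fun v => cross u v ^+ 2)).
  rewrite Ex_cat; apply: eq_Ex => u su; apply: eq_Ex => v sv.
  by rewrite /cross_at take_size_cat// drop_size_cat.
have X0 : X [::] = 0 by rewrite /occ_sum /occ_sum_from big_nil.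
have rhs : 0 <= 96 * K * C * r4 (a + b) by rewrite !mulr_ge0 ?root4_ge0.
rewrite (norm2_le _ _ rhs) E; case: a {E} rhs => [|a] rhs.
  rewrite ExO (eq_Ex (G := fun=> 0)) ?Ex0 ?sqr_ge0// => v _.
  by rewrite /cross /= X0 subr0 subrr expr0n.
case: b rhs => [|b] rhs; last exact: Ex_cross_sq.
rewrite (eq_Ex (G := fun=> 0)) ?Ex0 ?sqr_ge0// => u _.
by rewrite ExO /cross cats0 X0 subr0 subrr expr0n.
Qed.

End CrossTerm.

Section AlmostAdditive.
Variables (R : rcfType) (V : finType).
Hypothesis V0 : (0 < #|V|)%N.
Variables (X : seq V -> R) (K : R).
Local Notation r4 := (root4 R).
Let cr a w := X w - X (take a w) - X (drop a w).

Hypothesis crK : forall a b, norm2 (a + b) (cr a) <= K * r4 (a + b).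

Definition mean n := Ex n X.
Definition centered n w := X w - mean n.
Local Notation cen := centered.

Let K0 : 0 <= K.
Proof. by have := le_trans (norm2_ge0 _ _) (crK 0 1); rewrite root4_1 mulr1. Qed.

Lemma Ex_centered n : Ex n (cen n) = 0.
Proof. by rewrite /centered ExB (Ex_cst V0) subrr. Qed.

Lemma mean_cat a b : mean (a + b) = mean a + mean b + Ex (a + b) (cr a).
Proof.
rewrite /cr !ExB (Ex_take V0) -/(mean a) (_ : Ex _ (fun w => X (drop a w)) = mean b).
  by rewrite /mean; ring.
rewrite Ex_cat -[RHS](Ex_cst V0 a); apply: eq_Ex => u su; apply: eq_Ex => v _.
by rewrite drop_size_cat.
Qed.

Lemma mean_almost_additive a b : `|mean (a + b) - mean a - mean b| <= K * r4 (a + b).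
Proof.
rewrite mean_cat (_ : _ - _ - _ = Ex (a + b) (cr a)); last by ring.
exact: le_trans (Ex_abs_le_norm2 V0 _ _) (crK a b).
Qed.

Let h := r4 2.
Let h1 : 1 < h. Proof. exact: root4_2_gt1. Qed.
Let h2 : h < 2. Proof. exact: root4_2_lt2. Qed.
Let h0 : 0 <= h. Proof. exact: root4_ge0. Qed.

Lemma mean_dyadic n k :
  `|mean (2 ^ k * n) - 2 ^+ k * mean n| <= K * r4 n * (h / (2 - h)) * 2 ^+ k.
Proof.
set c := h / (2 - h).
have c0 : 0 <= c by rewrite divr_ge0 ?subr_ge0 ?(ltW h2).
have ch : h * (1 + c) = 2 * c by rewrite /c; field; rewrite subr_eq0 gt_eqF.
(* With this [c], the sequence [c (2^k - h^k)] solves [x_(k+1) = 2 x_k + h^(k+1)], [x_0 = 0], which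
   is the recursion that doubling produces. *)
suff H : `|mean (2 ^ k * n) - 2 ^+ k * mean n| <= K * r4 n * (c * (2 ^+ k - h ^+ k)).
  apply: le_trans H _; rewrite -[leRHS]mulrA ler_wpM2l ?mulr_ge0 ?root4_ge0//.
  by rewrite ler_wpM2l// gerBl exprn_ge0.
elim: k => [|k IH].
  by rewrite expn0 mul1n !expr0 mul1r subrr normr0 subrr !mulr0.
rewrite expnS -mulnA mul2n -addnn; set N := (2 ^ k * n)%N.
have A := mean_almost_additive N N.
have rN : r4 (N + N) = h ^+ k.+1 * r4 n.
  by rewrite addnn -mul2n /N mulnA -expnS root4M root4X.
rewrite {}rN in A.
have -> : mean (N + N) - 2 ^+ k.+1 * mean n =
  (mean (N + N) - mean N - mean N) + 2 * (mean N - 2 ^+ k * mean n) by rewrite exprS; ring.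
apply: le_trans (ler_normD _ _) _; rewrite normrM ger0_norm//.
apply: (@le_trans _ _ (K * (h ^+ k.+1 * r4 n) + 2 * (K * r4 n * (c * (2 ^+ k - h ^+ k))))).
  by rewrite lerD// ler_wpM2l.
apply: eq_ler; rewrite !exprS.
have -> : K * (h * h ^+ k * r4 n) = K * r4 n * (h * h ^+ k) by ring.
rewrite [2 * _]mulrCA -mulrDr; congr (_ * _).
apply/eqP; rewrite -subr_eq0.
have -> : h * h ^+ k + 2 * (c * (2 ^+ k - h ^+ k)) - c * (2 * 2 ^+ k - h * h ^+ k) =
  h ^+ k * (h * (1 + c) - 2 * c) by ring.
by rewrite ch subrr mulr0.
Qed.

Definition blocks m b w := bsum m (cen m) b w.
Definition defect m b w := cen (b * m) w - blocks m b w.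

Lemma blocks_cat m b1 b2 u v : size u = (b1 * m)%N ->
  blocks m (b1 + b2) (u ++ v) = blocks m b1 u + blocks m b2 v.
Proof. exact: bsum_cat. Qed.

Lemma Ex_blocks m b : Ex (b * m) (blocks m b) = 0.
Proof. by apply: Ex_bsum => //; exact: Ex_centered. Qed.

Lemma Ex_defect m b : Ex (b * m) (defect m b) = 0.
Proof. by rewrite /defect ExB Ex_centered Ex_blocks subr0. Qed.

Lemma norm2_centered_cross a b :
  norm2 (a + b) (fun w => cr a w - Ex (a + b) (cr a)) <= K * r4 (a + b).
Proof. exact: le_trans (norm2_center V0 _ _) (crK a b). Qed.

Lemma centered_cat a b w : size w = (a + b)%N ->
  cen (a + b) w = cen a (take a w) + cen b (drop a w) + (cr a w - Ex (a + b) (cr a)).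
Proof. by move=> sw; rewrite /centered mean_cat /cr; ring. Qed.

Lemma norm2_sum_indep a b (F G : seq V -> R) (f : R) : Ex a F = 0 -> 0 <= f ->
  norm2 a F <= f -> norm2 b G <= f ->
  norm2 (a + b) (fun w => F (take a w) + G (drop a w)) <= h ^+ 2 * f.
Proof.
move=> F0 f0 Ff Gf; rewrite norm2_le ?mulr_ge0 ?sqr_ge0//.
have -> : Ex (a + b) (fun w => (F (take a w) + G (drop a w)) ^+ 2) =
    Ex a (fun u => F u ^+ 2) + Ex b (fun v => G v ^+ 2).
  rewrite -(Ex_sq_indep V0 _ _ F0) Ex_cat; apply: eq_Ex => u su; apply: eq_Ex => v _.
  by rewrite take_size_cat// drop_size_cat.
rewrite exprMn -exprM root4_4 mulrDl mul1r.
by rewrite lerD// -norm2_le.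
Qed.

(* Halving [b]: the two halves are independent, so their errors add in squares,
   and [root4 2 ^+ 2 = sqrt 2] is the factor of [norm2_sum_indep]. *)
Lemma norm2_defect m k b : (0 < b)%N -> (b <= 2 ^ k)%N ->
  norm2 (b * m) (defect m b) <= K * r4 m * ((h - 1)^-1 * (h ^+ k.*2 - h ^+ k)).
Proof.
have hh : h - 1 != 0 by rewrite subr_eq0 gt_eqF.
elim: k b => [|k IH] b b0 bk.
  have -> : b = 1%N by move: bk; rewrite expn0; lia.
  rewrite double0 !expr0 subrr !mulr0 (eq_norm2 (G := fun=> 0)) => [|w sw].
    by rewrite /norm2 (eq_Ex (G := fun=> 0)) ?Ex0 ?sqrtr0// => w _; rewrite expr0n.
  by rewrite /defect /blocks /= mul1n addr0 take_oversize ?subrr// sw mul1n.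
set f := K * r4 m * ((h - 1)^-1 * (h ^+ k.*2 - h ^+ k)) in IH.
have f0 : 0 <= f.
  rewrite !mulr_ge0 ?root4_ge0 ?invr_ge0 ?subr_ge0 ?(ltW h1)//.
  by rewrite ler_eXn2l// -addnn leq_addr.
(* The bound is the solution of [y_(k+1) = h^2 y_k + h^(k+1)], [y_0 = 0]; its leading term [h^(2k)]
   is [sqrt (2^k)]. *)
have fS : h ^+ 2 * f + K * r4 m * h ^+ k.+1 =
    K * r4 m * ((h - 1)^-1 * (h ^+ k.+1.*2 - h ^+ k.+1)).
  by rewrite /f doubleS !exprS; field.
rewrite -fS; have [b2|b2] := leqP b 1.
  have b1 : (b <= 2 ^ k)%N by apply: leq_trans b2 _; rewrite expn_gt0.
  apply: le_trans (IH b b0 b1) _; apply: (@le_trans _ _ (h ^+ 2 * f)).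
    by rewrite ler_peMl// exprn_ege1// ltW.
  by rewrite lerDl !mulr_ge0 ?root4_ge0 ?exprn_ge0.
set b1 := b./2; set b3 := (b - b1)%N.
have Eb : b = (b1 + b3)%N by rewrite /b3 /b1; lia.
rewrite expnS in bk.
have [b10 b1k] : (0 < b1)%N /\ (b1 <= 2 ^ k)%N by rewrite /b1; lia.
have [b30 b3k] : (0 < b3)%N /\ (b3 <= 2 ^ k)%N by rewrite /b3 /b1; lia.
rewrite Eb mulnDl (eq_norm2 (G := fun w =>
   (defect m b1 (take (b1 * m) w) + defect m b3 (drop (b1 * m) w))
   + (cr (b1 * m) w - Ex (b1 * m + b3 * m) (cr (b1 * m))))); last first.
  move=> w sw; rewrite /defect mulnDl centered_cat//.
  have -> : blocks m (b1 + b3) w =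
      blocks m b1 (take (b1 * m) w) + blocks m b3 (drop (b1 * m) w).
    by rewrite -{1}(cat_take_drop (b1 * m) w) blocks_cat// size_takel// sw leq_addr.
  ring.
apply: le_trans (ler_norm2D _ _ _) _; rewrite lerD//.
  by apply: norm2_sum_indep => //; [exact: Ex_defect|exact: IH|exact: IH].
apply: le_trans (norm2_centered_cross _ _) _; rewrite -mulnDl -Eb root4M -mulrA ler_wpM2l//.
by rewrite mulrC ler_wpM2l ?root4_ge0// -root4X ler_root4// expnS.
Qed.

Definition approx_const := K * ((h - 1)^-1 * (h ^+ 2 * h ^+ 2)) + K.

(** Three errors: the defect of the [n / m] full blocks, where [m^(1/4) sqrt (n/m)] is at most
    [m^(-1/4) sqrt n]; the incomplete block, bounded independently of [n] by summing over all
    remainders; and the cross term where it is attached. *)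
Lemma norm2_block_approx m n : (0 < m)%N ->
  norm2 n (fun w => cen n w - blocks m (n %/ m) w) <=
  approx_const * Num.sqrt n%:R / r4 m + \sum_(r < m) norm2 r (cen r) + K * r4 n.
Proof.
move=> m0; set b := (n %/ m)%N; set r := (n %% m)%N.
have En : n = (b * m + r)%N by exact: divn_eq.
have rm : (r < m)%N by rewrite ltn_mod.
rewrite (eq_norm2 (G := fun w => (defect m b (take (b * m) w) + cen r (drop (b * m) w))
    + (cr (b * m) w - Ex (b * m + r) (cr (b * m))))); last first.
  move=> w sw; rewrite /defect [in LHS]En centered_cat -?En//.
  have -> : blocks m b w = blocks m b (take (b * m) w).
    rewrite -{1}(cat_take_drop (b * m) w) -{1}[b]addn0 blocks_cat; first exact: addr0.
    by rewrite size_takel// sw [leqRHS]En leq_addr.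
  ring.
apply: le_trans (ler_norm2D _ _ _) _; rewrite lerD//; last first.
  by have := norm2_centered_cross (b * m) r; rewrite -En.
apply: le_trans (ler_norm2D _ _ _) _; rewrite lerD//.
  have -> : norm2 n (fun w => defect m b (take (b * m) w)) = norm2 (b * m) (defect m b).
    by rewrite /norm2 [in LHS]En (Ex_take V0 _ _ (fun w => defect m b w ^+ 2)).
  have r4m : 0 < r4 m by apply: lt_le_trans (root4_ge1 R m0).
  have hm : 0 <= (h - 1)^-1 by rewrite invr_ge0 subr_ge0 ltW.
  have [b0|b0] := posnP b.
    rewrite b0 mul0n /norm2 ExO /defect /centered /mean ExO /blocks /=.
    rewrite subrr subr0 expr0n sqrtr0.
    by rewrite !mulr_ge0 ?invr_ge0 ?addr_ge0 ?mulr_ge0 ?sqr_ge0 ?sqrtr_ge0.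
  (* Rounding [b] up to a power of two at most doubles it, which costs a factor
     [h ^+ 2 = sqrt 2]. *)
  set k := up_log 2 b.
  have bk : (b <= 2 ^ k)%N by exact: up_logP.
  have kb : (2 ^ k <= 2 * b)%N.
    have [b1|b1] := leqP b 1; first by rewrite /k (_ : b = 1%N) ?up_log1//; lia.
    have := up_log_gtn (isT : 1 < 2)%N b1; rewrite -/k.
    have : (0 < k)%N by rewrite up_log_gt0.
    by case: (k) => //= k' _; rewrite expnS; lia.
  apply: le_trans (norm2_defect m b0 bk) _.
  apply: (@le_trans _ _ (K * r4 m * ((h - 1)^-1 * (h ^+ 2 * Num.sqrt b%:R)))).
    rewrite ler_wpM2l ?mulr_ge0 ?root4_ge0// ler_wpM2l//.
    apply: (@le_trans _ _ (h ^+ k.*2)).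
      by rewrite gerBl exprn_ge0.
    rewrite -muln2 exprM -root4X -root4_2 -exprMn -root4M.
    by rewrite lerXn2r ?nnegrE ?root4_ge0// ler_root4.
  rewrite ler_pdivlMr// /approx_const.
  have sb : r4 m * Num.sqrt b%:R * r4 m <= Num.sqrt n%:R.
    rewrite mulrAC -expr2 root4_2 -sqrtrM ?ler0n// -natrM ler_wsqrtr//.
    by rewrite ler_nat [leqRHS]En mulnC leq_addr.
  have -> : K * r4 m * ((h - 1)^-1 * (h ^+ 2 * Num.sqrt b%:R)) * r4 m =
    K * (h - 1)^-1 * h ^+ 2 * (r4 m * Num.sqrt b%:R * r4 m) by ring.
  apply: (@le_trans _ _ (K * (h - 1)^-1 * h ^+ 2 * Num.sqrt n%:R)).
    by rewrite ler_wpM2l// !mulr_ge0 ?sqr_ge0.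
  rewrite ler_wpM2r ?sqrtr_ge0// -[leLHS]addr0 lerD// -mulrA ler_wpM2l// ler_wpM2l//.
  by rewrite ler_peMr ?sqr_ge0// exprn_ege1// ltW.
rewrite (_ : norm2 n (fun w => cen r (drop (b * m) w)) = norm2 r (cen r)).
  rewrite (bigD1 (Ordinal rm))//= lerDl; apply: sumr_ge0 => i _; exact: norm2_ge0.
rewrite /norm2 [in LHS]En Ex_cat; congr Num.sqrt.
rewrite -[RHS](Ex_cst V0 (b * m)); apply: eq_Ex => u su; apply: eq_Ex => v _.
by rewrite drop_size_cat.
Qed.

End AlmostAdditive.

(** * Lower bound on the variance *)

Section Delta.
Variables (R : rcfType) (V : finType).

Lemma Ex_delta p (F : seq V -> R) :
  Ex (size p) (fun w => (w == p)%:R * F w) = #|V|%:R ^- size p * F p.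
Proof.
elim: p F => [|s p IH] F; first by rewrite ExO eqxx expr0 invr1.
rewrite /= ExS exprS invfM -mulrA; congr (_ * _).
rewrite (bigD1 s)//= [X in _ + X]big1 ?addr0 => [|i si].
  by rewrite -(IH (fun w => F (s :: w))); apply: eq_Ex => w _; rewrite eqseq_cons eqxx.
rewrite -(Ex0 R V (size p)); apply: eq_Ex => w _.
by rewrite eqseq_cons (negbTE si) mul0r.
Qed.

(** [undup] keeps the last occurrence of each entry, so a sum over visited sites becomes a sum over
    last-visit times. *)
Lemma sum_undup (T : eqType) (F : T -> R) (x0 : T) (t : seq T) :
  \sum_(z <- undup t) F z =
  \sum_(k < size t) (nth x0 t k \notin drop k.+1 t)%:R * F (nth x0 t k).
Proof.
elim: t => [|x t IH]; first by rewrite big_nil big_ord0.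
rewrite big_ord_recl /= drop0 -IH; case: ifP => xt /=; first by rewrite mul0r add0r.
by rewrite big_cons mul1r.
Qed.

End Delta.

Section Swap.
Variables (R : rcfType) (V : finType) (L : zmodType) (st : V -> L).
Hypothesis V0 : (0 < #|V|)%N.
Variable inv : V -> V.
Hypothesis invK : involutive inv.
Hypothesis st_inv : forall s, st (inv s) = - st s.
Variable C : R.
Hypothesis hkC : forall n z, hk R st n z <= C / n.+1%:R ^+ 2.
Variables (phi : nat -> R) (l : R).
Hypothesis l0 : 0 < l.
Hypothesis lC : l * (2 * C) <= 1 / 6.
Hypothesis phi0 : phi 0 = 0.
Hypothesis phiD : forall a b, phi a + phi b <= phi (a + b).
Hypothesis phi_ge0 : forall a, 0 <= phi a.
Local Notation trail := (trail st).
Local Notation occ := (occ st).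
Local Notation occS := (occS st).
Local Notation pos := (pos st).
Local Notation green := (green R st).
Local Notation X := (occ_sum st phi).

Lemma occ_end_occS u z : (occ 0 u (pos u + z)%R + (z == 0%R) = occS 0 (rev u) (- z)%R)%N.
Proof.
elim: u => [|s u IH].
  by rewrite /= addn0 -[z == 0]oppr_eq0 eq_sym.
rewrite occ_cons occ_shift rev_cons occS_rcons -IH.
rewrite (_ : pos (s :: u) + z - st s = pos u + z); last first.
  by rewrite pos_cons -[st s + _ + z]addrA [st s + _]addrC addrK.
rewrite add0r -rev_cons pos_rev [0 == _]eq_sym addr_eq0 -addnA addnC; congr (_ + _)%N.
Qed.

(** At the last visit to a site, the future never comes back and the reversed past has made all the
    visits; [occS] includes the visit taking place at time [k] itself. *)
Lemma occ_sum_last_visit w : X w = \sum_(k < size w)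
  (0 \notin behead (trail 0 (drop k w)))%:R * phi (occS 0 (rev (take k w)) 0).
Proof.
rewrite /occ_sum /occ_sum_from (sum_undup _ 0) size_trail; apply: eq_bigr => k _.
have kw := ltn_ord k.
set u := take k w; have su : size u = k by rewrite size_takel// ltnW.
case Ev : (drop k w) => [|s v]; first by move: kw; rewrite -subn_gt0 -size_drop Ev.
have tr : trail 0 w = trail 0 u ++ pos u :: trail (pos u + st s) v.
  by rewrite -{1}(cat_take_drop k w) Ev trail_cat add0r.
have tk : nth 0 (trail 0 w) k = pos u.
  by rewrite tr nth_cat size_trail su ltnn subnn.
have td : drop k.+1 (trail 0 w) = trail (pos u + st s) v.
  rewrite tr drop_cat size_trail su ltnNge leqnSn /= subSnn /= drop0//.
rewrite tk td /= add0r.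
have E : (pos u \in trail (pos u + st s) v) = (0 \in trail (st s) v).
  rewrite addrC trail_shift; apply/mapP/idP => [[y yv]|H]; last by exists 0; rewrite ?add0r.
  by rewrite -[LHS]add0r => /addIr ->.
rewrite E; have [H|H] := boolP (0 \in _); rewrite ?mul0r// !mul1r.
have := occ_end_occS u 0; rewrite addr0 eqxx oppr0 => <-; congr phi.
have uv : pos u \notin trail (pos u + st s) v by rewrite E.
by rewrite /occ tr count_cat /= eqxx (count_memPn uv) addn0.
Qed.

(** [behead] drops time 0 and [trail] drops the endpoint, so the event is that of no return during
    the times [1, ..., n-1]. *)
Definition esc n : R := Ex n (fun v => (0 \notin behead (trail 0 v))%:R).
Definition returns_moment n : R := Ex n (fun u => phi (occS 0 u 0)).

Lemma mean_convolution n :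
  mean X n = \sum_(k < n) returns_moment k * esc (n - k).
Proof.
rewrite /mean (eq_Ex (G := fun w => \sum_(k < n)
   (0 \notin behead (trail 0 (drop k w)))%:R * phi (occS 0 (rev (take k w)) 0))); last first.
  by move=> w sw; rewrite occ_sum_last_visit sw.
rewrite Ex_sum; apply: eq_bigr => k _.
have kn : n = (k + (n - k))%N by rewrite subnKC// ltnW.
rewrite {1}kn Ex_cat /returns_moment -(Ex_rev k (fun u => phi (occS 0 u 0))) -ExZr.
apply: eq_Ex => u su; rewrite mulrC -ExZr; apply: eq_Ex => v _.
by rewrite take_size_cat// drop_size_cat.
Qed.

Variables (A : R) (e : V) (n0 : nat).
Hypothesis A0 : 0 <= A.
Hypothesis phi_incr : forall r b, (b <= 2)%N -> phi (r + b) - phi r <= A * (1 + l) ^+ r.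
Hypothesis e_inj : injective (fun j => st e *+ j).

(* Two closed paths of the same length: the first visits its origin [n0] times,
   the second visits no site more than twice. *)
Definition zigzag := flatten (nseq n0 [:: e; inv e]).
Definition there_and_back := nseq n0 e ++ nseq n0 (inv e).

Lemma size_zigzag : size zigzag = n0.*2.
Proof. by rewrite /zigzag size_flatten /shape map_nseq sumn_nseq /= mul2n. Qed.

Lemma size_there_and_back : size there_and_back = n0.*2.
Proof. by rewrite size_cat !size_nseq addnn. Qed.

Lemma pos_nseq k s : pos (nseq k s) = st s *+ k.
Proof. by elim: k => [|k IH]; rewrite ?pos_nil //= pos_cons IH mulrS. Qed.

Lemma pos_zigzag : pos zigzag = 0.
Proof.
rewrite /zigzag; elim: n0 => [|k IH] /=; first exact: pos_nil.
by rewrite !pos_cons IH st_inv addr0 subrr.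
Qed.

Lemma pos_there_and_back : pos there_and_back = 0.
Proof. by rewrite pos_cat !pos_nseq st_inv mulNrn subrr. Qed.

Lemma trail_nseq x k s : trail x (nseq k s) = [seq x + st s *+ j | j <- iota 0 k].
Proof.
elim: k x => [//|k IH] x /=; rewrite mulr0n addr0 IH; congr (_ :: _).
rewrite (iotaDl 1 0) -map_comp; apply: eq_map => j /=.
by rewrite add1n mulrS addrA.
Qed.

Lemma occ_zigzag x : (n0 <= occ x zigzag x)%N.
Proof.
rewrite /zigzag; elim: n0 => [//|k IH] /=; rewrite !occ_cons eqxx add1n ltnS.
by rewrite st_inv addrK; apply: leq_trans IH (leq_addl _ _).
Qed.

Lemma occ_there_and_back x z : (occ x there_and_back z <= 2)%N.
Proof.
rewrite occ_cat /occ; apply: (@leq_add _ _ 1 1).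
  rewrite trail_nseq count_uniq_mem ?leq_b1// map_inj_uniq ?iota_uniq//.
  by move=> i j /addrI/e_inj.
rewrite trail_nseq count_uniq_mem ?leq_b1// map_inj_uniq ?iota_uniq//.
by move=> i j /addrI; rewrite st_inv !mulNrn => /oppr_inj/e_inj.
Qed.

Lemma trail_there_and_back x z : z \in trail x there_and_back ->
  z \in [seq x + st e *+ j | j <- iota 0 n0.+1].
Proof.
rewrite trail_cat mem_cat => /orP[|].
  rewrite trail_nseq => /mapP[j jn ->]; apply/mapP; exists j => //.
  by move: jn; rewrite !mem_iota; lia.
rewrite trail_nseq => /mapP[j jn ->]; apply/mapP; exists (n0 - j)%N.
  by rewrite mem_iota; lia.
rewrite mem_iota in jn.
by rewrite pos_nseq st_inv mulNrn mulrnBr 1?addrA//; lia.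
Qed.

Let ex_ge1 k : 1 <= (1 + l) ^+ k. Proof. by rewrite exprn_ege1// lerDl ltW. Qed.

Lemma phi_homo : {homo phi : a b / (a <= b)%N >-> a <= b}.
Proof.
move=> a b ab; rewrite -(subnKC ab); apply: le_trans (phiD _ _).
by rewrite lerDl.
Qed.

(** By superadditivity the zigzag gains at least [phi n0] at the insertion point and loses nowhere.
    The other excursion touches only the [n0 + 1] sites of a segment, each at most twice, and
    [phi_incr] controls the increase by the exponential of the visits made by the rest of the
    path. *)
Lemma swap_ge u v :
  phi n0 - A * \sum_(0 <= j < n0.+1)
     (1 + l) ^+ (occS 0 (rev u) (- (st e *+ j)) + occS 0 v (st e *+ j))
  <= X (u ++ zigzag ++ v) - X (u ++ there_and_back ++ v).
Proof.
set x := pos u.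
pose r z := (occ 0 u z + occ x v z)%N.
pose Z := undup (x :: trail 0 (u ++ zigzag ++ v) ++ trail 0 (u ++ there_and_back ++ v)).
have uZ : uniq Z by exact: undup_uniq.
have XA p : pos p = 0 -> {subset trail 0 (u ++ p ++ v) <= Z} ->
    X (u ++ p ++ v) = \sum_(z <- Z) phi (r z + occ x p z).
  move=> p0 sZ; rewrite /occ_sum (occ_sum_fromE phi0 uZ sZ); apply: eq_bigr => z _; congr phi.
  by rewrite !occ_cat p0 addr0 add0r /r -/x; lia.
rewrite (XA zigzag) ?pos_zigzag//; last first.
  by move=> z zt; rewrite mem_undup inE mem_cat zt /= orbT.
rewrite (XA there_and_back) ?pos_there_and_back//; last first.
  by move=> z zt; rewrite mem_undup inE mem_cat zt !orbT.
have -> : \sum_(z <- Z) phi (r z + occ x zigzag z) -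
    \sum_(z <- Z) phi (r z + occ x there_and_back z) =
  \sum_(z <- Z) (phi (r z + occ x zigzag z) - phi (r z)) -
  \sum_(z <- Z) (phi (r z + occ x there_and_back z) - phi (r z)).
  by rewrite !sumrB; ring.
rewrite lerB//.
  rewrite (bigD1_seq x)//= ?mem_undup ?mem_head// -[leLHS]addr0 lerD//.
    rewrite lerBrDl; apply: le_trans (phiD _ _); rewrite lerD2l.
    exact/phi_homo/occ_zigzag.
  by apply: sumr_ge0 => z _; rewrite subr_ge0 phi_homo// leq_addr.
rewrite (@eq_big_support _ _ _ Z [seq x + st e *+ j | j <- iota 0 n0.+1])//.
- rewrite big_map mulr_sumr /index_iota subn0; apply: ler_sum => j _.
  apply: le_trans (phi_incr _ (occ_there_and_back _ _)) _; rewrite ler_wpM2l//.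
  rewrite ler_weXn2l ?lerDl ?ltW// /r leq_add//; first exact: occ_end_le_occS.
  by rewrite -{1}[x]add0r occ_shift addrC addKr occ_le_occS.
- by rewrite map_inj_uniq ?iota_uniq// => i j /addrI/e_inj.
- move=> z hz; have zB : z \in trail x there_and_back.
    by apply: occ_neq0; apply: contraNN hz => /eqP ->; rewrite addn0 subrr.
  have zt : z \in trail 0 (u ++ there_and_back ++ v).
    by rewrite trail_cat mem_cat add0r -/x (trail_cat st x there_and_back v) mem_cat zB orbT.
  by rewrite (trail_there_and_back zB) mem_undup inE mem_cat zt !orbT.
Qed.

Let occS_moment n z : Ex n (fun w => (1 + l) ^+ occS 0 w z) <= 2.
Proof.
have l6 : l * (2 * C) <= 1 / 2 by apply: le_trans lC _; lra.
have := exp_moment_occ V0 hkC n 0 z l0 l6.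
rewrite ExB (Ex_cst V0).
have : 2 * l * green n.+1 (z - 0) <= 2 * l * (2 * C).
  by rewrite ler_wpM2l ?mulr_ge0 ?(ltW l0)// green_le.
lra.
Qed.

(** Past and future factor at each of the [n0 + 1] sites, and each exponential moment is at most 2,
    whence the 4. *)
Lemma Ex_swap_ge a c : phi n0 - 4 * A * n0.+1%:R <=
  Ex a (fun u => Ex c (fun v => X (u ++ zigzag ++ v) - X (u ++ there_and_back ++ v))).
Proof.
apply: (@le_trans _ _ (Ex a (fun u => Ex c (fun v =>
  phi n0 - A * \sum_(0 <= j < n0.+1)
     ((1 + l) ^+ occS 0 (rev u) (- (st e *+ j)) * (1 + l) ^+ occS 0 v (st e *+ j)))))); last first.
  apply: le_Ex => u _; apply: le_Ex => v _; apply: le_trans (swap_ge u v).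
  by rewrite lerD2l lerN2 ler_wpM2l//; apply: ler_sum => j _; rewrite exprD.
have -> : Ex a (fun u => Ex c (fun v =>
  phi n0 - A * \sum_(0 <= j < n0.+1)
     ((1 + l) ^+ occS 0 (rev u) (- (st e *+ j)) * (1 + l) ^+ occS 0 v (st e *+ j)))) =
  phi n0 - A * \sum_(0 <= j < n0.+1)
    (Ex a (fun u => (1 + l) ^+ occS 0 (rev u) (- (st e *+ j))) *
     Ex c (fun v => (1 + l) ^+ occS 0 v (st e *+ j))).
  transitivity (Ex a (fun u => phi n0 - A * \sum_(0 <= j < n0.+1)
    ((1 + l) ^+ occS 0 (rev u) (- (st e *+ j)) *
     Ex c (fun v => (1 + l) ^+ occS 0 v (st e *+ j))))).
    apply: eq_Ex => u _; rewrite ExB (Ex_cst V0) ExZ Ex_sum.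
    by congr (_ - _ * _); apply: eq_bigr => j _; rewrite ExZ.
  rewrite ExB (Ex_cst V0) ExZ Ex_sum.
  by congr (_ - _ * _); apply: eq_bigr => j _; rewrite ExZr.
rewrite lerD2l lerN2 [4 * A]mulrC -mulrA ler_wpM2l//.
apply: (@le_trans _ _ (\sum_(0 <= j < n0.+1) 4)).
  apply: ler_sum => j _.
  have -> : 4 = 2 * 2 :> R by ring.
  rewrite (Ex_rev a (fun u => (1 + l) ^+ occS 0 u (- (st e *+ j)))).
  by apply: ler_pM => //; apply: Ex_ge0 => w _; apply: le_trans (ex_ge1 _).
by rewrite sumr_const_nat subn0 mulr_natr.
Qed.

(** Contrast variable of one block: centred because the two words have the same length, hence the
    same probability [p]. *)
Let t w : R := (w == zigzag)%:R - (w == there_and_back)%:R.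
Let p : R := #|V|%:R ^- n0.*2.
Let p0 : 0 < p. Proof. by rewrite invr_gt0 exprn_gt0 ?ltr0n. Qed.

Lemma Ex_contrast (F : seq V -> R) :
  Ex n0.*2 (fun w => F w * t w) = p * (F zigzag - F there_and_back).
Proof.
have EA := Ex_delta zigzag F; have EB := Ex_delta there_and_back F.
rewrite size_zigzag in EA; rewrite size_there_and_back in EB.
rewrite mulrBr -EA -EB -ExB; apply: eq_Ex => w _; rewrite /t; ring.
Qed.

Lemma Ex_contrast0 : Ex n0.*2 t = 0.
Proof.
have := Ex_contrast (fun=> 1); rewrite subrr mulr0 => E; rewrite -[RHS]E.
by apply: eq_Ex => w _; rewrite mul1r.
Qed.

Lemma Ex_contrast_sq : Ex n0.*2 (fun w => t w ^+ 2) <= 2 * p.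
Proof.
have EA := Ex_delta zigzag (fun=> 1 : R); have EB := Ex_delta there_and_back (fun=> 1 : R).
rewrite size_zigzag -/p in EA; rewrite size_there_and_back -/p in EB.
rewrite !mulr1 in EA EB; have -> : 2 * p = p + p by ring.
rewrite -{1}EA -EB -ExD; apply: le_Ex => w _; rewrite !mulr1 /t.
by case: (_ == _); case: (_ == _); rewrite /=; lra.
Qed.

(** Each block of the word is contrasted separately while the rest of the path is kept. The prefix
    [u] carries the induction: blocks already treated are absorbed into it. *)
Lemma Ex_occ_sum_contrast a b :
  b%:R * (p * (phi n0 - 4 * A * n0.+1%:R)) <=
  Ex a (fun u => Ex (b * n0.*2) (fun w => X (u ++ w) * bsum n0.*2 t b w)).
Proof.
elim: b a => [|b IH] a.
  rewrite mul0r mul0n; apply: eq_ler.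
  rewrite -[LHS](Ex0 R V a); apply: eq_Ex => u _.
  by rewrite ExO mulr0.
rewrite mulSn -natr1 mulrDl mul1r addrC.
have -> : Ex a (fun u => Ex (n0.*2 + b * n0.*2) (fun w => X (u ++ w) * bsum n0.*2 t b.+1 w)) =
  Ex a (fun u => Ex n0.*2 (fun s => Ex (b * n0.*2) (fun w => X (u ++ s ++ w)) * t s)) +
  Ex (a + n0.*2) (fun u => Ex (b * n0.*2) (fun w => X (u ++ w) * bsum n0.*2 t b w)).
  rewrite Ex_cat -ExD; apply: eq_Ex => u _; rewrite Ex_cat -ExD; apply: eq_Ex => s ss.
  rewrite -ExZr -ExD; apply: eq_Ex => w _.
  by rewrite -catA /= take_size_cat// drop_size_cat// mulrDr.
rewrite lerD//.
rewrite (eq_Ex (G := fun u => p * Ex (b * n0.*2) (fun w =>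
    X (u ++ zigzag ++ w) - X (u ++ there_and_back ++ w)))).
  by rewrite ExZ ler_wpM2l ?(ltW p0)// Ex_swap_ge.
by move=> u _; rewrite Ex_contrast -ExB.
Qed.

(** Cauchy-Schwarz against the contrast sum [T]: the covariance is at least [b p dl], while [T] is a
    sum of independent centred blocks with second moment at most [2 b p]. *)
Lemma variance_ge b : 0 < phi n0 - 4 * A * n0.+1%:R ->
  b%:R * (p * (phi n0 - 4 * A * n0.+1%:R) ^+ 2 / 2) <=
  Ex (b * n0.*2) (fun w => centered X (b * n0.*2) w ^+ 2).
Proof.
set dl := _ - _ => d0; case: b => [|b].
  by rewrite mul0r; apply: Ex_ge0 => w _; exact: sqr_ge0.
set N := (b.+1 * n0.*2)%N; set T := bsum n0.*2 t b.+1.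
have H1 : b.+1%:R * (p * dl) <= Ex N (fun w => centered X N w * T w).
  apply: le_trans (Ex_occ_sum_contrast 0 b.+1) _; rewrite ExO.
  rewrite (eq_Ex (F := fun w => centered X N w * T w)
    (G := fun w => X w * T w - mean X N * T w)).
    by rewrite ExB ExZ (Ex_bsum V0 _ Ex_contrast0) mulr0 subr0.
  by move=> w _; rewrite /centered mulrBl.
have H2 : Ex N (fun w => T w ^+ 2) <= b.+1%:R * (2 * p).
  by rewrite (Ex_bsum_sq V0 _ Ex_contrast0) ler_wpM2l ?ler0n// Ex_contrast_sq.
have CS := Ex_cauchy_schwarz N (centered X N) T.
set W := Ex N (fun w => centered X N w ^+ 2) in CS *.
have W0 : 0 <= W by apply: Ex_ge0 => w _; exact: sqr_ge0.
have b0 : 0 < b.+1%:R :> R by rewrite ltr0n.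
have bp : 0 < b.+1%:R * (2 * p) by rewrite mulr_gt0// mulr_gt0.
rewrite -(ler_pM2r bp).
have : (b.+1%:R * (p * dl)) ^+ 2 <= W * (b.+1%:R * (2 * p)).
  apply: (@le_trans _ _ (Ex N (fun w => centered X N w * T w) ^+ 2)).
    rewrite lerXn2r// nnegrE ?(le_trans _ H1)// !mulr_ge0 ?ler0n// ltW//.
  by apply: le_trans CS _; rewrite ler_wpM2l.
apply: le_trans; apply: eq_ler; by field.
Qed.

End Swap.

(** * The mean *)

Section Convolution.
Variable R : realType.

Lemma sum_cvg0_le (x : nat -> R) (e : R) : (forall k, 0 <= x k) -> x @ \oo --> 0 ->
  0 < e -> \forall n \near \oo, \sum_(k < n) x k <= e * n%:R.
Proof.
move=> x0 xl e0; have e20 : 0 < e / 2 by rewrite divr_gt0.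
move/cvgrPdist_le : xl => /(_ _ e20)[N _ HN].
near=> n; have Nn : (N <= n)%N by near: n; exact: nbhs_infty_ge.
have n2 : 2 * (\sum_(k < N) x k) / e <= n%:R by near: n; exact: nbhs_infty_ger.
rewrite -(big_mkord xpredT x) (big_cat_nat (leq0n N) Nn)//= big_mkord.
have h1 : \sum_(k < N) x k <= e / 2 * n%:R.
  by move: n2; rewrite ler_pdivrMr// => n2; lra.
have h2 : \sum_(N <= k < n) x k <= e / 2 * n%:R.
  apply: (@le_trans _ _ (\sum_(N <= k < n) e / 2)).
    rewrite big_nat_cond [leRHS]big_nat_cond; apply: ler_sum => k /andP[/andP[Nk _] _].
    by have := HN k Nk; rewrite /= sub0r normrN ger0_norm.
  by rewrite sumr_const_nat -[leLHS]mulr_natr ler_wpM2l ?(ltW e20)// ler_nat leq_subr.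
lra.
Unshelve. all: by end_near. Qed.

(** Cesaro averaging applied to [a_k b_(n-k) - al be = (a_k - al) b_(n-k) + al (b_(n-k) - be)].
    Since [k < n], the index [n - k] starts at 1, which explains the shifted [b k.+1]. *)
Lemma convolution_cvg (a b : nat -> R) (al be : R) :
  a @ \oo --> al -> b @ \oo --> be ->
  (fun n => (\sum_(k < n) a k * b (n - k)%N) / n%:R) @ \oo --> al * be.
Proof.
move=> al_ be_; apply/cvgrPdist_le => e e0.
have [M [M0 bM]] : exists M, 0 < M /\ forall n, `|b n| <= M.
  have [M [_ HM]] := cvg_seq_bounded (cvgP _ be_).
  exists (`|M| + 1); split; first by rewrite ltr_wpDl.
  by move=> n; apply: (HM (`|M| + 1)) => //; rewrite (le_lt_trans (ler_norm _))// ltrDl.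
have e1 : 0 < e / 2 / M by rewrite !divr_gt0.
have A1 : 0 < `|al| + 1 by rewrite ltr_wpDl.
have e2 : 0 < e / 2 / (`|al| + 1) by rewrite !divr_gt0.
have xa : (fun k => `|a k - al|) @ \oo --> 0.
  by rewrite -[0](normr0 R) -(subrr al); apply: cvg_norm; apply: cvgB => //; exact: cvg_cst.
have xb : (fun k => `|b k.+1 - be|) @ \oo --> 0.
  rewrite -[0](normr0 R) -(subrr be); apply: cvg_norm; apply: cvgB; last exact: cvg_cst.
  by rewrite cvg_shiftS.
near=> n; have n0 : (0 < n)%N by near: n; exact: nbhs_infty_gt.
have nR : 0 < n%:R :> R by rewrite ltr0n.
have Sa : \sum_(k < n) `|a k - al| <= e / 2 / M * n%:R.
  by near: n; exact: (@sum_cvg0_le (fun k => `|a k - al|)).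
have Sb : \sum_(k < n) `|b k.+1 - be| <= e / 2 / (`|al| + 1) * n%:R.
  by near: n; exact: (@sum_cvg0_le (fun k => `|b k.+1 - be|)).
have -> : al * be - (\sum_(k < n) a k * b (n - k)%N) / n%:R =
  - (\sum_(k < n) (a k - al) * b (n - k)%N + al * \sum_(k < n) (b k.+1 - be)) / n%:R.
  have -> : \sum_(k < n) (b k.+1 - be) = \sum_(k < n) (b (n - k)%N - be).
    rewrite (reindex_inj rev_ord_inj) /=; apply: eq_bigr => k _; congr (b _ - _).
    by have := ltn_ord k; lia.
  rewrite mulr_sumr -big_split /=.
  have -> : \sum_(k < n) ((a k - al) * b (n - k)%N + al * (b (n - k)%N - be)) =
     \sum_(k < n) a k * b (n - k)%N - \sum_(k < n) al * be.
    by rewrite -sumrB; apply: eq_bigr => k _; ring.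
  rewrite sumr_const card_ord -[_ *+ n]mulr_natr; field; exact: lt0r_neq0.
rewrite normrM normrN [`|n%:R^-1|]gtr0_norm ?invr_gt0// ler_pdivrMr//.
have h1 : `|\sum_(k < n) (a k - al) * b (n - k)%N| <= e / 2 * n%:R.
  apply: le_trans (ler_norm_sum _ _ _) _.
  apply: (@le_trans _ _ (\sum_(k < n) `|a k - al| * M)).
    by apply: ler_sum => k _; rewrite normrM ler_wpM2l.
  rewrite -mulr_suml -ler_pdivlMr//; apply: le_trans Sa _.
  by apply: eq_ler; field; rewrite gt_eqF.
have h2 : `|al * \sum_(k < n) (b k.+1 - be)| <= e / 2 * n%:R.
  rewrite normrM; apply: (@le_trans _ _ ((`|al| + 1) * (e / 2 / (`|al| + 1) * n%:R))).
    apply: ler_pM => //; first by rewrite lerDl.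
    exact: le_trans (ler_norm_sum _ _ _) Sb.
  by apply: eq_ler; field; rewrite gt_eqF.
apply: le_trans (ler_normD _ _) _; lra.
Unshelve. all: by end_near. Qed.

End Convolution.

Section MeanRate.
Variables (R : realType) (V : finType).
Hypothesis V0 : (0 < #|V|)%N.
Variables (X : seq V -> R) (K kap : R).
Local Notation r4 := (root4 R).
Let cr a w := X w - X (take a w) - X (drop a w).
Hypothesis crK : forall a b, norm2 (a + b) (cr a) <= K * r4 (a + b).
Hypothesis mean_cvg : (fun n => mean X n / n%:R) @ \oo --> kap.

(** The dyadic estimate is uniform in [k], and along the lengths [2^k n] the rescaled mean tends to
    [n kap]. For [n = 0], almost additivity of the empty split forces [mean X 0 = 0]. *)
Lemma mean_rate n :
  `|mean X n - n%:R * kap| <= K * (r4 2 / (2 - r4 2)) * r4 n.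
Proof.
have := mean_dyadic V0 crK n; set c := _ / _ => H.
have [->|n0] := posnP n.
  rewrite mul0r subr0 /root4 !sqrtr0 mulr0.
  have := mean_almost_additive V0 crK 0 0.
  rewrite /root4 !sqrtr0 mulr0 addn0 (_ : _ - _ = - mean X 0); last by ring.
  by rewrite normrN.
have nR : 0 < n%:R :> R by rewrite ltr0n.
have lim : (fun k => mean X (2 ^ k * n) / 2 ^+ k) @ \oo --> n%:R * kap.
  have -> : (fun k => mean X (2 ^ k * n) / 2 ^+ k) =
     (fun k => n%:R * (mean X (2 ^ k * n) / (2 ^ k * n)%:R)).
    apply/funext => k; rewrite natrM natrX; field.
    by rewrite gt_eqF//= expf_neq0.
  apply: cvgM; first exact: cvg_cst.
  apply: (cvg_comp (fun k => 2 ^ k * n)%N (fun n => mean X n / n%:R)); last exact: mean_cvg.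
  move=> A [N _ HA]; exists N => // k /= Nk; apply: HA => /=.
  apply: leq_trans Nk _; apply: leq_trans (ltnW (ltn_expl k (ltnSn 1))) _.
  by rewrite leq_pmulr.
apply/ler_addgt0Pr => e e0.
move/cvgrPdist_le : lim => /(_ _ e0)[k _ /(_ k (leqnn k))] /= L.
have {}H : `|mean X (2 ^ k * n) / 2 ^+ k - mean X n| <= K * r4 n * c.
  have k0 : 0 < 2 ^+ k :> R by rewrite exprn_gt0.
  have -> : mean X (2 ^ k * n) / 2 ^+ k - mean X n =
     (mean X (2 ^ k * n) - 2 ^+ k * mean X n) / 2 ^+ k by field; rewrite gt_eqF.
  by rewrite normrM [`|_^-1|]gtr0_norm ?invr_gt0// ler_pdivrMr.
move: L H; set u := _ / 2 ^+ k => L H.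
have -> : mean X n - n%:R * kap = - (u - mean X n) - (n%:R * kap - u) by ring.
apply: le_trans (ler_normB _ _) _; rewrite normrN lerD// mulrAC; exact: H.
Qed.

End MeanRate.

(** * Superadditivity and growth of [k^q] *)

Section Power.
Variables (R : realType) (q : R).
Hypothesis q1 : 1 < q.
Let q0 : q != 0. Proof. by rewrite gt_eqF// (lt_trans ltr01). Qed.

Definition npow (k : nat) : R := k%:R `^ q.

Lemma npow0 : npow 0 = 0. Proof. by rewrite /npow powR0. Qed.

Lemma npow_ge0 k : 0 <= npow k. Proof. exact: powR_ge0. Qed.

Lemma npowE k : npow k = k%:R * k%:R `^ (q - 1).
Proof.
case: k => [|k]; first by rewrite npow0 mul0r.
rewrite /npow -[X in X * _](@powRr1 _ k.+1%:R) ?ler0n// -powRD; last first.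
  by rewrite pnatr_eq0 implybT.
by congr (_ `^ _); ring.
Qed.

(** Write [k^q = k * k^(q-1)] and use that [k^(q-1)] is nondecreasing. *)
Lemma npow_superadd a b : npow a + npow b <= npow (a + b).
Proof.
rewrite !npowE natrD mulrDl.
have h c : (c <= a + b)%N -> c%:R `^ (q - 1) <= (a%:R + b%:R) `^ (q - 1).
  move=> cab; rewrite -natrD; apply: ge0_ler_powR; rewrite ?nnegrE ?ler0n ?ler_nat//.
  by rewrite subr_ge0 ltW.
by rewrite lerD// ler_wpM2l ?ler0n// h ?leq_addr ?leq_addl.
Qed.

(** Induction at base [sqrt (1 + l)]: with [u = sqrt (1 + l)^k], the inductive bound times one
    Bernoulli factor is of order [(u - 1)^2], and [(u - 1)^2 <= u^2 - 1 = (1 + l)^k - 1]. *)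
Lemma natpow_le_exp (m : nat) (l : R) : 0 < l -> exists2 A : R, 0 <= A &
  forall k : nat, k%:R ^+ m.+1 <= A * ((1 + l) ^+ k - 1).
Proof.
have bern (l' : R) (k : nat) : 0 < l' -> k%:R * l' <= (1 + l') ^+ k - 1.
  move=> l0; elim: k => [|k IH]; first by rewrite mul0r expr0 subrr.
  rewrite exprS -natr1; have p : 0 <= k%:R :> R by rewrite ler0n.
  move: IH; set u := (1 + l') ^+ k => IH; nra.
elim: m l => [|m IH] l l0.
  exists l^-1; first by rewrite invr_ge0 ltW.
  by move=> k; rewrite expr1 mulrC ler_pdivlMr// bern.
pose mu := Num.sqrt (1 + l).
have mu2 : mu ^+ 2 = 1 + l by rewrite sqr_sqrtr// addr_ge0// ltW.
have mu1 : 1 < mu.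
  by rewrite -(@ltr_pXn2r _ 2)// ?nnegrE ?sqrtr_ge0// mu2 expr1n ltrDl.
have l'0 : 0 < mu - 1 by rewrite subr_gt0.
have [A A0 HA] := IH _ l'0.
exists (A / (mu - 1)); first by rewrite divr_ge0// ltW.
move=> k; have e1 : 1 + (mu - 1) = mu by ring.
have := HA k; have := bern _ k l'0; rewrite e1 -mu2 -exprM mulnC exprM.
set u := mu ^+ k => h1 h2.
have u1 : 1 <= u by rewrite exprn_ege1// ltW.
rewrite exprSr; have h3 : k%:R <= (u - 1) / (mu - 1) by rewrite ler_pdivlMr.
apply: (@le_trans _ _ (A * (u - 1) * ((u - 1) / (mu - 1)))).
  by apply: ler_pM => //; rewrite ?exprn_ge0 ?ler0n.
have -> : A * (u - 1) * ((u - 1) / (mu - 1)) = A / (mu - 1) * (u - 1) ^+ 2 by ring.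
rewrite ler_wpM2l ?divr_ge0 ?(ltW l'0)//; nra.
Qed.

Lemma npow_le_exp (l : R) : 0 < l -> exists2 A : R, 0 <= A &
  forall k : nat, npow k <= A * ((1 + l) ^+ k - 1).
Proof.
move=> l0; pose m := Num.truncn q.
have [A A0 HA] := natpow_le_exp m l0; exists A => // -[|k].
  by rewrite npow0 expr0 subrr mulr0.
apply: le_trans (HA k.+1); rewrite -powR_mulrn ?ler0n// /npow.
rewrite ler_powR ?ler1n//; apply: ltW; have : 0 <= q by rewrite ltW// (lt_trans ltr01).
by move/truncn_itv => /andP[_].
Qed.

(** Both sides vanish when [a] or [b] is 0. Otherwise [a + b <= 2 a b] turns the power of the sum
    into a product of powers. *)
Lemma npow_cross (l : R) : 0 < l -> exists2 K : R, 0 <= K & forall a b,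
  npow (a + b) - npow a - npow b <= K * (((1 + l) ^+ a - 1) * ((1 + l) ^+ b - 1)).
Proof.
move=> l0; have [A A0 HA] := npow_le_exp l0.
have p0 k : 0 <= (1 + l) ^+ k - 1 by rewrite subr_ge0 exprn_ege1// lerDl ltW.
have two : 0 <= (2 : R) `^ q by exact: powR_ge0.
exists ((2 : R) `^ q * (A * A)); first by rewrite mulr_ge0// mulr_ge0.
move=> [|a] b; first by rewrite add0n npow0 subr0 subrr expr0 subrr mul0r mulr0.
case: b => [|b]; first by rewrite addn0 npow0 subr0 subrr expr0 subrr !mulr0.
apply: (@le_trans _ _ (npow (a.+1 + b.+1))).
  by rewrite -addrA gerDl -opprD oppr_le0 addr_ge0// npow_ge0.
apply: (@le_trans _ _ ((2 : R) `^ q * (npow a.+1 * npow b.+1))).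
  rewrite /npow -!powRM ?ler0n ?mulr_ge0 ?ler0n//.
  have qq : 0 <= q by rewrite ltW// (lt_trans ltr01).
  apply: ge0_ler_powR => //; rewrite ?nnegrE ?mulr_ge0 ?ler0n//.
  by rewrite -!natrM ler_nat; nia.
rewrite -mulrA ler_wpM2l// [leRHS]mulrACA.
by apply: ler_pM; rewrite ?npow_ge0.
Qed.

Lemma npow_incr (l : R) : 0 < l -> l <= 1 -> exists2 A : R, 0 <= A &
  forall r b : nat, (b <= 2)%N -> npow (r + b) - npow r <= A * (1 + l) ^+ r.
Proof.
move=> l0 l1; have [A A0 HA] := npow_le_exp l0.
exists (A * 4); first by rewrite mulr_ge0.
move=> r b b2; apply: (@le_trans _ _ (npow (r + 2))).
  apply: (@le_trans _ _ (npow (r + b))); first by rewrite gerBl npow_ge0.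
  rewrite -(subnKC b2) addnA; apply: le_trans (npow_superadd _ _).
  by rewrite lerDl npow_ge0.
apply: le_trans (HA _) _; rewrite -mulrA ler_wpM2l// exprD.
have : 0 <= (1 + l) ^+ r by rewrite exprn_ge0// addr_ge0// ltW.
set u := (1 + l) ^+ r => u0; have : (1 + l) ^+ 2 <= 4 by nra.
move=> h; have : u * (1 + l) ^+ 2 <= u * 4 by rewrite ler_wpM2l.
lra.
Qed.

(** Makes the gain of a zigzag exceed the mean loss: once [n0^(q-1) >= 8 |A| + 1], [n0^q] beats
    [8 |A| n0], which is at least [4 A (n0 + 1)]. *)
Lemma npow_superlinear (A : R) : exists2 n0 : nat, (0 < n0)%N &
  0 < npow n0 - 4 * A * n0.+1%:R.
Proof.
pose B := 8 * `|A| + 1.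
have B1 : 0 < B by rewrite ltr_wpDl// mulr_ge0.
have p0 : 0 < q - 1 by rewrite subr_gt0.
have p0' : q - 1 != 0 by rewrite gt_eqF.
pose n0 := (Num.truncn (B `^ (q - 1)^-1)).+1.
exists n0 => //; have Bn : B <= n0%:R `^ (q - 1).
  have E : (B `^ (q - 1)^-1) `^ (q - 1) = B by rewrite -powRrM mulVf// powRr1// ltW.
  rewrite -[leLHS]E.
  apply: ge0_ler_powR; rewrite ?nnegrE ?powR_ge0 ?ler0n ?(ltW p0)//.
  by apply: ltW; have /truncn_itv/andP[] := powR_ge0 B (q - 1)^-1.
rewrite npowE subr_gt0; have n1 : 1 <= n0%:R :> R by rewrite ler1n.
rewrite -natr1; move: Bn n1; rewrite /B; set u := _ `^ _; set x := n0%:R => Bn n1.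
have := ler_norm A; set y := `|A| in Bn *; have y0 : 0 <= y by exact: normr_ge0.
move=> Ay; apply: (@le_lt_trans _ _ (4 * y * (x + x))).
  have h1 : A * (x + 1) <= y * (x + 1) by rewrite ler_wpM2r// addr_ge0// (le_trans ler01).
  have h2 : y * (x + 1) <= y * (x + x) by rewrite ler_wpM2l// lerD2l.
  lra.
apply: (@lt_le_trans _ _ (x * (8 * y + 1))); last by rewrite ler_wpM2l// (le_trans ler01).
lra.
Qed.

End Power.

(** * Stein's equation *)

Section UniformContinuity.
Variable R : realType.

Definition unif_cont (u : R -> R) :=
  forall e, 0 < e -> exists2 d, 0 < d & forall x y, `|x - y| <= d -> `|u x - u y| <= e.

(** Only [x] is confined to the segment, so that the case distinction in [unif_cont_vanishing] can
    be made on [x] alone. *)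
Lemma compact_unif_cont (u : R -> R) (A e : R) : continuous u -> 0 < e ->
  exists2 d, 0 < d & forall x y, - A <= x <= A -> `|x - y| <= d -> `|u x - u y| <= e.
Proof.
move=> cu e0.
have /compact_near_coveringP/(_ R (0^'+)%R
    (fun d x => forall y, `|x - y| <= d -> `|u x - u y| <= e)) :=
  @segment_compact R (- A) A.
case.
  move=> x _; have /cvgrPdist_lt /(_ (e / 2)) := cu x; rewrite divr_gt0// => /(_ isT).
  case=> r /= r0 ur; exists (ball x (r / 2), [set d | d < r / 2]) => /=.
    split; first by apply: nbhsx_ballx; rewrite divr_gt0.
    by apply: nbhs_right_lt; rewrite divr_gt0.
  move=> [x' d] [/= xx' dr] y x'y; have h1 : `|u x - u x'| < e / 2.
    apply: ur; apply: lt_trans xx' _; rewrite ltr_pdivrMr//; lra.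
  have h2 : `|u x - u y| < e / 2.
    apply: ur => /=; rewrite -(subrKA x') (le_lt_trans (ler_normD _ _))//.
    have : `|x - x'| < r / 2 by exact: xx'.
    lra.
  rewrite -(subrKA (u x)) (le_trans (ler_normD _ _))// [`|u x' - _|]distrC; lra.
move=> r /= r0 H; exists (r / 2); first by rewrite divr_gt0.
move=> x y xA xy; apply: (H (r / 2)) => //=; last first.
  by rewrite divr_gt0.
rewrite sub0r normrN gtr0_norm ?divr_gt0// ltr_pdivrMr//; lra.
Qed.

Lemma unif_cont_vanishing (u : R -> R) (D c : R) : continuous u -> 0 < c ->
  (forall x, `|u x| <= D / (1 + (c * x) ^+ 2)) -> unif_cont u.
Proof.
move=> cu c0 uD e e0.
have den x : 0 < 1 + (c * x) ^+ 2 by rewrite ltr_wpDr ?sqr_ge0.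
have D0 : 0 <= D.
  by have := le_trans (normr_ge0 _) (uD 0); rewrite mulr0 expr0n addr0 divr1.
pose A := (1 + 2 * D / e) / c.
have small x : A < `|x| -> `|u x| <= e / 2.
  move=> Ax; apply: le_trans (uD x) _; rewrite ler_pdivrMr//.
  have h : 1 + 2 * D / e < c * `|x| by rewrite [c * _]mulrC -ltr_pdivrMr.
  have q0 : 0 <= 2 * D / e by rewrite divr_ge0// ?mulr_ge0// ltW.
  have -> : (c * x) ^+ 2 = (c * `|x|) ^+ 2 by rewrite !exprMn real_normK ?num_real.
  have h2 : 2 * D / e <= (c * `|x|) ^+ 2.
    by move: h q0; set a := 2 * D / e; set b := c * _ => h q0; nra.
  have -> : D = e / 2 * (2 * D / e) by field; rewrite gt_eqF.
  by rewrite ler_wpM2l ?divr_ge0 ?(ltW e0)// (le_trans h2)// lerDr.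
have [d d0 H] := @compact_unif_cont u (A + 1) e cu e0.
exists (Num.min d 1); first by rewrite lt_min d0 ltr01.
move=> x y; rewrite le_min => /andP[xyd xy1].
have [xA|xA] := leP `|x| (A + 1).
  by apply: H => //; rewrite -ler_norml.
have yA : A < `|y|.
  have := lerB_dist x y => h; lra.
have := ler_normB (u x) (u y); have := small x; have := small y yA; move=> h1 h2 h3.
have {}h2 : `|u x| <= e / 2 by apply: h2; lra.
lra.
Qed.

End UniformContinuity.

Section SteinSolution.
Variable R : realType.
Local Notation mu := lebesgue_measure.
Let pdf : R -> R := normal_pdf 0 1.

Lemma stdpdfE x : pdf x = normal_peak 1 * expR (- x ^+ 2 / 2).
Proof. by rewrite /pdf normal_pdfE ?oner_neq0// /normal_fun subr0 expr1n. Qed.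

Lemma stdpdf_gt0 x : 0 < pdf x.
Proof. by rewrite stdpdfE mulr_gt0 ?expR_gt0 ?normal_peak_gt0 ?oner_neq0. Qed.

Lemma is_derive_stdpdf (x : R) : is_derive x (1 : R) pdf (- x * pdf x).
Proof.
have -> : pdf = (cst (normal_peak 1)) * (expR \o (fun x => - x ^+ 2 / 2)).
  by apply/funext => y; rewrite stdpdfE.
have H : is_derive x (1 : R) (fun x : R => - x ^+ 2 / 2) (- x).
  have -> : (fun x : R => - x ^+ 2 / 2) = (- 2^-1) \*: (id ^+ 2).
    by apply/funext => y; rewrite !fctE /= mulNr mulrC scaleNr.
  by apply: is_derive_eq; rewrite /= expr1 scaler1 /GRing.scale/=; field.
have H2 : is_derive x (1 : R) (expR \o (fun x => - x ^+ 2 / 2)) (expR (- x ^+ 2 / 2) * - x).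
  exact: is_derive1_comp.
apply: is_derive_eq.
rewrite scaler0 addr0 /GRing.scale/= !fctE /=; ring.
Qed.

Lemma integrable_bounded_pdf (h : R -> R) B : continuous h -> (forall x, `|h x| <= B) ->
  mu.-integrable setT (EFin \o (fun x => h x * pdf x)).
Proof.
move=> ch hB.
have mh : measurable_fun setT h by exact: measurable_realfun.continuous_measurable_fun.
have ip := @integrable_normal_pdf R 0 1.
apply: (@le_integrable _ _ _ mu _ measurableT _ (fun x => B%:E * (normal_pdf 0 1 x)%:E)%E).
- apply/measurable_EFinP; apply: measurable_funM => //; exact: measurable_normal_pdf.
- move=> x _; rewrite -EFinM !abse_EFin lee_fin !normrM.
  by rewrite ler_wpM2r// (le_trans (hB x))// ler_norm.
- exact: integrableZl.
Qed.

Section Tail.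
Variables (h : R -> R) (B : R).
Hypothesis ch : continuous h.
Hypothesis hB : forall x, `|h x| <= B.
Hypothesis h0 : \int[mu]_x (h x * pdf x) = 0.

Let F x := \int[mu]_(t in `]-oo, x]) (h t * pdf t).

Let ih := integrable_bounded_pdf ch hB.
Let ihS (A : set R) : measurable A -> mu.-integrable A (EFin \o (fun x => h x * pdf x)).
Proof. by move=> mA; apply: integrableS ih. Qed.

Let B0 : 0 <= B. Proof. exact: le_trans (normr_ge0 _) (hB 0). Qed.

Lemma continuous_stdpdf : continuous pdf.
Proof. by apply: continuous_normal_pdf; exact: oner_neq0. Qed.

Lemma is_derive_primitive (x : R) : is_derive x (1 : R) F (h x * pdf x).
Proof.
have [] := @continuous_FTC1 R (fun t => h t * pdf t) -oo%O x (x + 1).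
- by rewrite ltrDl.
- exact: ihS.
- by rewrite ltNyr.
- by apply: continuousM; [exact: ch|exact: continuous_stdpdf].
by move=> dF F'; apply: DeriveDef => //; rewrite -derive1E.
Qed.

Let Rintegral_pdf A : measurable A ->
  \int[mu]_(t in A) (B * pdf t) = B * fine (normal_prob 0 1 A).
Proof.
move=> mA; rewrite RintegralZl//.
exact: (integrableS measurableT mA (@subsetT _ _) (@integrable_normal_pdf R 0 1)).
Qed.

Let bound A : measurable A ->
  `|\int[mu]_(t in A) (h t * pdf t)| <= B * fine (normal_prob 0 1 A).
Proof.
move=> mA; rewrite -Rintegral_pdf//; apply: le_trans (le_normr_Rintegral mA (ihS mA)) _.
have ip := integrableS measurableT mA (@subsetT _ _) (@integrable_normal_pdf R 0 1).
apply: le_Rintegral => //.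
- have := ihS mA; move=> /integrable_norm; exact.
- apply: (eq_integrable mA (fun x => B%:E * (pdf x)%:E)%E) => //; exact: integrableZl.
- by move=> x _; rewrite normrM ler_pM// (ger0_norm (ltW (stdpdf_gt0 x))).
Qed.

Let idR : measurableTypeR R -> R := idfun.
#[local] HB.instance Definition _ :=
  @isMeasurableFun.Build _ _ _ _ idR (@measurable_id _ _ setT).
Let id_RV : {RV (@normal_prob R 0 1) >-> R} := idR.

Lemma primitive_small_left e x : 0 < e -> exists2 y, y <= x & `|F y| <= e.
Proof.
move=> e0; have := cvg_cdfNy0 id_RV => /fine_cvgP[_ /cvgrPdist_lt].
have eB : 0 < e / (B + 1) by rewrite divr_gt0// ltr_wpDl.
move=> /(_ _ eB)[M [_ HM]]; exists (Num.min x (M - 1)); first by rewrite ge_min lexx.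
set y := Num.min _ _.
have := HM y; rewrite /= sub0r normrN => H.
have {}H : `|fine (cdf id_RV y)| < e / (B + 1).
  by apply: H; rewrite /y gt_min ltrBlDr ltrDl ltr01 orbT.
have bd := bound (measurable_itv `]-oo, y]); apply: le_trans bd _.
move: H; rewrite ltr_pdivlMr ?ltr_wpDl// => H.
apply: le_trans _ (ltW H); rewrite mulrC; apply: ler_pM => //.
- by rewrite fine_ge0.
- exact: ler_norm.
- by rewrite lerDl.
Qed.

(** The centring [h0] rewrites [F y] as minus the integral over the upper tail, which is controlled
    like the lower one. *)
Lemma primitive_small_right e x : 0 < e -> exists2 y, x <= y & `|F y| <= e.
Proof.
move=> e0; have := cvg_ccdfy0 id_RV => /fine_cvgP[_ /cvgrPdist_lt].
have eB : 0 < e / (B + 1) by rewrite divr_gt0// ltr_wpDl.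
move=> /(_ _ eB)[M [_ HM]]; exists (Num.max x (M + 1)); first by rewrite le_max lexx.
set y := Num.max _ _.
have := HM y; rewrite /= sub0r normrN => H.
have {}H : `|fine (ccdf id_RV y)| < e / (B + 1).
  by apply: H; rewrite /y lt_max ltrDl ltr01 orbT.
have -> : F y = - \int[mu]_(t in `]y, +oo[) (h t * pdf t).
  apply/eqP; rewrite -addr_eq0 -Rintegral_setU//.
  - by rewrite -itv_bndbnd_setU ?bnd_simp// set_itvNyy h0.
  - by apply: ihS; exact: measurableU.
  - rewrite disj_set2E; apply/eqP/seteqP; split => // t /=.
    by rewrite !in_itv/= andbT => -[ty yt]; move: (lt_le_trans yt ty); rewrite ltxx.
rewrite normrN.
have bd := bound (measurable_itv `]y, +oo[); apply: le_trans bd _.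
move: H; rewrite ltr_pdivlMr ?ltr_wpDl// => H.
apply: le_trans _ (ltW H); rewrite mulrC; apply: ler_pM => //.
- by rewrite fine_ge0.
- exact: ler_norm.
- by rewrite lerDl.
Qed.

(* [s F + B pdf] tends to 0 at both ends, and its derivative [(s h - B x) pdf]
   has a constant sign beyond [1] and beyond [-1]. *)
Let mono (s x y : R) : s ^+ 2 = 1 ->
  (1 <= x /\ x <= y) \/ (x <= -1 /\ y <= x) ->
  s * F y + B * pdf y <= s * F x + B * pdf x.
Proof.
move=> s1 xy.
have dU z : is_derive z (1 : R) (s \*: F + B \*: pdf) ((s * h z - B * z) * pdf z).
  have H1 := is_derive_primitive z; have H2 := is_derive_stdpdf z.
  by apply: is_derive_eq; rewrite /GRing.scale /=; ring.
have cU : continuous (s \*: F + B \*: pdf).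
  move=> z; apply/differentiable_continuous/derivable1_diffP.
  by have [] := dU z.
have hs z : `|s * h z| <= B.
  rewrite normrM (_ : `|s| = 1) ?mul1r//.
  by apply/eqP; rewrite -sqrp_eq1// real_normK ?num_real// s1.
have hs1 z : s * h z <= B by apply: le_trans (hs z); exact: ler_norm.
have hs2 z : - B <= s * h z by rewrite lerNl; apply: le_trans (hs z); rewrite -normrN ler_norm.
have pdf0 z : 0 <= pdf z by exact/ltW/stdpdf_gt0.
case: xy => -[x1 xy].
  have [c cI E] := MVT_segment xy (fun z _ => dU z) (continuous_subspaceT cU).
  rewrite -subr_le0; apply: (@le_trans _ _ ((s * h c - B * c) * pdf c * (y - x))).
    by rewrite -E /GRing.scale /= !fctE /= lexx.
  rewrite mulr_le0_ge0 ?subr_ge0// mulr_le0_ge0// subr_le0.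
  apply: le_trans (hs1 c) _; rewrite ler_peMr//.
  by move: cI; rewrite in_itv/= => /andP[xc _]; exact: le_trans x1 xc.
have [c cI E] := MVT_segment xy (fun z _ => dU z) (continuous_subspaceT cU).
rewrite -subr_ge0; apply: (@le_trans _ _ ((s * h c - B * c) * pdf c * (x - y))); last first.
  by rewrite -E /GRing.scale /= !fctE /= lexx.
rewrite mulr_ge0 ?subr_ge0// mulr_ge0//.
have cx : c <= -1 by move: cI; rewrite in_itv/= => /andP[_ xc]; exact: le_trans xc x1.
rewrite -lerBlDl sub0r lerN2; apply: le_trans (hs2 c).
by rewrite -mulrN1 ler_wpM2l.
Qed.

(** For [s = 1] and [s = -1], [mono] says that [s F + B pdf] decreases away from the origin, while
    it is at least [-e] at suitable far points for every [e > 0]; hence it is nonnegative. *)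
Lemma primitive_tail x : 1 <= `|x| -> `|F x| <= B * pdf x.
Proof.
move=> x1.
have H s : s ^+ 2 = 1 -> 0 <= s * F x + B * pdf x.
  move=> s1; apply/ler_addgt0Pl => e e0; rewrite addrC -lerBlDr sub0r.
  have sF y : `|F y| <= e -> - e <= s * F y + B * pdf y.
    move=> Fe; rewrite -[leLHS]addr0 lerD ?mulr_ge0// ?(ltW (stdpdf_gt0 y))//.
    rewrite lerNl (le_trans (ler_norm _))// normrN normrM (_ : `|s| = 1) ?mul1r//.
    by apply/eqP; rewrite -sqrp_eq1// real_normK ?num_real// s1.
  move: x1; rewrite ler_normr => /orP[x1|x1].
    have [y xy /sF] := primitive_small_right x e0.
    by move/le_trans; apply; apply: mono => //; left.
  have [y xy /sF] := primitive_small_left x e0.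
  move/le_trans; apply; apply: mono => //; right.
  by rewrite lerNr.
have := H 1 (expr1n _ _); have := H (-1); rewrite sqrrN expr1n => /(_ erefl).
by rewrite ler_norml; lra.
Qed.

Definition stein_sol (x : R) : R := F x / pdf x.

Lemma is_derive_stein_sol (x : R) :
  is_derive x (1 : R) stein_sol (h x + x * stein_sol x).
Proof.
have p0 : pdf x != 0 by rewrite gt_eqF// stdpdf_gt0.
have H1 := is_derive_primitive x; have H2 := is_derive_stdpdf x.
have H3 := is_deriveV p0 H2.
have -> : stein_sol = F * (fun y => (pdf y)^-1) by [].
apply: is_derive_eq; rewrite /GRing.scale /= !fctE /=.
by field.
Qed.

(** For [|x| >= 1] the tail estimate gives [B]; for [|x| < 1] the primitive is at most [B] and the
    density at least [pdf 1]. *)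
Lemma stein_sol_bounded : exists D, forall x, `|stein_sol x| <= D.
Proof.
exists (B + B / pdf 1) => x; rewrite /stein_sol normrM normfV.
rewrite (gtr0_norm (stdpdf_gt0 x)) ler_pdivrMr ?stdpdf_gt0//.
have p1 : 0 < pdf 1 by exact: stdpdf_gt0.
have px : 0 < pdf x by exact: stdpdf_gt0.
rewrite mulrDl; have [x1|x1] := leP 1 `|x|.
  by apply: le_trans (primitive_tail x1) _; rewrite lerDl !mulr_ge0 ?invr_ge0// ltW.
apply: (@le_trans _ _ B).
  have := bound (measurable_itv `]-oo, x]); move/le_trans; apply.
  by rewrite ler_piMr// -lee_fin fineK ?fin_num_measure// probability_le1.
rewrite -[leLHS]add0r lerD ?mulr_ge0 ?(ltW px)//.
rewrite -mulrA ler_peMr// mulrC ler_pdivlMr// mul1r !stdpdfE.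
rewrite ler_wpM2l ?normal_peak_ge0// ler_expR ler_pM2r// lerN2.
by rewrite expr1n -[x ^+ 2]real_normK ?num_real// expr_le1// ltW.
Qed.

End Tail.

Lemma stein_equation (f : R -> R) M : continuous f -> (forall x, `|f x| <= M) ->
  exists (g : R -> R) (D : R), (forall x, `|g x| <= D) /\
  forall x : R, is_derive x (1 : R) g
    (f x - \int[mu]_x (f x * pdf x) + x * g x).
Proof.
move=> cf fM; set c := \int[mu]_x _.
have if_ := integrable_bounded_pdf cf fM.
pose h x := f x - c.
have ch : continuous h by move=> x; apply: cvgB; [exact: cf|exact: cvg_cst].
have hB x : `|h x| <= M + `|c|.
  by apply: le_trans (ler_normB _ _) _; rewrite lerD.
have ip1 : \int[mu]_x pdf x = 1 by rewrite /Rintegral integral_normal_pdf.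
have h0 : \int[mu]_x (h x * pdf x) = 0.
  have -> : \int[mu]_x (h x * pdf x) = \int[mu]_x (f x * pdf x - c * pdf x).
    by apply: eq_Rintegral => x _; rewrite mulrBl.
  have ic : mu.-integrable setT (EFin \o (fun x => c * pdf x)).
    have cc : continuous (fun _ : R => c) by move=> x; exact: cvg_cst.
    exact: (integrable_bounded_pdf (B := `|c|) cc).
  rewrite RintegralB// RintegralZl// ?ip1 ?mulr1 ?subrr//.
  exact: integrable_normal_pdf.
have [D HD] := stein_sol_bounded ch hB h0.
exists (stein_sol h), D; split => // x.
exact: (is_derive_stein_sol ch hB).
Qed.

(* The Stein solution times the cutoff [(1 + (c x)^2)^-2], which makes all the
   functions involved vanish at infinity, hence uniformly continuous. *)
Lemma stein_test (f : R -> R) M : continuous f -> (forall x, `|f x| <= M) ->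
  exists2 B : R, 0 <= B & forall c : R, 0 < c -> exists G G' : R -> R,
  [/\ forall x : R, is_derive x (1 : R) G (G' x), unif_cont G',
      unif_cont (fun x => G' x - x * G x), exists D, forall x, `|G' x - x * G x| <= D &
      forall x, `|f x - \int[mu]_x (f x * pdf x) - (G' x - x * G x)| <=
        B * ((c * x) ^+ 2 + c)].
Proof.
move=> cf fM; have [g [D [gD dg]]] := stein_equation cf fM.
set a := \int[mu]_x _ in dg *.
pose h x := f x - a.
have hB x : `|h x| <= M + `|a|.
  by apply: le_trans (ler_normB _ _) _; rewrite lerD.
have B0 : 0 <= M + `|a| by exact: le_trans (normr_ge0 _) (hB 0).
have D0 : 0 <= D by exact: le_trans (normr_ge0 _) (gD 0).
have ch : continuous h by move=> x; apply: cvgB; [exact: cf|exact: cvg_cst].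
have cg : continuous g.
  by move=> x; apply/differentiable_continuous/derivable1_diffP; have [] := dg x.
exists (2 * (M + `|a|) + 2 * D); first by rewrite addr_ge0 ?mulr_ge0.
move=> c c0; pose t (x : R) := 1 + (c * x) ^+ 2.
have t1 x : 1 <= t x by rewrite lerDl sqr_ge0.
have t0 x : 0 < t x by apply: lt_le_trans (t1 x).
have tn0 x : t x != 0 by rewrite gt_eqF.
have dt x : is_derive x (1 : R) t (2 * c ^+ 2 * x).
  have -> : t = cst 1 + (cst c * id) ^+ 2 by apply/funext.
  apply: is_derive_eq; rewrite /GRing.scale /= [(cst c * id) x]/(c * x).
  by rewrite add0r mulr0 addr0 mulr1 expr1 -!mulrA [x * c]mulrC.
have ct : continuous t.
  by move=> x; apply/differentiable_continuous/derivable1_diffP; have [] := dt x.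
pose k (x : R) := (t x)^-1.
have ck : continuous k by move=> x; apply: cvgV => //; exact: ct.
have ck2 : continuous (fun x => k x ^+ 2) by move=> x; exact: (cvgM (ck x) (ck x)).
have ck3 : continuous (fun x => k x ^+ 3) by move=> x; exact: (cvgM (ck x) (ck2 x)).
pose k' (x : R) := - (4 * c ^+ 2 * x) * k x ^+ 3.
have dk x : is_derive x (1 : R) (k ^+ 2) (k' x).
  have H1 := dt x; have H2 : is_derive x (1 : R) k (- (t x) ^- 2 *: (2 * c ^+ 2 * x)).
    exact: is_deriveV.
  apply: is_derive_eq; rewrite /GRing.scale /= /k' /k; rewrite !exprVn; field.
  exact: tn0.
have k0 x : 0 < k x by rewrite invr_gt0.
have k1 x : k x <= 1 by rewrite invf_le1.
have kx x : (c * x) ^+ 2 * k x <= 1.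
  by rewrite ler_pdivrMr// mul1r /t lerDr.
have ckx x : `|c * x| * k x <= 1 / 2.
  rewrite ler_pdivrMr// /t -(real_normK (num_real (c * x))).
  by have := sqr_ge0 (`|c * x| - 1); set u := `|_|; nra.
pose G x := g x * k x ^+ 2.
pose F x := h x * k x ^+ 2 + g x * k' x.
pose G' x := F x + x * G x.
have dG x : is_derive x (1 : R) G (G' x).
  have H1 := dg x; have H2 := dk x.
  have -> : G = g * (k ^+ 2) by apply/funext => y; rewrite !fctE.
  by apply: is_derive_eq; rewrite /GRing.scale /= !fctE /= /G' /F /G /h; ring.
have FE x : G' x - x * G x = F x by rewrite /G' addrK.
have k'b x : `|k' x| <= 2 * c * k x.
  have -> : k' x = - (4 * c) * ((c * x) * k x) * k x ^+ 2 by rewrite /k'; ring.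
  have c4 : 0 <= 4 * c by rewrite mulr_ge0// ltW.
  rewrite normrM [`|k x ^+ 2|]ger0_norm ?sqr_ge0// normrM normrN (ger0_norm c4).
  rewrite [`|c * x * k x|]normrM (ger0_norm (ltW (k0 x))).
  apply: (@le_trans _ _ (4 * c * (1 / 2) * k x ^+ 2)).
    by rewrite ler_wpM2r ?sqr_ge0// ler_wpM2l// mulr_ge0// ltW.
  have -> : 4 * c * (1 / 2) * k x ^+ 2 = 2 * c * (k x * k x) by field.
  rewrite ler_wpM2l ?mulr_ge0 ?(ltW c0)//.
  by rewrite ler_piMr// ltW.
have Fb x : `|F x| <= (M + `|a| + D * (2 * c)) / (1 + (c * x) ^+ 2).
  apply: le_trans (ler_normD _ _) _; rewrite [leRHS]mulrDl -/(t x) lerD//.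
    rewrite normrM (ger0_norm (sqr_ge0 _)) ler_pM ?sqr_ge0//.
    by rewrite expr2 ler_piMr// ltW.
  rewrite normrM -mulrA; apply: ler_pM => //; exact: k'b.
have cF : continuous F.
  move=> x; apply: cvgD; apply: cvgM.
  - exact: ch.
  - exact: ck2.
  - exact: cg.
  - apply: cvgM; last exact: ck3.
    apply: cvgN; apply: cvgM; [exact: cvg_cst|exact: cvg_id].
have cG : continuous (fun x : R => x * G x).
  move=> x; apply: cvgM; first exact: cvg_id.
  by apply: cvgM; [exact: cg|exact: ck2].
have Gb x : `|x * G x| <= (D / c) / (1 + (c * x) ^+ 2).
  have -> : x * G x = c^-1 * (g x * (((c * x) * k x) * k x)).
    by rewrite /G; field; rewrite gt_eqF.
  rewrite normrM gtr0_norm ?invr_gt0// [leRHS](_ : _ = c^-1 * (D * k x)); last first.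
    by rewrite mulrAC mulrC.
  rewrite ler_wpM2l ?invr_ge0 ?(ltW c0)// normrM.
  apply: ler_pM => //; rewrite normrM [`|c * x * k x|]normrM (gtr0_norm (k0 x)).
  rewrite ler_piMl ?(ltW (k0 x))//; have := ckx x; lra.
have ucF : unif_cont F by apply: (unif_cont_vanishing cF c0 Fb).
have ucG : unif_cont (fun x : R => x * G x) by apply: (unif_cont_vanishing cG c0 Gb).
exists G, G'; split => //.
- move=> e e0; have [d1 d10 H1] := ucF _ (divr_gt0 e0 (ltr0Sn R 1)).
  have [d2 d20 H2] := ucG _ (divr_gt0 e0 (ltr0Sn R 1)).
  exists (Num.min d1 d2); first by rewrite lt_min d10 d20.
  move=> x y; rewrite le_min => /andP[xy1 xy2]; rewrite /G'.
  have -> : F x + x * G x - (F y + y * G y) = (F x - F y) + (x * G x - y * G y) by ring.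
  apply: le_trans (ler_normD _ _) _; have := H1 _ _ xy1; have := H2 _ _ xy2; lra.
- by move=> e e0; have [d d0 H] := ucF e e0; exists d => // x y; rewrite !FE; exact: H.
- exists (M + `|a| + D * (2 * c)) => x; rewrite FE; apply: le_trans (Fb x) _.
  rewrite ler_piMr// ?invf_le1//; last exact: t0.
    by rewrite addr_ge0// !mulr_ge0// ltW.
  exact: t1.
- move=> x; rewrite FE /F -/(h x).
  have -> : h x - (h x * k x ^+ 2 + g x * k' x) = h x * (1 - k x ^+ 2) - g x * k' x by ring.
  apply: le_trans (ler_normB _ _) _.
  (* The cutoff costs a multiple of [(c x)^2] on [h], and its derivative a multiple of [c] through
     [g]. The quadratic growth is harmless because the second moment of the normalised variable is
     bounded. *)
  have e1 : `|1 - k x ^+ 2| <= 2 * (c * x) ^+ 2.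
    rewrite ger0_norm ?subr_ge0 ?exprn_ile1 ?(ltW (k0 x))//.
    have tk : t x * k x = 1 by rewrite divff.
    have -> : 1 - k x ^+ 2 = (1 + k x) * (1 - k x) by ring.
    have -> : 1 - k x = (c * x) ^+ 2 * k x by rewrite -{1}tk /t; ring.
    have := k0 x; have := k1 x; have := sqr_ge0 (c * x); set u := _ ^+ 2; set v := k x.
    move=> u0 v1 v0; have h1 : u * v <= u by rewrite ler_piMr.
    have : u * v * v <= u * v by rewrite ler_piMr// mulr_ge0// ltW.
    nra.
  have e2 : `|g x * k' x| <= D * (2 * c).
    rewrite normrM; apply: ler_pM => //; apply: le_trans (k'b x) _.
    by rewrite ler_piMr// mulr_ge0// ltW.
  have e3 : `|h x * (1 - k x ^+ 2)| <= (M + `|a|) * (2 * (c * x) ^+ 2).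
    by rewrite normrM; apply: ler_pM.
  have p1 : 0 <= D * (c * x) ^+ 2 by rewrite mulr_ge0 ?sqr_ge0.
  have p2 : 0 <= (M + `|a|) * c by rewrite mulr_ge0// ltW.
  apply: le_trans (lerD e3 e2) _; move: p1 p2.
  by move: (M + _) ((c * x) ^+ 2) => m u p1 p2; lra.
Qed.

End SteinSolution.

(** * Central limit theorem over words *)

Section BlockCLT.
Variables (R : realType) (V : finType).
Hypothesis V0 : (0 < #|V|)%N.
Variables (m : nat) (t : seq V -> R) (Mt : R).
Hypothesis t0 : Ex m t = 0.
Hypothesis tM : forall w, size w = m -> `|t w| <= Mt.
Let s2 := Ex m (fun w => t w ^+ 2).

Let s20 : 0 <= s2. Proof. by apply: Ex_ge0 => w _; exact: sqr_ge0. Qed.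

Section Step.
Variables (G G' : R -> R) (eta : R).
Hypothesis dG : forall x : R, is_derive x (1 : R) G (G' x).
Hypothesis G'eta : forall x y, `|x - y| <= Mt -> `|G' x - G' y| <= eta.

Let taylor y h : `|h| <= Mt -> `|h * (G (y + h) - G y - h * G' y)| <= eta * h ^+ 2.
Proof.
move=> hM; have cG : continuous G.
  by move=> x; apply/differentiable_continuous/derivable1_diffP; have [] := dG x.
have [z [zE zM]] : exists z, G (y + h) - G y = G' z * h /\ `|z - y| <= `|h|.
  have [h0|h0] := leP 0 h.
    have yh : y <= y + h by rewrite lerDl.
    have [z zI ->] := MVT_segment yh (fun x _ => dG x) (continuous_subspaceT cG).
    exists z; rewrite addrAC subrr add0r; split => //.
    move: zI; rewrite in_itv/= => /andP[z1 z2].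
    by rewrite ger0_norm ?subr_ge0// (ger0_norm h0) lerBlDl.
  have yh : y + h <= y by rewrite gerDl ltW.
  have [z zI E] := MVT_segment yh (fun x _ => dG x) (continuous_subspaceT cG).
  exists z; split; first by rewrite -opprB E; ring.
  move: zI; rewrite in_itv/= => /andP[z1 z2].
  by rewrite ler0_norm ?subr_le0// (ltr0_norm h0); lra.
have -> : h * (G (y + h) - G y - h * G' y) = (G' z - G' y) * h ^+ 2 by rewrite zE; ring.
rewrite normrM [`|h ^+ 2|]ger0_norm ?sqr_ge0// ler_wpM2r ?sqr_ge0//.
by apply: G'eta; apply: le_trans hM.
Qed.

(** Approximate form of Stein's identity [E[S G(S)] = Var S * E[G'(S)]]. The shift [x0] makes the
    induction possible: after one block is peeled, its value moves into the shift. *)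
Lemma block_stein b x0 :
  `|Ex (b * m) (fun w => bsum m t b w * G (x0 + bsum m t b w)) -
    b%:R * s2 * Ex (b * m) (fun w => G' (x0 + bsum m t b w))| <= b%:R * (2 * s2 * eta).
Proof.
elim: b x0 => [|b IH] x0; first by rewrite !ExO /= !mul0r subrr normr0.
pose S w := bsum m t b w; pose bm := (b * m)%N.
have cat (H : R -> R) : Ex (b.+1 * m) (fun w => H (bsum m t b.+1 w)) =
    Ex m (fun u => Ex bm (fun w => H (t u + S w))).
  rewrite mulSn Ex_cat; apply: eq_Ex => u su; apply: eq_Ex => w _ /=.
  by rewrite take_size_cat// drop_size_cat.
rewrite (cat (fun x => x * G (x0 + x))) (cat (fun x => G' (x0 + x))).
pose A u := Ex bm (fun w => S w * G (x0 + t u + S w)) -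
            b%:R * s2 * Ex bm (fun w => G' (x0 + t u + S w)).
(* Error of a single block, [y] being the shifted sum of the others: a Taylor remainder, then the
   cost of moving [G'] from [y] to [y + t u], each at most [s2 * eta]. The terms subtracted in the
   remainder are accounted for by [Ex m t = 0] and the definition of [s2]. *)
pose D y := Ex m (fun u => t u * (G (y + t u) - G y - t u * G' y)) +
            s2 * Ex m (fun u => G' y - G' (y + t u)).
have -> : Ex m (fun u => Ex bm (fun w => (t u + S w) * G (x0 + (t u + S w)))) -
   b.+1%:R * s2 * Ex m (fun u => Ex bm (fun w => G' (x0 + (t u + S w)))) =
   Ex m A + Ex bm (fun w => D (x0 + S w)).
  have -> : Ex bm (fun w => D (x0 + S w)) =
    Ex m (fun u => Ex bm (fun w => t u * G (x0 + t u + S w)) -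
                   s2 * Ex bm (fun w => G' (x0 + t u + S w))).
    rewrite ExB ExZ !(Ex_exchange m bm) -ExZ -ExB; apply: eq_Ex => w _.
    have z1 : Ex m (fun u => t u * G (x0 + S w)) = 0 by rewrite ExZr t0 mul0r.
    have z2 : Ex m (fun u => t u ^+ 2 * G' (x0 + S w)) = s2 * G' (x0 + S w) by rewrite ExZr.
    rewrite /D ExB (Ex_cst V0).
    have -> : Ex m (fun u => t u * (G (x0 + S w + t u) - G (x0 + S w) - t u * G' (x0 + S w))) =
      Ex m (fun u => t u * G (x0 + t u + S w)) - s2 * G' (x0 + S w).
      rewrite -[X in X - _]subr0 -z2 -[X in _ - X - _]z1 -!ExB; apply: eq_Ex => u _.
      have E (a b' c d : R) : a * (b' - c - a * d) = a * b' - a * c - a ^+ 2 * d by ring.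
      by rewrite [x0 + S w + _]addrAC E.
    have -> : Ex m (fun u => G' (x0 + S w + t u)) = Ex m (fun u => G' (x0 + t u + S w)).
      by apply: eq_Ex => u _; rewrite addrAC.
    ring.
  rewrite -ExD -(ExZ m (b.+1%:R * s2)) -ExB; apply: eq_Ex => u _.
  rewrite /A -!(ExZ bm) -!ExB -ExD.
  apply: eq_Ex => w _; rewrite [x0 + (_ + _)]addrA -natr1; ring.
apply: le_trans (ler_normD _ _) _.
rewrite -natr1 mulrDl mul1r lerD//.
  apply: le_trans (Ex_norm _ _) _.
  rewrite -[leRHS](Ex_cst V0 m); apply: le_Ex => u _; exact: IH.
apply: le_trans (Ex_norm _ _) _.
rewrite -[leRHS](Ex_cst V0 bm); apply: le_Ex => w _; rewrite /D.
have -> : 2 * s2 * eta = eta * s2 + s2 * eta by ring.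
apply: le_trans (ler_normD _ _) _; rewrite lerD//.
  apply: le_trans (Ex_norm _ _) _.
  by rewrite /s2 -ExZ; apply: le_Ex => u su; apply: taylor; exact: tM.
rewrite normrM (ger0_norm s20) ler_wpM2l//.
apply: le_trans (Ex_norm _ _) _.
rewrite -[leRHS](Ex_cst V0 m); apply: le_Ex => u su; apply: G'eta.
by rewrite opprD addrA subrr sub0r normrN tM.
Qed.

End Step.

Lemma block_stein_normalized (G G' : R -> R) b eta : 0 < s2 -> (0 < b)%N ->
  (forall x : R, is_derive x (1 : R) G (G' x)) ->
  (forall x y, `|x - y| <= Mt / Num.sqrt (b%:R * s2) -> `|G' x - G' y| <= eta) ->
  `|Ex (b * m) (fun w => G' (bsum m t b w / Num.sqrt (b%:R * s2)) -
     (bsum m t b w / Num.sqrt (b%:R * s2)) * G (bsum m t b w / Num.sqrt (b%:R * s2)))|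
  <= 2 * eta.
Proof.
move=> s2p b0 dG G'eta; set s := Num.sqrt _ in G'eta *.
have bs : 0 < b%:R * s2 by rewrite mulr_gt0// ltr0n.
have s0 : 0 < s by rewrite sqrtr_gt0.
have ss : s ^+ 2 = b%:R * s2 by rewrite sqr_sqrtr// ltW.
pose H x := G (x / s); pose H' x := G' (x / s) / s.
have dH x : is_derive x (1 : R) H (H' x).
  have D := dG (x / s).
  have L : is_derive x (1 : R) (fun x : R => x / s) s^-1.
    have -> : (fun x : R => x / s) = cst s^-1 * id by apply/funext => y; rewrite !fctE /= mulrC.
    by apply: is_derive_eq; rewrite /GRing.scale /= mulr1 mulr0 addr0.
  exact: (@is_derive1_comp R G (fun x => x / s) x _ _ D L).
have Heta x y : `|x - y| <= Mt -> `|H' x - H' y| <= eta / s.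
  move=> xy; rewrite /H' -mulrBl normrM [`|s^-1|]gtr0_norm ?invr_gt0//.
  rewrite ler_wpM2r ?invr_ge0 ?(ltW s0)//; apply: G'eta.
  rewrite -mulrBl normrM [`|s^-1|]gtr0_norm ?invr_gt0//.
  by rewrite ler_wpM2r ?invr_ge0 ?(ltW s0).
have := block_stein dH Heta b 0.
have -> : b%:R * (2 * s2 * (eta / s)) = s * (2 * eta).
  rewrite (_ : b%:R * _ = b%:R * s2 * (2 * eta / s)); last by ring.
  by rewrite -ss; field; rewrite gt_eqF.
have -> : Ex (b * m) (fun w => bsum m t b w * H (0 + bsum m t b w)) -
    b%:R * s2 * Ex (b * m) (fun w => H' (0 + bsum m t b w)) =
  - (s * Ex (b * m) (fun w => G' (bsum m t b w / s) -
      bsum m t b w / s * G (bsum m t b w / s))).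
  rewrite -ss -ExZ -ExB -ExZ -ExN; apply: eq_Ex => w _; rewrite /H /H' add0r.
  by field; rewrite gt_eqF.
by rewrite normrN normrM (gtr0_norm s0) ler_pM2l.
Qed.

End BlockCLT.

Section Limits.
Variables (R : realType) (V : finType).
Hypothesis V0 : (0 < #|V|)%N.
Variables (X : seq V -> R) (K : R).
Local Notation r4 := (root4 R).
Let cr a w := X w - X (take a w) - X (drop a w).

Hypothesis crK : forall a b, norm2 (a + b) (cr a) <= K * r4 (a + b).
Local Notation cen := (centered X).
Local Notation blocks := (blocks X).

Let K0 : 0 <= K.
Proof. by have := le_trans (norm2_ge0 _ _) (crK 0 1); rewrite root4_1 mulr1. Qed.

Lemma root4_near (A : R) : \forall n \near \oo, A <= r4 n.
Proof.
pose A' := Num.max A 0; have A'0 : 0 <= A' by rewrite le_max lexx orbT.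
near=> n; apply: (@le_trans _ _ A'); first by rewrite le_max lexx.
rewrite -(@ler_pXn2r _ 4)// ?nnegrE ?root4_ge0// root4_4.
near: n; exact: nbhs_infty_ger.
Unshelve. all: by end_near. Qed.

Lemma sqrt_ge_root4 n : r4 n <= Num.sqrt n%:R :> R.
Proof.
rewrite -root4_2; case: n => [|n]; first by rewrite /root4 !sqrtr0 expr0n.
by rewrite expr2 ler_peMr ?root4_ge0 ?root4_ge1.
Qed.

(** The order of the quantifiers matters: [m] makes the [m^(-1/4)] term small, then [n], chosen
    after [m], absorbs the remainder sum and the last cross term. Each gets a third of [e]. *)
Lemma block_approx_near (e : R) : 0 < e -> \forall m \near \oo, \forall n \near \oo,
  norm2 n (fun w => cen n w - blocks m (n %/ m) w) <= e * Num.sqrt n%:R.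
Proof.
move=> e0; pose C1 := approx_const K.
have C10 : 0 <= C1.
  have h1 := root4_2_gt1 R.
  by rewrite /C1 /approx_const addr_ge0// !mulr_ge0 ?root4_ge0// invr_ge0 subr_ge0 ltW.
near=> m; have m0 : (0 < m)%N by near: m; exact: nbhs_infty_gt.
have r4m : 0 < r4 m by apply: lt_le_trans (root4_ge1 R m0).
have mA : 3 * C1 / e <= r4 m by near: m; exact: root4_near.
near=> n; apply: le_trans (norm2_block_approx V0 crK n m0) _.
set Km := \sum_(r < m) _.
have nA : 3 * (`|Km| + K) / e <= r4 n by near: n; exact: root4_near.
have sr := sqrt_ge_root4 n.
have s0 : 0 <= Num.sqrt n%:R :> R by exact: sqrtr_ge0.
have h1 : C1 * Num.sqrt n%:R / r4 m <= e / 3 * Num.sqrt n%:R.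
  rewrite mulrAC ler_wpM2r// ler_pdivrMr//.
  by move: mA; rewrite ler_pdivrMr// => mA; lra.
have KA : `|Km| + K <= e / 3 * r4 n.
  by move: nA; rewrite ler_pdivrMr// => nA; lra.
have h2 : Km <= e / 3 * Num.sqrt n%:R.
  apply: le_trans (ler_norm _) _; apply: (@le_trans _ _ (e / 3 * r4 n)).
    by apply: le_trans KA; rewrite lerDl.
  by rewrite ler_wpM2l// divr_ge0// ltW.
have [n0|n0] := posnP n.
  have h3 : K * r4 n <= e / 3 * Num.sqrt n%:R by rewrite n0 /root4 !sqrtr0 !mulr0.
  by rewrite -/C1; lra.
have h3 : K * r4 n <= e / 3 * Num.sqrt n%:R.
  rewrite -root4_2 expr2 mulrA ler_wpM2r ?root4_ge0//; apply: le_trans KA.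
  by rewrite lerDr.
by rewrite -/C1; lra.
Unshelve. all: by end_near. Qed.

Definition sd n := norm2 n (cen n).

Let blocks_take m b n : (b * m <= n)%N ->
  norm2 n (blocks m b) = Num.sqrt b%:R * sd m.
Proof.
move=> bn; rewrite /sd /norm2 -sqrtrM ?ler0n//.
rewrite -(Ex_bsum_sq V0 b (Ex_centered V0 X m)) -(subnKC bn) Ex_cat.
congr Num.sqrt; apply: eq_Ex => u su; rewrite -[RHS](Ex_cst V0 (n - b * m)).
apply: eq_Ex => v _; congr (_ ^+ 2).
by rewrite -{1}[b]addn0 (blocks_cat V0 _ _ _ su) [blocks m 0 v]/0 addr0.
Qed.

Let floor_sqrt m n : (0 < m)%N ->
  `|Num.sqrt (n %/ m)%:R * Num.sqrt m%:R - Num.sqrt n%:R| <= Num.sqrt m%:R :> R.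
Proof.
move=> m0; rewrite -sqrtrM ?ler0n// -natrM.
have h1 : ((n %/ m) * m <= n)%N by exact: leq_trunc_div.
have h2 : (n <= (n %/ m) * m + m)%N.
  by rewrite {1}(divn_eq n m) leq_add2l ltnW// ltn_mod.
rewrite ler0_norm ?subr_le0 ?ler_wsqrtr ?ler_nat// opprB lerBlDl.
apply: (@le_trans _ _ (Num.sqrt ((n %/ m) * m + m)%:R)); first by rewrite ler_wsqrtr// ler_nat.
set a := (_ * _)%N; rewrite -(@ler_pXn2r _ 2)// ?nnegrE ?addr_ge0 ?sqrtr_ge0//.
by rewrite sqrrD !sqr_sqrtr ?ler0n// natrD lerD2r lerDl mulrn_wge0//.
Qed.

Let sdn n := sd n / Num.sqrt n%:R.

(** [sd n] is close to the norm of the block sum, which by independence is exactly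
    [sqrt (n / m) * sd m] with integer division, that is [sqrt n * sdn m] up to [sd m]. *)
Let sd_cauchy (e : R) : 0 < e -> \forall m \near \oo, \forall n \near \oo,
  `|sdn n - sdn m| <= e.
Proof.
move=> e0; near=> m.
have m0 : (0 < m)%N by near: m; exact: nbhs_infty_gt.
near=> n.
have n0 : (0 < n)%N by near: n; exact: nbhs_infty_gt.
have E : norm2 n (fun w => cen n w - blocks m (n %/ m) w) <= e / 2 * Num.sqrt n%:R.
  by near: n; near: m; apply: block_approx_near; rewrite divr_gt0.
have sn0 : 0 < Num.sqrt n%:R :> R by rewrite sqrtr_gt0 ltr0n.
have sm0 : 0 < Num.sqrt m%:R :> R by rewrite sqrtr_gt0 ltr0n.
have := le_trans (ler_norm2B _ _ _) E; rewrite blocks_take ?leq_trunc_div// -/(sd n).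
move: (floor_sqrt n m0); set q := Num.sqrt (n %/ m)%:R => Q H.
have sdm : 0 <= sd m by exact: norm2_ge0.
have nbig : sd m / (e / 2) <= r4 n by near: n; exact: root4_near.
have {}nbig : sd m <= e / 2 * Num.sqrt n%:R.
  move: nbig; rewrite ler_pdivrMr ?divr_gt0// => nb; apply: le_trans nb _.
  by rewrite mulrC ler_wpM2l ?divr_ge0 ?(ltW e0)// sqrt_ge_root4.
have Q2 : `|q * sd m - Num.sqrt n%:R * sdn m| <= sd m.
  have -> : q * sd m - Num.sqrt n%:R * sdn m = (q * Num.sqrt m%:R - Num.sqrt n%:R) * sdn m.
    by rewrite /sdn; field; rewrite gt_eqF.
  rewrite normrM [`|sdn m|]ger0_norm ?divr_ge0 ?(ltW sm0)//.
  rewrite mulrA ler_pdivrMr// mulrC; rewrite [leRHS]mulrC.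
  by rewrite [leLHS]mulrC ler_wpM2r.
have -> : sdn n - sdn m = (sd n - Num.sqrt n%:R * sdn m) / Num.sqrt n%:R.
  by rewrite /sdn; field; rewrite !gt_eqF.
rewrite normrM [`|_^-1|]gtr0_norm ?invr_gt0// ler_pdivrMr//.
have -> : sd n - Num.sqrt n%:R * sdn m = (sd n - q * sd m) + (q * sd m - Num.sqrt n%:R * sdn m).
  by ring.
apply: le_trans (ler_normD _ _) _; lra.
Unshelve. all: by end_near. Qed.

Variables (c0 : R) (N0 : nat).
Hypothesis c00 : 0 < c0.
Hypothesis N00 : (0 < N0)%N.
Hypothesis var_ge : forall b, b%:R * c0 <= Ex (b * N0) (fun w => cen (b * N0) w ^+ 2).

Lemma variance_cvg : exists2 v : R, 0 < v &
  (fun n => Ex n (fun w => cen n w ^+ 2) / n%:R) @ \oo --> v.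
Proof.
have /cauchy_cvgP : cauchy (sdn @ \oo).
  apply/cauchy_ballP => e e0.
  have e20 : 0 < e / 3 by rewrite divr_gt0.
  have [m _ Hm] := sd_cauchy e20; have {}Hm := Hm m (leqnn m).
  pose A := [set x | `|x - sdn m| <= e / 3].
  have sA : (sdn @ \oo) A by rewrite /A /=; exact: Hm.
  exists (A, A) => //= -[x y] [/= Ax Ay]; rewrite /ball /= -(subrKA (sdn m)).
  rewrite [`|_|](_ : _ = `|(x - sdn m) - (y - sdn m)|); last by congr `|_|; ring.
  apply: le_lt_trans (ler_normB _ _) _; move: Ax Ay; rewrite /A /=; lra.
move=> /cvg_ex[s sl].
have sq : (fun n => Ex n (fun w => cen n w ^+ 2) / n%:R) @ \oo --> s ^+ 2.
  have -> : (fun n => Ex n (fun w => cen n w ^+ 2) / n%:R) = (fun n => sdn n * sdn n).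
    apply/funext => n; rewrite -expr2 /sdn exprMn exprVn (sqr_sqrtr (ler0n R n)).
    by rewrite /sd norm2_sq.
  by rewrite expr2; apply: cvgM.
exists (s ^+ 2) => //.
apply: (@lt_le_trans _ _ (c0 / N0%:R)); first by rewrite divr_gt0// ltr0n.
apply/ler_addgt0Pr => e e0.
move/cvgrPdist_le : sq => /(_ e e0)[n1 _ H].
(* The lower bound is available at multiples of [N0], a subsequence that suffices for the sign of
   the limit. *)
have {}H := H (n1.+1 * N0)%N; have /H : (n1 <= n1.+1 * N0)%N.
  by apply: leq_trans (leqnSn n1) _; rewrite leq_pmulr.
have p1 : 0 < N0%:R :> R by rewrite ltr0n.
have p2 : 0 < n1.+1%:R :> R by rewrite ltr0n.
have : c0 / N0%:R <= Ex (n1.+1 * N0) (fun w => cen (n1.+1 * N0) w ^+ 2) / (n1.+1 * N0)%:R.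
  rewrite ler_pdivlMr ?ltr0n ?muln_gt0//; apply: le_trans (var_ge _).
  by rewrite natrM mulrCA mulrC divfK ?gt_eqF// mulrC.
move=> h1; rewrite ler_distlC => /andP[_ h2].
exact: le_trans h1 h2.
Qed.

Section CLT.
Variables (kap v Cm : R).
Hypothesis v0 : 0 < v.
Hypothesis vl : (fun n => Ex n (fun w => cen n w ^+ 2) / n%:R) @ \oo --> v.
Hypothesis meanC : forall n, `|mean X n - n%:R * kap| <= Cm * r4 n.

(** [W] is normalised by the limiting constants, [W'] by the exact standard deviation of its block
    sum, the form in which Stein's estimate applies. *)
Let W n w := (X w - n%:R * kap) / Num.sqrt (n%:R * v).
Let W' m n w := blocks m (n %/ m) w /
  Num.sqrt ((n %/ m)%:R * Ex m (fun w => cen m w ^+ 2)).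

Let sdn_lim : sdn @ \oo --> Num.sqrt v.
Proof.
have -> : sdn = Num.sqrt \o (fun n => Ex n (fun w => cen n w ^+ 2) / n%:R).
  apply/funext => n /=; rewrite /sdn /sd /norm2 sqrtrM; last first.
    by apply: Ex_ge0 => w _; exact: sqr_ge0.
  by rewrite sqrtrV.
by apply: cvg_comp vl _; exact: sqrt_continuous.
Qed.

Let sd_gt0 : \forall m \near \oo, 0 < sd m.
Proof.
have sv : 0 < Num.sqrt v by rewrite sqrtr_gt0.
near=> m; have : `|Num.sqrt v - sdn m| < Num.sqrt v.
  by near: m; move/cvgrPdist_lt : sdn_lim; apply.
rewrite ltr_distl => /andP[_ h].
have {}h : 0 < sdn m by lra.
rewrite lt0r norm2_ge0 andbT; apply: contraTN h => /eqP E.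
by rewrite /sdn E mul0r ltxx.
Unshelve. all: by end_near. Qed.

Let sqrtE m n : Num.sqrt ((n %/ m)%:R * Ex m (fun w => cen m w ^+ 2)) =
  Num.sqrt (n %/ m)%:R * sd m.
Proof. by rewrite sqrtrM ?ler0n. Qed.

Let norm2_W' m n : (m <= n)%N -> (0 < m)%N -> 0 < sd m -> norm2 n (W' m n) = 1.
Proof.
move=> mn m0 sm; rewrite /W' sqrtE; set q := Num.sqrt (n %/ m)%:R.
have q0 : 0 < q by rewrite sqrtr_gt0 ltr0n divn_gt0.
rewrite (eq_norm2 (G := fun w => (q * sd m)^-1 * blocks m (n %/ m) w)); last first.
  by move=> w _; rewrite mulrC.
rewrite norm2Z blocks_take ?leq_trunc_div// -/q.
have qs : 0 < q * sd m by rewrite mulr_gt0.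
by rewrite gtr0_norm ?invr_gt0// mulVf// gt_eqF.
Qed.

Let W_approx (th : R) : 0 < th -> \forall m \near \oo, \forall n \near \oo,
  norm2 n (fun w => W n w - W' m n w) <= th.
Proof.
move=> th0; have sv : 0 < Num.sqrt v by rewrite sqrtr_gt0.
(* Four shares: one for the block approximation, one for the bias of the mean, two for the change of
   normalisation. *)
pose e := th * Num.sqrt v / 4.
have e0 : 0 < e by rewrite divr_gt0// mulr_gt0.
near=> m.
have m0 : (0 < m)%N by near: m; exact: nbhs_infty_gt.
have sm : 0 < sd m by near: m; exact: sd_gt0.
have sml : `|Num.sqrt v - sdn m| <= e.
  by near: m; move/cvgrPdist_le : sdn_lim; apply.
near=> n.
have n0 : (0 < n)%N by near: n; exact: nbhs_infty_gt.
have mn : (m <= n)%N by near: n; exact: nbhs_infty_ge.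
have E : norm2 n (fun w => cen n w - blocks m (n %/ m) w) <= e * Num.sqrt n%:R.
  by near: n; near: m; exact: block_approx_near.
have sn0 : 0 < Num.sqrt n%:R :> R by rewrite sqrtr_gt0 ltr0n.
have sm0 : 0 < Num.sqrt m%:R :> R by rewrite sqrtr_gt0 ltr0n.
have nbig A : A / e <= r4 n -> A <= e * Num.sqrt n%:R.
  rewrite ler_pdivrMr// => nb; apply: le_trans nb _.
  by rewrite mulrC ler_wpM2l ?(ltW e0)// sqrt_ge_root4.
have b1 : sd m <= e * Num.sqrt n%:R by apply: nbig; near: n; exact: root4_near.
have b2 : Cm * r4 n <= e * Num.sqrt n%:R.
  have h : Cm <= e * r4 n.
    by rewrite -[leLHS](divfK (lt0r_neq0 e0)) mulrC ler_pM2l//; near: n; exact: root4_near.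
  by rewrite -root4_2 expr2 mulrA ler_wpM2r ?root4_ge0.
rewrite /W /W' sqrtE; set q := Num.sqrt (n %/ m)%:R.
have q0 : 0 < q by rewrite sqrtr_gt0 ltr0n divn_gt0.
have snv : Num.sqrt (n%:R * v) = Num.sqrt n%:R * Num.sqrt v by rewrite sqrtrM ?ler0n.
set s := Num.sqrt (n%:R * v) in snv *.
have s0 : 0 < s by rewrite snv mulr_gt0.
have qs : 0 < q * sd m by rewrite mulr_gt0.
rewrite (eq_norm2 (G := fun w => s^-1 * (cen n w - blocks m (n %/ m) w) +
   (s^-1 * (mean X n - n%:R * kap) + (s^-1 - (q * sd m)^-1) * blocks m (n %/ m) w)));
  last by move=> w _; rewrite /centered; ring.
apply: le_trans (ler_norm2D _ _ _) _; rewrite norm2Z (gtr0_norm (_ : 0 < s^-1)) ?invr_gt0//.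
apply: (@le_trans _ _ (s^-1 * (e * Num.sqrt n%:R) + (s^-1 * (e * Num.sqrt n%:R) +
     s^-1 * (2 * e * Num.sqrt n%:R)))); last first.
  rewrite snv /e; apply: eq_ler; field.
  by rewrite !gt_eqF.
apply: lerD; first by rewrite ler_wpM2l// invr_ge0 ltW.
apply: le_trans (ler_norm2D _ _ _) _; apply: lerD.
  rewrite /norm2 (Ex_cst V0) sqrtr_sqr normrM gtr0_norm ?invr_gt0//.
  by rewrite ler_wpM2l ?invr_ge0 ?(ltW s0)//; apply: le_trans (meanC n) b2.
rewrite norm2Z blocks_take ?leq_trunc_div// -/q.
have -> : `|s^-1 - (q * sd m)^-1| * (q * sd m) = s^-1 * `|q * sd m - s|.
  rewrite -{2}[q * sd m]gtr0_norm// -normrM -{2}[s^-1]gtr0_norm ?invr_gt0// -normrM.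
  by congr `|_|; field; rewrite !gt_eqF.
rewrite ler_wpM2l ?invr_ge0 ?(ltW s0)//.
have -> : q * sd m - s = (q * Num.sqrt m%:R - Num.sqrt n%:R) * sdn m +
    Num.sqrt n%:R * (sdn m - Num.sqrt v).
  by rewrite snv /sdn; field; rewrite gt_eqF.
apply: le_trans (ler_normD _ _) _.
have -> : 2 * e * Num.sqrt n%:R = e * Num.sqrt n%:R + Num.sqrt n%:R * e by ring.
apply: lerD; last first.
  by rewrite normrM (gtr0_norm sn0) ler_wpM2l ?(ltW sn0)// distrC.
apply: le_trans b1; rewrite normrM [`|sdn m|]ger0_norm ?divr_ge0 ?norm2_ge0 ?(ltW sm0)//.
rewrite mulrA ler_pdivrMr// mulrC; rewrite ler_wpM2l ?(ltW sm)//.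
exact: floor_sqrt.
Unshelve. all: by end_near. Qed.

(** With [m] fixed, a block is bounded by [Mt] (crudely, a sum over all words of length [m]) while
    the normalisation grows with [n], so uniform continuity of [G'] applies to a single
    increment. *)
Let W'_stein (G G' : R -> R) m e : (0 < m)%N -> 0 < sd m -> 0 < e ->
  (forall x : R, is_derive x (1 : R) G (G' x)) -> unif_cont G' ->
  \forall n \near \oo, `|Ex n (fun w => G' (W' m n w) - W' m n w * G (W' m n w))| <= e.
Proof.
move=> m0 sm e0 dG ucG'.
pose Mt := \sum_(t : m.-tuple V) `|cen m t|.
have Mt0 : 0 <= Mt by apply: sumr_ge0 => i _; exact: normr_ge0.
have tM w : size w = m -> `|cen m w| <= Mt.
  move=> sw; have -> : w = Tuple (introT eqP sw) by [].
  rewrite /Mt (bigD1 (Tuple (introT eqP sw)))//= lerDl.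
  by apply: sumr_ge0 => i _; exact: normr_ge0.
have [d d0 Hd] := ucG' _ (divr_gt0 e0 (ltr0Sn R 1)).
have s2p : 0 < Ex m (fun w => cen m w ^+ 2) by rewrite -norm2_sq exprn_gt0.
near=> n; have mn : (m <= n)%N by near: n; exact: nbhs_infty_ge.
set b := (n %/ m)%N.
have b0 : (0 < b)%N by rewrite divn_gt0.
have Hb x y : `|x - y| <= Mt / Num.sqrt (b%:R * Ex m (fun w => cen m w ^+ 2)) ->
    `|G' x - G' y| <= e / 2.
  move=> xy; apply: Hd; apply: le_trans xy _; rewrite sqrtE -/b.
  rewrite ler_pdivrMr ?mulr_gt0 ?sqrtr_gt0 ?ltr0n//.
  have nA : 2 * (Num.sqrt m%:R + Num.sqrt m%:R * (Mt / (d * sd m))) <= Num.sqrt n%:R.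
    by apply: le_trans (sqrt_ge_root4 n); near: n; exact: root4_near.
  have sm0 : 0 < Num.sqrt m%:R :> R by rewrite sqrtr_gt0 ltr0n.
  have := floor_sqrt n m0; rewrite ler_norml -/b => /andP[h _].
  have h2 : Num.sqrt m%:R * (Mt / (d * sd m)) <= Num.sqrt b%:R * Num.sqrt m%:R.
    have : 0 <= Num.sqrt m%:R * (Mt / (d * sd m)).
      by rewrite mulr_ge0 ?(ltW sm0)// divr_ge0// mulr_ge0// ltW.
    set u := Num.sqrt m%:R * (Mt / _) in nA * => u0; lra.
  move: h2; rewrite mulrC ler_pM2r// ler_pdivrMr ?mulr_gt0//.
  by rewrite mulrCA.
have := block_stein_normalized V0 (Ex_centered V0 X m) tM s2p b0 dG Hb.
have -> : 2 * (e / 2) = e by field.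
apply: le_trans; apply: eq_ler; congr `|_|.
have bn : (b * m <= n)%N by exact: leq_trunc_div.
rewrite -{1}(subnKC bn) Ex_cat; apply: eq_Ex => u su.
rewrite -[RHS](Ex_cst V0 (n - b * m)); apply: eq_Ex => y _.
have -> : W' m n (u ++ y) = W' m n u => //.
rewrite /W' -/b; congr (_ / _).
rewrite -{1}[b]addn0 (blocks_cat V0 _ _ _ su).
have -> : blocks m 0 y = 0 by [].
by rewrite addr0.
Unshelve. all: by end_near. Qed.

(** Three comparisons with [F = G' - x G]: [f - Nf] against [F] at [W], through the cutoff error;
    [F] at [W] against [F] at [W'], through L2 closeness; and the mean of [F] at [W'] against 0,
    through Stein. The parameters are chosen in the order [c], [d], [th], [m], [n]. *)
Lemma clt_words (f : R -> R) M : continuous f -> (forall x, `|f x| <= M) ->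
  (fun n => Ex n (fun w => f (W n w))) @ \oo -->
  \int[lebesgue_measure]_x (f x * normal_pdf 0 1 x).
Proof.
move=> cf fM; have [B B0 H] := stein_test cf fM; set Nf := Rintegral _ _ _ in H *.
apply/cvgrPdist_le => e e0.
(* As [c <= 1] and the second moment of [W] is at most 4, the cutoff error is at most [5 B c]. *)
pose c := Num.min 1 (e / (20 * (B + 1))).
have B1 : 0 < B + 1 by rewrite ltr_wpDl.
have c0' : 0 < c by rewrite lt_min ltr01 divr_gt0// mulr_gt0.
have c1 : c <= 1 by rewrite ge_min lexx.
have cB : 5 * B * c <= e / 4.
  have h : c * (20 * (B + 1)) <= e by rewrite -ler_pdivlMr ?mulr_gt0// ge_min lexx orbT.
  have : 0 <= c by exact: ltW.
  lra.
have [G [G' [dG ucG' ucF [D FD] fF]]] := H c c0'.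
pose F x := G' x - x * G x.
have D0 : 0 <= D by exact: le_trans (normr_ge0 _) (FD 0).
have D1 : 0 < D + 1 by rewrite ltr_wpDl.
have e40 : 0 < e / 4 by rewrite divr_gt0.
have [d d0 Hd] := ucF _ e40.
pose k := Num.min 1 (e / (8 * (D + 1))).
have k0 : 0 < k by rewrite lt_min ltr01 divr_gt0// mulr_gt0.
have k1 : k <= 1 by rewrite ge_min lexx.
have kD : 2 * D * k <= e / 4.
  have h : k * (8 * (D + 1)) <= e by rewrite -ler_pdivlMr ?mulr_gt0// ge_min lexx orbT.
  have : 0 <= k by exact: ltW.
  lra.
(* [th <= 1] gives [norm2 W <= 2], since [W'] has norm 1; [th <= d k] turns the Chebyshev term
   [2 D th^2 / d^2] below into at most [2 D k]. *)
pose th := Num.min 1 (d * k).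
have th0 : 0 < th by rewrite lt_min ltr01 mulr_gt0.
have th1 : th <= 1 by rewrite ge_min lexx.
have thd : th <= d * k by rewrite ge_min lexx orbT.
have [m [m0 sm Hm]] : exists m, [/\ (0 < m)%N, 0 < sd m &
    \forall n \near \oo, norm2 n (fun w => W n w - W' m n w) <= th].
  near \oo => m; exists m; split.
  - by near: m; exact: nbhs_infty_gt.
  - by near: m; exact: sd_gt0.
  - by near: m; exact: W_approx.
near=> n.
have mn : (m <= n)%N by near: n; exact: nbhs_infty_ge.
have Wth : norm2 n (fun w => W n w - W' m n w) <= th by near: n.
have St : `|Ex n (fun w => F (W' m n w))| <= e / 4 by near: n; exact: W'_stein.
have W2 : norm2 n (W n) <= 2.
  have E : norm2 n (W n) = norm2 n (fun w => W' m n w + (W n w - W' m n w)).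
    by apply: eq_norm2 => w _; rewrite addrC subrK.
  rewrite E; apply: le_trans (ler_norm2D _ _ _) _; rewrite norm2_W'//.
  by have := le_trans Wth th1; lra.
have A1 : `|Ex n (fun w => F (W n w) - F (W' m n w))| <= e / 4 + e / 4.
  apply: le_trans (Ex_norm _ _) _.
  (* Pointwise Chebyshev: either the two variables are within [d], or the quadratic term already
     exceeds the trivial bound [2 D]. *)
  apply: (@le_trans _ _ (Ex n (fun w => e / 4 + 2 * D / d ^+ 2 * (W n w - W' m n w) ^+ 2))).
    apply: le_Ex => w _; have [h|h] := leP `|W n w - W' m n w| d.
      apply: le_trans (Hd _ _ h) _; rewrite lerDl mulr_ge0 ?sqr_ge0//.
      by rewrite divr_ge0 ?sqr_ge0// mulr_ge0.
    apply: (@le_trans _ _ (2 * D)).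
      apply: le_trans (ler_normB _ _) _.
      by have := FD (W n w); have := FD (W' m n w); rewrite -/(F _) -/(F (W n w)); lra.
    rewrite -[leLHS]add0r lerD ?(ltW e40)// mulrAC -mulrA ler_peMr ?mulr_ge0//.
    rewrite ler_pdivlMr ?exprn_gt0// mul1r -[leRHS]real_normK ?num_real//.
    by rewrite lerXn2r ?nnegrE// ltW.
  rewrite ExD (Ex_cst V0) ExZ lerD2l; apply: (le_trans _ kD).
  rewrite -norm2_sq [leLHS]mulrAC -[leLHS]mulrA ler_wpM2l ?mulr_ge0// ler_pdivrMr ?exprn_gt0//.
  apply: (@le_trans _ _ ((d * k) ^+ 2)).
    by rewrite lerXn2r ?nnegrE ?norm2_ge0 ?mulr_ge0 ?(ltW d0) ?(ltW k0)// (le_trans Wth).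
  by rewrite exprMn mulrC ler_wpM2r ?sqr_ge0// expr2 ler_piMr// ltW.
have A2 : `|Ex n (fun w => f (W n w) - Nf - F (W n w))| <= e / 4.
  apply: le_trans (Ex_norm _ _) _; apply: (le_trans _ cB).
  apply: (@le_trans _ _ (Ex n (fun w => B * c ^+ 2 * W n w ^+ 2 + B * c))).
    apply: le_Ex => w _; apply: le_trans (fF (W n w)) _.
    by apply: eq_ler; ring.
  rewrite ExD ExZ (Ex_cst V0) -norm2_sq.
  have h4 : norm2 n (W n) ^+ 2 <= 4.
    have -> : 4 = 2 ^+ 2 :> R by ring.
    by rewrite lerXn2r ?nnegrE ?norm2_ge0.
  have h5 : B * c ^+ 2 * norm2 n (W n) ^+ 2 <= B * c * 4.
    apply: ler_pM => //; [by apply: mulr_ge0 => //; exact: sqr_ge0|exact: sqr_ge0|].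
    by rewrite ler_wpM2l// expr2 ler_piMr// ltW.
  lra.
have -> : Nf - Ex n (fun w => f (W n w)) =
   - (Ex n (fun w => f (W n w) - Nf - F (W n w)) +
      Ex n (fun w => F (W n w) - F (W' m n w)) + Ex n (fun w => F (W' m n w))).
  by rewrite -{1}(Ex_cst V0 n Nf) -ExB -!ExD -ExN; apply: eq_Ex => w _; ring.
rewrite normrN; apply: le_trans (ler_normD _ _) _.
apply: (@le_trans _ _ (e / 4 + (e / 4 + e / 4) + e / 4)); last by lra.
by apply: lerD => //; apply: le_trans (ler_normD _ _) _; exact: lerD.
Unshelve. all: by end_near. Qed.

End CLT.

End Limits.

(** * From words to the random walk *)

Section Words.
Variables (R : rcfType) (V : finType).

Fixpoint words n : seq (seq V) :=
  if n is n'.+1 then [seq s :: w | s <- enum V, w <- words n'] else [:: [::]].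

Lemma words_uniq n : uniq (words n).
Proof.
elim: n => [//|n IH] /=; rewrite allpairs_uniq ?enum_uniq//.
by move=> [s w] [s' w'] _ _ [-> ->].
Qed.

Lemma size_words n w : w \in words n -> size w = n.
Proof.
elim: n w => [|n IH] w /=; first by rewrite inE => /eqP ->.
by move=> /allpairsP[[s u] /= [_ uw ->]] /=; rewrite IH.
Qed.

Lemma mem_words w : w \in words (size w).
Proof.
elim: w => [|s w IH] //=; apply/allpairsP; exists (s, w); split => //=.
by rewrite mem_enum.
Qed.

Lemma Ex_words n (F : seq V -> R) : Ex n F = #|V|%:R ^- n * \sum_(w <- words n) F w.
Proof.
elim: n F => [|n IH] F; first by rewrite ExO big_seq1 expr0 invr1 mul1r.
rewrite ExS exprS invfM -mulrA big_allpairs_dep /= big_enum /=.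
by congr (_ * _); rewrite mulr_sumr; apply: eq_bigr => s _; rewrite IH.
Qed.

End Words.

Lemma srw_step_inj d : injective (@srw_step d).
Proof.
move=> [i b] [j c] /matrixP /(_ ord0) E.
have ij : i = j.
  move: (E i) => {E}; rewrite /srw_step /=; have [//|ne] := eqVneq i j.
  case: b; case: c => /=; rewrite !mxE !eqxx (negbTE ne) /= ?oppr0 => /eqP;
  by rewrite ?oppr_eq0 oner_eq0.
rewrite -{}ij in E *; move: (E i) => {E}; rewrite /srw_step /=.
by case: b; case: c => //=; rewrite !mxE !eqxx.
Qed.

Lemma measurable_preimage_countable (disp : measure_display) (T : measurableType disp)
    (E : countType) (f : T -> E) (A : set E) :
  (forall z, measurable [set w | f w = z]) -> measurable (f @^-1` A).
Proof.
move=> mf; rewrite (_ : _ @^-1` _ = \bigcup_(c : nat)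
    (if unpickle c is Some z then (if `[< A z >] then [set w | f w = z] else set0) else set0)).
  apply: bigcupT_measurable => c; case: unpickle => [z|]; last exact: measurable0.
  by case: ifP => _; [exact: mf|exact: measurable0].
apply/seteqP; split => w /=.
  by move=> Aw; exists (pickle (f w)) => //=; rewrite pickleK; case: asboolP.
by move=> [c _]; case: unpickle => // z; case: asboolP => // Az /= ->.
Qed.

Section Bridge.
Variables (R : realType) (disp : measure_display) (T : measurableType disp)
  (P : probability T R) (d : nat) (S : nat -> T -> 'rV[int]_d).
Hypothesis d0 : (0 < d)%N.
Hypothesis hS : simple_random_walk P S.
Let V := ('I_d * bool)%type.
Local Notation st := (@srw_step d).
Let V0 : (0 < #|{: V}|)%N.
Proof. by rewrite card_prod card_ord card_bool muln_gt0 d0. Qed.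

Definition visited n (w : T) := [seq S k w | k <- iota 0 n].

Lemma measurable_visited n (A : set (seq 'rV[int]_d)) : measurable (visited n @^-1` A).
Proof.
have single a k z : measurable [set w | [seq S i w | i <- iota a k] = z].
  elim: k a z => [|k IH] a z.
    case: z => [|x z]; first by rewrite (_ : [set _ | _] = setT)//; apply/seteqP; split.
    by rewrite (_ : [set _ | _] = set0)//; apply/seteqP; split.
  case: z => [|x z]; first by rewrite (_ : [set _ | _] = set0)//; apply/seteqP; split.
  rewrite (_ : [set _ | _] =
    (S a @^-1` [set x]) `&` [set w | [seq S i w | i <- iota a.+1 k] = z]).
    by apply: measurableI; [exact: (srw_measurable hS)|exact: IH].
  by apply/seteqP; split => w /= => [[-> ->]|[-> ->]].
by apply: measurable_preimage_countable => z; exact: single.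
Qed.

Lemma measurable_fun_visited n (H : seq 'rV[int]_d -> R) :
  measurable_fun setT (fun w => H (visited n w)).
Proof.
move=> _ B mB; rewrite setTI.
exact: (measurable_visited n (H @^-1` B)).
Qed.

Lemma P_step k (s : V) : P (walk_step S k @^-1` [set st s]) = (#|{: V}|%:R^-1)%:E.
Proof.
rewrite card_prod card_ord card_bool muln2; case: s => i [] /=.
  exact: (srw_unif_pos hS).
exact: (srw_unif_neg hS).
Qed.

Lemma measurable_step k A : measurable (walk_step S k @^-1` A).
Proof.
rewrite (_ : _ @^-1` _ = visited k.+2 @^-1` [set l | A (nth 0 l k.+1 - nth 0 l k)]).
  exact: measurable_visited.
have h1 : (k < k.+2)%N by rewrite ltnS leqnSn.
have E w : nth 0 (visited k.+2 w) k.+1 - nth 0 (visited k.+2 w) k = walk_step S k w.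
  by rewrite /visited !(nth_map 0%N) ?size_iota// !nth_iota.
by apply/seteqP; split => w; rewrite -[X in X -> _]/(A _) -[X in _ -> X]/(A _) E.
Qed.

Definition cyl (u : seq V) : set T :=
  \big[setI/setT]_(k <- iota 0 (size u))
     (walk_step S k @^-1` [set st (nth (Ordinal d0, true) u k)]).

Lemma cylE u w : cyl u w <-> forall k, (k < size u)%N ->
  walk_step S k w = st (nth (Ordinal d0, true) u k).
Proof.
rewrite /cyl -bigcap_seq; split=> H k.
  by move=> ku; apply: (H k); rewrite /= mem_iota.
by rewrite /= mem_iota add0n => /H.
Qed.

Lemma P_cyl u : P (cyl u) = (#|{: V}|%:R ^- size u)%:E.
Proof.
have := srw_indep hS (fun k => [set st (nth (Ordinal d0, true) u k)]) (iota_uniq 0 (size u)).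
move=> ->; under eq_bigr do rewrite P_step.
rewrite big_const_seq count_predT size_iota.
elim: (size u) => [|n IH]; first by rewrite /= expr0 invr1.
by rewrite iterS IH -EFinM exprS invfM.
Qed.

Lemma measurable_cyl u : measurable (cyl u).
Proof. by apply: big_rec => // k A _ mA; apply: measurableI => //; exact: measurable_step. Qed.

(** The [2d] step events are disjoint and their probabilities add up to 1. *)
Lemma step_ae k : P.-negligible [set w | forall s : V, walk_step S k w <> st s].
Proof.
pose F (s : V) := walk_step S k @^-1` [set st s].
have mU : measurable (\bigcup_(s in [set` enum {: V}]) F s).
  by apply: fin_bigcup_measurable => // s _; exact: measurable_step.
exists (~` \bigcup_(s in [set` enum {: V}]) F s); split.
- exact: measurableC.
- rewrite probability_setC// measure_fin_bigcup//; last 2 first.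
  + move=> s s' _ _ [w [/= E1 E2]]; apply: srw_step_inj; by rewrite -E1 -E2.
  + by move=> s _; exact: measurable_step.
  rewrite -fsbig_seq ?enum_uniq//= big_enum /=.
  under eq_bigr do rewrite /F P_step.
  rewrite sumEFin sumr_const -[_ *+ _]mulr_natr mulVf ?subee//.
  by rewrite pnatr_eq0 -lt0n.
- by move=> w /= Hw [s _ /= E]; exact: (Hw s).
Qed.

Lemma visited_cyl u w : cyl u w -> visited (size u) w = trail st 0 u.
Proof.
move/cylE => H; rewrite /visited; have S0 := srw_start hS w.
suff G a x v : S a w = x -> (forall k, (k < size v)%N ->
    walk_step S (a + k) w = st (nth (Ordinal d0, true) v k)) ->
    [seq S k w | k <- iota a (size v)] = trail st x v.
  by apply: G => // k ku; rewrite add0n H.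
elim: v a x => [//|s v IH] a x Sa Hv /=; rewrite Sa; congr (_ :: _).
apply: IH.
  by have := Hv 0%N isT; rewrite addn0 /walk_step /= => <-; rewrite -Sa addrC subrK.
by move=> k kv; rewrite addSnnS; exact: (Hv k.+1).
Qed.

(** Outside a null set every step is a unit vector, so [w] lies in exactly one cylinder of length
    [n], and [H (visited n w)] is a finite combination of indicators of equally likely cylinders. *)
Lemma walk_integral n (H : seq 'rV[int]_d -> R) :
  (\int[P]_w (H (visited n w))%:E = (Ex n (fun u => H (trail st 0 u)))%:E)%E.
Proof.
pose c u := H (trail st 0 u).
have mc u : measurable_fun setT (fun w => c u * \1_(cyl u) w).
  by apply: measurable_funM => //; apply: measurable_indic; exact: measurable_cyl.
rewrite (ae_eq_integral
  (fun w => (\sum_(u <- words V n) (c u * \1_(cyl u) w)%:E)%E))//; last 3 first.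
- exact/measurable_EFinP/measurable_fun_visited.
- by apply: emeasurable_sum => u; exact/measurable_EFinP/mc.
- have : P.-negligible (\bigcup_k [set w | forall s : V, walk_step S k w <> st s]).
    by apply: negligible_bigcup => k; exact: step_ae.
  apply: negligibleS => w /= Hw; apply: contrapT => Hn; apply: Hw => _.
  have {}Hn k : exists s, walk_step S k w = st s.
    apply: contrapT => Hs; apply: Hn; exists k => //= s E; apply: Hs; by exists s.
  have [f Hf] := choice Hn.
  pose u := mkseq f n.
  have cu : cyl u w.
    by apply/cylE => k; rewrite size_mkseq => kn; rewrite nth_mkseq.
  have su : size u = n by exact: size_mkseq.
  rewrite (bigD1_seq u)/=; [|by rewrite -su mem_words|exact: words_uniq].
  rewrite indicE mem_set// mulr1 /c -(visited_cyl cu) su big_seq_cond big1 ?adde0//.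
  move=> v /andP[/size_words sv vu]; rewrite indicE memNset ?mulr0//.
  move=> cv; move/negP: vu; apply; apply/eqP.
  apply: (@eq_from_nth _ (Ordinal d0, true)); rewrite ?sv ?su// => k kn.
  apply: srw_step_inj; move/cylE : cv => <-; rewrite ?sv//.
  by move/cylE : cu => <-; rewrite ?su.
rewrite integral_sum//; last first.
  move=> u; apply: (eq_integrable measurableT (fun w => (c u)%:E * (\1_(cyl u) w)%:E)%E) => //.
  by apply: integrableZl => //; apply: integrable_indic; exact: measurable_cyl.
rewrite Ex_words mulr_sumr -sumEFin big_seq [RHS]big_seq; apply: eq_bigr => u /size_words su.
under eq_integral do rewrite EFinM.
rewrite integralZl//; last by apply: integrable_indic; exact: measurable_cyl.
have mcu := measurable_cyl u.
by rewrite integral_indic// setIT [X in (_ * X)%E](P_cyl u) su -EFinM mulrC.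
Qed.

End Bridge.

(** The Radon-Nikodym derivative of the normal law agrees almost everywhere with [normal_pdf], both
    having the same integral over every measurable set. *)
Lemma integral_std_normal (R : realType) (f : R -> \bar R) :
  measurable_fun setT f ->
  (\int[normal_prob 0 1]_x `|f x| < +oo)%E ->
  (\int[normal_prob 0 1]_x f x =
   \int[lebesgue_measure]_x (f x * (normal_pdf 0 1 x)%:E))%E.
Proof.
move=> mf finf; have dom := @normal_prob_dominates R 0 1.
have mp : measurable_fun setT (EFin \o @normal_pdf R 0 1).
  by apply/measurable_EFinP; exact: measurable_normal_pdf.
rewrite -(Radon_Nikodym_change_of_variables dom)//=; last by apply/integrableP; split.
apply: ae_eq_integral => //.
- exact: emeasurable_funM.
- exact: emeasurable_funM.
- apply: ae_eqe_mul2l => /=.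
  rewrite Radon_NikodymE//=; case: cid => /= h [h1 h2 h3].
  by apply: integral_ae_eq => //= E E01 mE; rewrite -h3.
Qed.

(* [measurableTypeR R] and [R] carry their measurable structures through
   different paths; the identity random variable transports integrals. *)
Section StandardNormal.
Variable R : realType.
Let idR : measurableTypeR R -> R := idfun.
#[local] HB.instance Definition _ :=
  @isMeasurableFun.Build _ _ _ _ idR (@measurable_id _ _ setT).
Let id_RV : {RV (@normal_prob R 0 1) >-> R} := idR.

Lemma expectation_std_normal (disp : measure_display)
    (T : measurableType disp) (P : probability T R) (Z : {RV P >-> R})
    (f : R -> R) (M : R) :
  standard_normal Z -> continuous f -> (forall x, `|f x| <= M) ->
  ('E_P[f \o Z] = (\int[lebesgue_measure]_x (f x * normal_pdf 0 1 x)%R)%:E)%E.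
Proof.
move=> hZ cf fM; have M0 : 0 <= M by exact: le_trans (normr_ge0 _) (fM 0).
have mf : measurable_fun setT f by exact: measurable_realfun.continuous_measurable_fun.
have mfZ : measurable_fun setT (f \o Z) by exact: measurableT_comp.
have bd d0 (T0 : measurableType d0) (P0 : probability T0 R) (g : T0 -> R) :
    measurable_fun setT g -> (forall x, `|g x| <= M) ->
    P0.-integrable setT (EFin \o g).
  move=> mg gM; apply: measurable_bounded_integrable => //.
    exact: (le_lt_trans (probability_le1 P0 measurableT) (ltry 1)).
  by exists M; split; [exact: num_real|move=> x Mx t _; exact: le_trans (gM t) (ltW Mx)].
rewrite unlock.
have -> : (\int[P]_w ((f \o Z) w)%:E = \int[distribution P Z]_y (EFin \o f) y)%E.
  by rewrite integral_distribution//; [exact/measurable_EFinP|exact: bd].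
have if_ := bd _ _ (@normal_prob R 0 1) f mf fM.
have -> : (\int[distribution P Z]_y (EFin \o f) y =
    \int[distribution (@normal_prob R 0 1) id_RV]_y (EFin \o f) y)%E.
  by apply: eq_measure_integral => A mA _; exact: hZ.
rewrite integral_distribution//; last exact/measurable_EFinP.
rewrite -[LHS]/(\int[@normal_prob R 0 1]_x (EFin \o f) x)%E.
rewrite integral_std_normal//; last 2 first.
- exact/measurable_EFinP.
- by move/integrableP : if_ => [].
rewrite /Rintegral fineK; first by apply: eq_integral => x _; rewrite EFinM.
exact: (integrable_fin_num measurableT (integrable_bounded_pdf cf fM)).
Qed.

End StandardNormal.

(** * The norm of the local times: its variance and the constant [kappa] *)

Section RandomWalk.
Variables (R : realType) (disp : measure_display) (T : measurableType disp)
  (P : probability T R) (d : nat) (S : nat -> T -> 'rV[int]_d) (q : R).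
Hypothesis hd : (4 <= d)%N.
Hypothesis hS : simple_random_walk P S.
Hypothesis hq : 1 < q.
Let d0 : (0 < d)%N. Proof. exact: leq_trans hd. Qed.
Let V := ('I_d * bool)%type.
Let st := @srw_step d.
Let V0 : (0 < #|{: V}|)%N.
Proof. by rewrite card_prod card_ord card_bool muln_gt0 d0. Qed.
Let phi : nat -> R := npow q.
Let X : seq V -> R := occ_sum st phi.

Lemma local_time_visited n z w : local_time S n z w = count_mem z (visited S n w).
Proof.
rewrite /local_time /visited count_map -sum1_count [RHS]big_mkcond /index_iota subn0.
by apply: eq_bigr => k _ /=; case: (_ == _).
Qed.

Let norm_of (l : seq 'rV[int]_d) : R := \sum_(z <- undup l) phi (count_mem z l).

Lemma local_time_norm_visited n w : local_time_norm S q n w = norm_of (visited S n w).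
Proof.
rewrite /local_time_norm /norm_of [RHS]fsbig_seq ?undup_uniq// /phi /npow.
transitivity (\sum_(z \in [set: 'rV[int]_d]) (count_mem z (visited S n w))%:R `^ q : R).
  by apply: eq_fsbigr => z _; rewrite local_time_visited.
apply/esym; apply: fsbig_widen => // z /= [_ /negP].
rewrite mem_undup => /count_memPn ->.
by rewrite powR0// gt_eqF// (lt_trans ltr01).
Qed.

Let integral_walk n (H : seq 'rV[int]_d -> R) :=
  walk_integral d0 hS n H.

Lemma expectation_walk n (H : seq 'rV[int]_d -> R) (g : T -> R) :
  (forall w, g w = H (visited S n w)) ->
  ('E_P[g] = (Ex n (fun u => H (trail st 0 u)))%:E)%E.
Proof.
move=> gH; rewrite unlock -integral_walk; apply: eq_integral => w _.
by rewrite gH.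
Qed.

Lemma variance_local_time_norm n :
  fine 'V_P[local_time_norm S q n]%E = Ex n (fun u => centered X n u ^+ 2).
Proof.
have EX : ('E_P[local_time_norm S q n] = (mean X n)%:E)%E.
  exact: (@expectation_walk n norm_of _ (local_time_norm_visited n)).
rewrite /variance unlock EX /=.
rewrite (@expectation_walk n (fun l => (norm_of l - mean X n) ^+ 2)) => [//|w].
by rewrite !fctE /= local_time_norm_visited expr2.
Qed.

Let C : R := d%:R ^+ 2.
Let hkC n z : hk R st n z <= C / n.+1%:R ^+ 2 := hk_srw_le R hd n z.
Let inv (s : V) : V := (s.1, ~~ s.2).
Let invK : involutive inv.
Proof. by move=> [i b]; rewrite /inv /= negbK. Qed.
Let st_inv s : st (inv s) = - st s.
Proof. by case: s => i []; rewrite /st /srw_step /= ?opprK. Qed.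
Let C1 : 1 <= C. Proof. exact: (C_ge1 hkC). Qed.
(** Chosen so that [l * (2 * C) = 1/6], the threshold of the two-site moment bound. *)
Let l : R := (12 * C)^-1.
Let Cp : 0 < C. Proof. exact: lt_le_trans ltr01 C1. Qed.
Let l0 : 0 < l. Proof. by rewrite invr_gt0 mulr_gt0. Qed.
Let l1 : l <= 1. Proof.
have h : 1 <= 12 * C by apply: le_trans C1 _; rewrite ler_peMl ?(ltW Cp)// ler1n.
by rewrite /l invf_le1// mulr_gt0.
Qed.
Let lC : l * (2 * C) <= 1 / 6.
Proof.
by rewrite /l; apply: eq_ler; field; rewrite gt_eqF.
Qed.
Let phi0 : phi 0 = 0. Proof. exact: npow0. Qed.
Let phiD a b : phi a + phi b <= phi (a + b). Proof. exact: npow_superadd. Qed.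

Lemma cross_rate : exists K : R, forall a b,
  norm2 (a + b) (fun w => X w - X (take a w) - X (drop a w)) <= K * root4 R (a + b).
Proof.
have [K K0 HK] := npow_cross hq l0.
exists (96 * K * C) => a b.
have := norm2_cross V0 invK st_inv hkC l0 l1 lC K0 phi0 phiD HK a b.
apply: le_trans; apply: eq_ler; apply: eq_norm2 => w _.
by rewrite /cross_at /cross cat_take_drop.
Qed.

Lemma variance_lower_bound : exists (c0 : R) (N0 : nat), [/\ 0 < c0, (0 < N0)%N &
  forall b, b%:R * c0 <= Ex (b * N0) (fun w => centered X (b * N0) w ^+ 2)].
Proof.
have [A A0 HA] := npow_incr hq l0 l1.
have [n0 n00 Hn0] := npow_superlinear hq A.
pose e : V := (Ordinal d0, true).
have e_inj : injective (fun j => st e *+ j).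
  have H i : (st e *+ i) ord0 (Ordinal d0) = i%:Z.
    by rewrite mulmxnE /st /srw_step /= mxE !eqxx /= natz.
  by move=> j k /matrixP /(_ ord0 (Ordinal d0)); rewrite !H => -[].
exists (#|{: V}|%:R ^- n0.*2 * (phi n0 - 4 * A * n0.+1%:R) ^+ 2 / 2), n0.*2; split.
- by rewrite divr_gt0// mulr_gt0// ?exprn_gt0// invr_gt0 exprn_gt0// ltr0n.
- by rewrite double_gt0.
- move=> b.
  exact: (variance_ge V0 st_inv hkC l0 lC phi0 phiD (@npow_ge0 _ q) A0 HA e_inj b Hn0).
Qed.

Let escape_set n := [set w | 0 \notin behead (visited S n w)].

Lemma escape_cvg : (fun n => esc R st n) @ \oo --> escape_probability P S.
Proof.
have mE n : measurable (escape_set n).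
  exact: (measurable_visited hS n [set l | 0 \notin behead l]).
have PE n : P (escape_set n) = (esc R st n)%:E.
  rewrite -[LHS](_ : 'E_P[\1_(escape_set n)] = _)%E; last exact: expectation_indic.
  apply: (@expectation_walk n (fun l => (0 \notin behead l)%:R)) => w.
  by by rewrite indicE; congr ((nat_of_bool _)%:R); apply/idP/idP; rewrite ?inE.
have behE n w : behead (visited S n w) = [seq S k w | k <- iota 1 n.-1].
  by rewrite /visited; case: n.
have capE : \bigcap_n escape_set n = [set w | forall k, (1 <= k)%N -> S k w <> 0].
  apply/seteqP; split => w /= H.
    move=> k k1 Sk; have /negP := H k.+1 I; apply; rewrite behE.
    by apply/mapP; exists k => //; rewrite mem_iota; lia.
  move=> n _; rewrite /escape_set /= behE; apply/mapP => -[k].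
  by rewrite mem_iota => /andP[k1 _] E; apply: (H k k1); rewrite E.
have cv : P (escape_set n) @[n --> \oo] --> P [set w | forall k, (1 <= k)%N -> S k w <> 0].
  rewrite -capE; apply: (@nonincreasing_cvg_mu _ _ _ P escape_set) => //.
  - by rewrite (le_lt_trans (probability_le1 _ (mE _)))// ltry.
  - exact: bigcapT_measurable.
  - move=> m n mn; apply/subsetPset => w; rewrite /escape_set /= !behE.
    apply: contra => /mapP[k ki ->]; apply: map_f.
    by move: ki; rewrite !mem_iota; lia.
rewrite /escape_probability.
have -> : esc R st = fun n => fine (P (escape_set n)).
  by apply/funext => n; rewrite PE.
apply: fine_cvg; rewrite fineK// -capE fin_num_measure//.
exact: bigcapT_measurable.
Qed.

(** A dummy last letter makes the endpoint count as a visited site; this is the origin of the [n.+1]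
    in [returns_momentE]. *)
Lemma occS_loc_rcons x (u : seq V) s z : occ st x (rcons u s) z = occS st x u z.
Proof. by elim: u x => [|a u IH] x; rewrite ?rcons_cons occ_cons//= IH. Qed.

Lemma returns_momentE n :
  (\int[P]_w (phi (local_time S n.+1 0 w))%:E = (returns_moment st phi n)%:E)%E.
Proof.
transitivity (\int[P]_w (phi (count_mem 0 (visited S n.+1 w)))%:E)%E.
  by apply: eq_integral => w _; rewrite local_time_visited.
rewrite (integral_walk n.+1 (fun l => phi (count_mem 0 l))); congr (_%:E).
rewrite Ex_rcons; apply: eq_Ex => u _.
rewrite -[RHS](avg_cst V0); congr (_ * _); apply: eq_bigr => s _.
by rewrite -(occS_loc_rcons _ _ s).
Qed.

(** A nondecreasing sequence of integers is eventually constant or unbounded, and in both cases the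
    two limits can be read off. *)
Lemma limn_powR (u : nat -> nat) : {homo u : m n / (m <= n)%N} ->
  (limn (fun n => ((u n)%:R `^ q)%:E : \bar R) = (limn (fun n => (u n)%:R%:E : \bar R)) `^ q)%E.
Proof.
move=> uh; have [[N HN]|H] := pselect (exists N, forall n, (N <= n)%N -> u n = u N).
  have E (f : nat -> \bar R) : limn (f \o u) = f (u N).
    apply/cvg_lim => //; apply: cvg_near_cst.
    by exists N => // n /= Nn; rewrite HN.
  by rewrite (E (fun k => (k%:R `^ q)%:E)) (E (fun k => k%:R%:E)) poweR_EFin.
have ub m : \forall n \near \oo, (m <= u n)%N.
  suff [N HN] : exists N, (m <= u N)%N.
    by exists N => // n /= /uh; exact: leq_trans.
  elim: m => [|m [N HN]]; first by exists 0%N.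
  apply: contrapT => Hn; apply: H; exists N => n Nn.
  have h1 := uh _ _ Nn; have h2 : (u n <= m)%N.
    by rewrite leqNgt; apply/negP => h; apply: Hn; exists n.
  by apply/eqP; rewrite eqn_leq h1 andbT (leq_trans h2).
have -> : (limn (fun n => (u n)%:R%:E : \bar R) = +oo)%E.
  apply/cvg_lim => //; apply/cvgeyPge => A.
  near=> n; rewrite lee_fin; apply: (@le_trans _ _ (Num.truncn `|A|).+1%:R).
    apply: le_trans (ler_norm _) _; apply: ltW.
    by have /truncn_itv/andP[] := normr_ge0 A.
  by rewrite ler_nat; near: n; exact: ub.
rewrite poweRyr ?gt_eqF ?(lt_trans ltr01)//.
apply/cvg_lim => //; apply/cvgeyPge => A.
near=> n; rewrite lee_fin; apply: (@le_trans _ _ (Num.truncn `|A|).+1%:R).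
  apply: le_trans (ler_norm _) _; apply: ltW.
  by have /truncn_itv/andP[] := normr_ge0 A.
have h : ((Num.truncn `|A|).+1 <= u n)%N by near: n; exact: ub.
apply: (@le_trans _ _ (u n)%:R); first by rewrite ler_nat.
rewrite -{1}(@powRr1 _ (u n)%:R) ?ler0n// ler_powR ?ltW//.
by rewrite ltr1n; near: n; exact: ub.
Unshelve. all: by end_near. Qed.

(** Monotone convergence in the extended reals. The exponential moment at the origin bounds the
    truncated moments uniformly, so the limit is finite and [fine] loses nothing. *)
Lemma returns_moment_cvg : (fun n => returns_moment st phi n) @ \oo -->
  fine (\int[P]_w (local_time_oo R S w `^ q))%E.
Proof.
have lh w : {homo (fun n => local_time S n.+1 0 w) : m n / (m <= n)%N}.
  move=> m n mn; rewrite !local_time_visited /visited -(subnKC mn) -addSn iotaD map_cat.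
  by rewrite count_cat leq_addr.
have ooE w : (local_time_oo R S w = limn (fun n => (local_time S n.+1 0 w)%:R%:E))%E.
  rewrite /local_time_oo; apply/esym.
  have -> : (fun n => (local_time S n.+1 0 w)%:R%:E : \bar R) =
    (fun n => (\sum_(0 <= k < n.+1) ((S k w == 0)%:R : R)%:E)%E).
    by apply/funext => n; rewrite sumEFin /local_time natr_sum.
  have cv : cvgn (fun n => (\sum_(0 <= k < n) ((S k w == 0)%:R : R)%:E)%E).
    by apply: is_cvg_ereal_nneg_natsum => n _; rewrite lee_fin ler0n.
  apply/cvg_lim => //.
  rewrite (cvg_shiftS (fun n => (\sum_(0 <= k < n) ((S k w == 0)%:R : R)%:E)%E)).
  exact: cv.
have -> : (\int[P]_w (local_time_oo R S w `^ q) =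
    \int[P]_w limn (fun n => (phi (local_time S n.+1 0 w))%:E))%E.
  by apply: eq_integral => w _; rewrite ooE -limn_powR.
have cv := @cvg_monotone_convergence _ _ _ P setT measurableT
  (fun n w => (phi (local_time S n.+1 0 w))%:E).
have mphi n : measurable_fun setT (fun w => (phi (local_time S n.+1 0 w))%:E).
  apply/measurable_EFinP.
  have -> : (fun w => phi (local_time S n.+1 0 w)) =
     (fun w => (fun l : seq 'rV[int]_d => phi (count_mem 0 l)) (visited S n.+1 w)).
    by apply/funext => w; rewrite local_time_visited.
  exact: (measurable_fun_visited hS n.+1 (fun l => phi (count_mem 0 l))).
have {}cv := cv mphi.
have {}cv := cv (fun n w _ => npow_ge0 _ _ : (0%E <= (phi _)%:E)%E).
have {}cv := cv (fun w _ m n mn => phi_homo phiD (@npow_ge0 _ q) (lh w m n mn)).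
have bnd : exists B : R, forall n, returns_moment st phi n <= B.
  have [A A0 HA] := npow_le_exp hq l0.
  exists (A * (2 * l * (2 * C))) => n.
  apply: (@le_trans _ _ (Ex n (fun u => A * ((1 + l) ^+ occS st 0 u 0 - 1)))).
    by apply: le_Ex => u _; exact: HA.
  rewrite ExZ ler_wpM2l//; have l6 : l * (2 * C) <= 1 / 2 by apply: le_trans lC _; lra.
  apply: le_trans (exp_moment_occ V0 hkC n 0 0 l0 l6) _.
  by rewrite ler_wpM2l ?green_le// mulr_ge0// ltW.
move: cv; under eq_fun do rewrite returns_momentE.
set I := (\int[P]_w _)%E => cv.
have Ifin : I \is a fin_num.
  have [B HB] := bnd; rewrite fin_numE; apply/andP; split.
    by rewrite gt_eqF// (lt_le_trans ltNy0)// integral_ge0// => w _; apply: lime_ge;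
      [apply: ereal_nondecreasing_is_cvgn => m n mn;
        rewrite lee_fin; exact: (phi_homo phiD (@npow_ge0 _ q) (lh w m n mn))
      |near=> n; rewrite lee_fin npow_ge0].
  rewrite lt_eqF// (@le_lt_trans _ _ B%:E) ?ltry//.
  rewrite -(cvg_lim _ cv)//; apply: lime_le; first by apply/cvg_ex; exists I.
  by near=> n; rewrite lee_fin.
have cv' : (fun n => (returns_moment st phi n)%:E) @ \oo --> (fine I)%:E by rewrite fineK.
exact: (fine_cvg cv').
Unshelve. all: by end_near. Qed.

Lemma mean_cvg_kappa : (fun n => mean X n / n%:R) @ \oo --> kappa P S q.
Proof.
have -> : (fun n => mean X n / n%:R) =
   (fun n => (\sum_(k < n) returns_moment st phi k * esc R st (n - k)) / n%:R).
  by apply/funext => n; rewrite (mean_convolution st phi).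
rewrite /kappa mulrC; apply: convolution_cvg.
  exact: returns_moment_cvg.
exact: escape_cvg.
Qed.

End RandomWalk.

Theorem theorem1p9 (R : realType)
    (disp : measure_display) (T : measurableType disp) (P : probability T R)
    (d : nat) (S : nat -> T -> 'rV[int]_d) (q : R)
    (disp' : measure_display) (T' : measurableType disp')
    (P' : probability T' R) (Z : {RV P' >-> R})
    (hd : (4 <= d)%N) (hS : simple_random_walk P S) (hq : 1 < q)
    (hZ : standard_normal Z) :
  cvg_in_law P P'
    (fun (n : nat) (w : T) =>
       (local_time_norm S q n w - n%:R * kappa P S q)
       / Num.sqrt (n%:R * limit_variance P S q))
    Z.
Proof.
have V0 : (0 < #|{: 'I_d * bool}|)%N.
  by rewrite card_prod card_ord card_bool muln_gt0 (leq_trans _ hd).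
have [K crK] := cross_rate hd hq.
have [c0 [N0 [c00 N00 var_ge]]] := variance_lower_bound hd hq.
have [v v0 vl] := variance_cvg V0 crK c00 N00 var_ge.
have vE : limit_variance P S q = v.
  rewrite /limit_variance; apply/cvg_lim => //.
  under eq_fun do rewrite (variance_local_time_norm hd hS hq).
  exact: vl.
have meanC := mean_rate V0 crK (mean_cvg_kappa hd hS hq).
move=> f cf [M fM]; rewrite (expectation_std_normal hZ cf fM) vE.
have cvw := clt_words V0 crK v0 vl meanC cf fM.
under eq_fun => n.
  rewrite (@expectation_walk _ _ _ _ _ _ hd hS n (fun l =>
    f ((\sum_(z <- undup l) npow q (count_mem z l) - n%:R * kappa P S q)
       / Num.sqrt (n%:R * v)))); last first.
    by move=> w /=; rewrite (local_time_norm_visited S hq).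
  over.
apply: cvg_EFin; [exact: nearW|exact: cvw].
Qed.
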